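(* Let $g(t)$ be a Regge metric on $\mathcal S$ depending smoothly on $t$, and let $\sigma=\frac{\partial}{\partial t}g$. Then for every $v\in V$, $$\frac{d}{dt}\langle (\kappa\omega)_{\rm dist}(g),v\rangle_{V',V}=\frac12\, b_h(g;\sigma,v),$$ where $$b_h(g;\sigma,v)=\sum_{T\in\mathcal T_h}\langle S\sigma,\operatorname{Hess}v\rangle_{g,T}+\sum_{e\in\mathcal E_h}\big\langle \sigma(\tau,\tau),\llbracket\nabla_n v\rrbracket\big\rangle_{g,e}.$$
   Context: Let $\mathcal S$ be a finite triangulation of an oriented two-dimensional manifold (possibly with boundary $\partial\mathcal S$), with sets $\mathcal T_h,\mathcal E_h,\mathcal V_h$ of (closed) triangles, edges and vertices. $\mathcal V_h^0$ is the set of vertices not on $\partial\mathcal S$; $\mathcal E_h^0$ is the set of interior edges, i.e. edges not contained in $\partial\mathcal S$, each of which is shared by two triangles. For an edge $e\subset\partial T$, $i_{T,e}:e\hookrightarrow T$ is the inclusion. A Regge metric is a collection $g=(g_T)_{T\in\mathcal T_h}$ of smooth Riemannian metrics $g_T$ on the triangles $T$ with $i_{T_1,e}^*g_{T_1}=i_{T_2,e}^*g_{T_2}$ for every $e=T_1\cap T_2\in\mathcal E_h^0$. ''Depending smoothly on $t$'' means each $g_T(t)$ does. On each triangle $T$ all operators are those of $g_T$: $\nabla$ is the Levi-Civita connection, $\omega$ the volume form, $\operatorname{Hess}v=\nabla\nabla v$, $S\sigma=\sigma-g\operatorname{Tr}\sigma$, and $\langle\cdot,\cdot\rangle_{g,T}=\int_T\langle\cdot,\cdot\rangle_g\,\omega$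 (with $\langle\cdot,\cdot\rangle_g$ the pointwise inner product of tensors). On an edge $e\subset\partial T$, $n$ and $\tau$ are the $g_T$-unit outward normal and $g_T$-unit tangent with $(n,\tau)$ right-handed; $\langle u,v\rangle_{g,e}=\int_e uv\,ds$ with $ds$ the $g$-length element of $e$. For a quantity $q$ having a value from each adjacent triangle (computed with that triangle's metric, $n$ and $\tau$), $\llbracket q\rrbracket=q|_{T_1}+q|_{T_2}$ on an interior edge $e=T_1\cap T_2$, and $\llbracket q\rrbracket=q$ on an edge in $\partial\mathcal S$. $V=\{v\in\prod_T H^2(T): v_{T_1}|_e=v_{T_2}|_e\ \forall e=T_1\cap T_2\in\mathcal E_h^0,\ v|_{\partial\mathcal S}=0\}$, with dual $V'$. The distributional curvature two-form $(\kappa\omega)_{\rm dist}(g)\in V'$ is $$\langle(\kappa\omega)_{\rm dist}(g),v\rangle_{V',V}=\sum_{T\in\mathcal T_h}\langle\kappa_T(g),v\rangle_{g,T}+\sum_{e\in\mathcal E_h^0}\langle\llbracket k_e(g)\rrbracket,v\rangle_{g,e}+\sum_{z\in\mathcal V_h^0}\Theta_z(g)v(z),$$ where $\kappa_T(g)$ is the Gaussian curvature of $g_T$, $k_e(g_T)=-g_T(n,\nabla_\tau\tau)$ is the geodesic curvature of $e$, and $\Theta_z(g)=2\pi-\sum_{T\ni z}\theta_{zT}$ with $\theta_{zT}$ the interior angle of $T$ at $z$ measured by $g_T$. *)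

(* Defs.v *)
From HB Require Import structures.
From mathcomp Require Import all_boot all_order all_algebra.
From mathcomp Require Import all_classical all_reals all_analysis.

Set Implicit Arguments.
Unset Strict Implicit.
Unset Printing Implicit Defensive.

Import Order.TTheory GRing.Theory Num.Theory.
Import numFieldNormedType.Exports.

Local Open Scope classical_set_scope.
Local Open Scope ring_scope.

(** The surface is the geometric realization of a finite simplicial complex,
    up to the homeomorphism of a (smooth) triangulation.  The complex is given
    by the list of its triangles, each with its vertices enumerated
    counterclockwise.  A pair [(T, i)] stands for the [i]-th edge of [T], which
    runs counterclockwise from the [i]-th vertex to the next one, and also for
    the corner of [T] at its [i]-th vertex. *)

Record triangulation := Triangulation {
  vert : finType;
  tri : finType;
  corner_vert : tri -> 'I_3 -> vert;
  vset (T : tri) : {set vert} := [set corner_vert T i | i in 'I_3]%SET;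
  corner_vert_inj : forall T, injective (corner_vert T);
  vset_inj : injective vset;
  vert_covered : forall z, exists T, z \in vset T;
  (* An oriented edge bounds at most one triangle on its left: hence an edge
     lies in at most two triangles, which then induce opposite orientations
     on it. *)
  coherent : forall (T T' : tri) (i j : 'I_3),
    corner_vert T i = corner_vert T' j ->
    corner_vert T (ordS i) = corner_vert T' (ordS j) -> (T, i) = (T', j);
  (* The link of a vertex is connected, hence it is a cycle or a path. *)
  link_connected : forall (z : vert) (T T' : tri),
    z \in vset T -> z \in vset T' ->
    connect (fun T1 T2 => [exists w, (w != z) &&
      ([set z; w]%SET \subset vset T1 :&: vset T2)]) T T'
}.

Section Complex.
Variable S : triangulation.

Definition side : finType := (tri S * 'I_3)%type.

Definition org (h : side) : vert S := corner_vert h.1 h.2.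

Definition edge_of (h : side) : {set vert S} :=
  [set corner_vert h.1 h.2; corner_vert h.1 (ordS h.2)]%SET.

Definition edges : {set {set vert S}} := [set edge_of h | h in {: side}]%SET.

Definition sides_of (E : {set vert S}) : {set side} :=
  [set h | edge_of h == E]%SET.

Definition int_edges : {set {set vert S}} :=
  [set E in edges | #|sides_of E| == 2%N]%SET.

Definition bnd_edges : {set {set vert S}} :=
  [set E in edges | #|sides_of E| == 1%N]%SET.

Definition int_verts : {set vert S} :=
  [set z | [forall E in bnd_edges, z \notin E]]%SET.

End Complex.

Section Reference.
Variable R : realType.

Definition coord (i : 'I_2) (u : R * R) : R := if i == 0 then u.1 else u.2.

Definition bvec (i : 'I_2) : R * R := ((i == 0)%:R, (i == 1)%:R).

Definition tri_ref : set (R * R) :=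
  [set p | [/\ 0 <= p.1, 0 <= p.2 & p.1 + p.2 <= 1]].

Definition corner (i : 'I_3) : R * R :=
  ((i == 1%N :> nat)%:R, (i == 2%N :> nat)%:R).

Definition edge_vec (i : 'I_3) : R * R := corner (ordS i) - corner i.

Definition edge_pt (i : 'I_3) (s : R) : R * R := corner i + s *: edge_vec i.

(* Euclidean outward conormal of the [i]-th edge in coordinates: the edge
   vector rotated clockwise. *)
Definition conormal (i : 'I_3) : R * R := ((edge_vec i).2, - (edge_vec i).1).

Fixpoint Ck (W : normedModType R) (k : nat) (U : set W) (f : W -> R) : Prop :=
  (forall x, U x -> {for x, continuous f}) /\
  if k is k'.+1 then
    forall w : W, (forall x, U x -> derivable f x w) /\ Ck k' U ('D_w f)
  else True.

Definition smooth (W : normedModType R) (U : set W) (f : W -> R) : Prop :=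
  forall k, Ck k U f.

Definition leb : {measure set (measurableTypeR R) -> \bar R} :=
  lebesgue_measure.

Definition leb2 : {measure set (measurableTypeR R * measurableTypeR R)
                     -> \bar R} := (leb \x leb)%E.

Definition L2 d (X : measurableType d) (mu : {measure set X -> \bar R})
    (D : set X) (u : X -> R) : Prop :=
  measurable_fun D u /\ finite_norm mu 2%:E (u \_ D).

Definition L2_cvg d (X : measurableType d) (mu : {measure set X -> \bar R})
    (D : set X) (u_ : nat -> X -> R) (u : X -> R) : Prop :=
  'N[mu]_(2%:E)[EFin \o ((u_ n \- u)%R \_ D)]%E @[n --> \oo] --> 0%E.

Definition test_fun (phi : R * R -> R) : Prop :=
  smooth setT phi /\
  exists K : set (R * R), [/\ compact K, K `<=` tri_ref^° &
    forall p, ~ K p -> phi p = 0].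

Definition weak_deriv (i : 'I_2) (u w : R * R -> R) : Prop :=
  forall phi, test_fun phi ->
    \int[leb2]_(p in tri_ref) (u p * 'D_(bvec i) phi p) =
    - \int[leb2]_(p in tri_ref) (w p * phi p).

Definition is_H2 (v : R * R -> R) (G : 'I_2 -> R * R -> R)
    (H : 'I_2 -> 'I_2 -> R * R -> R) : Prop :=
  [/\ L2 leb2 tri_ref v,
      forall i, L2 leb2 tri_ref (G i),
      forall i j, L2 leb2 tri_ref (H i j),
      forall i, weak_deriv i v (G i) &
      forall i j, weak_deriv j (G i) (H i j)].

(* The trace of the gradient on the boundary is the continuous extension, from
   smooth functions to all of H^2, of the restriction of the gradient to each
   edge; [tr h i] is the [i]-th component of the trace on the [h]-th edge. *)
Definition is_grad_trace (v : R * R -> R) (G : 'I_2 -> R * R -> R)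
    (H : 'I_2 -> 'I_2 -> R * R -> R) (tr : 'I_3 -> 'I_2 -> R -> R) : Prop :=
  exists phi : nat -> R * R -> R,
  [/\ forall n, smooth setT (phi n),
      L2_cvg leb2 tri_ref phi v,
      forall i, L2_cvg leb2 tri_ref (fun n => 'D_(bvec i) (phi n)) (G i),
      forall i j, L2_cvg leb2 tri_ref
        (fun n => 'D_(bvec j) ('D_(bvec i) (phi n))) (H i j) &
      forall h i, L2_cvg leb `[0, 1]
        (fun n s => 'D_(bvec i) (phi n) (edge_pt h s)) (tr h i)].

(* An element of H^2(T): its continuous representative, bundled with its weak
   first and second derivatives and the trace of its gradient, which are
   determined by it almost everywhere. *)
Record H2fun := H2Fun {
  h2_val :> R * R -> R;
  h2_grad : 'I_2 -> R * R -> R;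
  h2_hess : 'I_2 -> 'I_2 -> R * R -> R;
  h2_trace : 'I_3 -> 'I_2 -> R -> R;
  h2_cont : {within tri_ref, continuous h2_val};
  h2_is_H2 : is_H2 h2_val h2_grad h2_hess;
  h2_trace_L2 : forall h i, L2 leb `[0, 1] (h2_trace h i);
  h2_is_trace : is_grad_trace h2_val h2_grad h2_hess h2_trace
}.

Definition metric := R * R -> 'M[R]_2.

Definition bil (A : 'M[R]_2) (u w : R * R) : R :=
  \sum_i \sum_j A i j * coord i u * coord j w.

Definition normalize (A : 'M[R]_2) (u : R * R) : R * R :=
  (Num.sqrt (bil A u u))^-1 *: u.

Definition raise (A : 'M[R]_2) (nu : R * R) : R * R :=
  \sum_k (\sum_l invmx A k l * coord l nu) *: bvec k.

Definition riemannian (g : metric) : Prop :=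
  forall p, tri_ref p ->
    (g p)^T = g p /\ forall u, u != 0 -> 0 < bil (g p) u u.

Section Metric.
Variable g : metric.

Definition christoffel (k i j : 'I_2) (p : R * R) : R :=
  2^-1 * \sum_l invmx (g p) k l *
    ('D_(bvec i) (fun q => g q j l) p + 'D_(bvec j) (fun q => g q i l) p
     - 'D_(bvec l) (fun q => g q i j) p).

(* [riem l k i j] is the component along d_l of R(d_i, d_j) d_k, where
   R(X, Y) = [nabla_X, nabla_Y] - nabla_[X, Y]. *)
Definition riem (l k i j : 'I_2) (p : R * R) : R :=
  'D_(bvec i) (christoffel l j k) p - 'D_(bvec j) (christoffel l i k) p
  + \sum_m (christoffel l i m p * christoffel m j k p
            - christoffel l j m p * christoffel m i k p).

Definition gauss_curv (p : R * R) : R :=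
  (\sum_l g p l 0 * riem l 1 0 1 p) / \det (g p).

Definition vol (p : R * R) : R := Num.sqrt (\det (g p)).

Definition inner2 (p : R * R) (A B : 'M[R]_2) : R :=
  \sum_i \sum_j \sum_k \sum_l
    invmx (g p) i k * invmx (g p) j l * A i j * B k l.

Definition tr_g (p : R * R) (A : 'M[R]_2) : R :=
  \sum_i \sum_j invmx (g p) i j * A i j.

Definition S_op (p : R * R) (A : 'M[R]_2) : 'M[R]_2 := A - tr_g p A *: g p.

Definition hess (v : H2fun) (p : R * R) : 'M[R]_2 :=
  \matrix_(i, j) (h2_hess v i j p
                  - \sum_k christoffel k i j p * h2_grad v k p).

(* Unit tangent and outward unit normal of the [h]-th edge.  Both are given by
   formulas that make sense at every point [p], not only on the edge. *)
Definition tau (h : 'I_3) (p : R * R) : R * R := normalize (g p) (edge_vec h).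

Definition nor (h : 'I_3) (p : R * R) : R * R :=
  normalize (g p) (raise (g p) (conormal h)).

Definition nabla_tau_tau (h : 'I_3) (p : R * R) : R * R :=
  \sum_k ('D_(tau h p) (fun q => coord k (tau h q)) p
    + \sum_i \sum_j christoffel k i j p * coord i (tau h p) * coord j (tau h p))
    *: bvec k.

Definition geod_curv (h : 'I_3) (p : R * R) : R :=
  - bil (g p) (nor h p) (nabla_tau_tau h p).

(* ds in terms of the parameter of [edge_pt h] *)
Definition len (h : 'I_3) (s : R) : R :=
  Num.sqrt (bil (g (edge_pt h s)) (edge_vec h) (edge_vec h)).

Definition normal_deriv (v : H2fun) (h : 'I_3) (s : R) : R :=
  \sum_i coord i (nor h (edge_pt h s)) * h2_trace v h i s.

Definition angle (i : 'I_3) : R :=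
  let A := g (corner i) in
  let u := edge_vec i in
  let w := corner (ordS (ordS i)) - corner i in
  acos (bil A u w / (Num.sqrt (bil A u u) * Num.sqrt (bil A w w))).

End Metric.
End Reference.

Section Regge.
Variables (R : realType) (S : triangulation).

(* If [h] and [h'] are sides of the same edge, [edge_pt h.2 s] and
   [edge_pt h'.2 (transfer h h' s)] are the coordinates of the same point in
   the two adjacent triangles. *)
Definition transfer (h h' : side S) (s : R) : R :=
  if org h' == org h then s else 1 - s.

(* Only the restriction of [g T] to the reference triangle is meaningful;
   outside, it is an arbitrary extension. *)
Definition tri_metric := tri S -> metric R.

Definition tt_continuous (g : tri_metric) : Prop :=
  forall h h' : side S, edge_of h = edge_of h' ->
  forall s : R, 0 <= s <= 1 ->
    bil (g h.1 (edge_pt h.2 s)) (edge_vec R h.2) (edge_vec R h.2) =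
    bil (g h'.1 (edge_pt h'.2 (transfer h h' s)))
        (edge_vec R h'.2) (edge_vec R h'.2).

(* [g t T] is smooth in time and space up to the boundary of the triangle,
   i.e. on a neighbourhood of ]a, b[ x T. *)
Definition smooth_family (a b : R) (g : R -> tri_metric) : Prop :=
  forall T : tri S, exists U : set (R * (R * R)),
  [/\ open U,
      forall t p, a < t < b -> tri_ref p -> U (t, p) &
      forall i j, smooth U (fun z => g z.1 T z.2 i j)].

Definition regge_family (a b : R) (g : R -> tri_metric) : Prop :=
  smooth_family a b g /\
  forall t, a < t < b -> (forall T, riemannian (g t T)) /\ tt_continuous (g t).

Definition time_deriv (g : R -> tri_metric) (t : R) (T : tri S) (p : R * R) :
    'M[R]_2 := \matrix_(i, j) derive1 (fun s => g s T p i j) t.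

Record V_space := VSpace {
  V_fun :> tri S -> H2fun R;
  V_single_valued : forall h h' : side S, edge_of h = edge_of h' ->
    forall s, 0 <= s <= 1 ->
      V_fun h.1 (edge_pt h.2 s) = V_fun h'.1 (edge_pt h'.2 (transfer h h' s));
  V_bnd0 : forall h : side S, edge_of h \in bnd_edges S ->
    forall s, 0 <= s <= 1 -> V_fun h.1 (edge_pt h.2 s) = 0
}.

(* Value at a vertex, read off in any triangle that contains it. *)
Definition vert_val (v : V_space) (z : vert S) : R :=
  if [pick h : side S | org h == z] is Some h then v h.1 (corner R h.2) else 0.

(* [q h s] is the value, from the triangle of [h], at the point [s] of the side
   [h]; the jump on the edge of [h] is parametrized as [h]. *)
Definition jump (q : side S -> R -> R) (h : side S) (s : R) : R :=
  \sum_(h' in sides_of (edge_of h)) q h' (transfer h h' s).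

(* Integral over an edge of a single-valued function, computed from any of
   its sides. *)
Definition edge_integral (g : tri_metric) (E : {set vert S})
    (f : side S -> R -> R) : R :=
  if [pick h in sides_of E] is Some h
  then \int[leb R]_(s in `[0, 1]) (f h s * len (g h.1) h.2 s) else 0.

Definition tri_integral (g : tri_metric) (T : tri S) (f : R * R -> R) : R :=
  \int[leb2 R]_(p in @tri_ref R) (f p * vol (g T) p).

Definition angle_defect (g : tri_metric) (z : vert S) : R :=
  2 * pi - \sum_(h : side S | org h == z) angle (g h.1) h.2.

Definition kappa_dist (g : tri_metric) (v : V_space) : R :=
  \sum_(T : tri S) tri_integral g T (fun p => gauss_curv (g T) p * v T p)
  + \sum_(E in int_edges S) edge_integral g E (fun h s =>
      jump (fun h' s' => geod_curv (g h'.1) h'.2 (edge_pt h'.2 s')) h s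
      * v h.1 (edge_pt h.2 s))
  + \sum_(z in int_verts S) angle_defect g z * vert_val v z.

Definition b_h (g : tri_metric) (sigma : tri S -> R * R -> 'M[R]_2)
    (v : V_space) : R :=
  \sum_(T : tri S) tri_integral g T (fun p =>
    inner2 (g T) p (S_op (g T) p (sigma T p)) (hess (g T) (v T) p))
  + \sum_(E in edges S) edge_integral g E (fun h s =>
      let p := edge_pt h.2 s in
      bil (sigma h.1 p) (tau (g h.1) h.2 p) (tau (g h.1) h.2 p)
      * jump (fun h' s' => normal_deriv (g h'.1) (v h'.1) h'.2 s') h s).

End Regge.

(* Main.v *)
Require Import Defs.
From mathcomp Require Import all_boot all_order all_algebra.
From mathcomp Require Import all_classical all_reals all_analysis.
From mathcomp Require Import measurable_realfun.
From mathcomp Require Import ring lra.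
Import Defs.
Import Order.TTheory GRing.Theory Num.Theory.
Import numFieldNormedType.Exports.
Local Open Scope classical_set_scope.
Local Open Scope ring_scope.

Set Implicit Arguments.
Unset Strict Implicit.
Unset Printing Implicit Defensive.

(** The formula is local: it already holds on each single triangle T, for every v in H^2(T), and no
    cancellation between triangles takes place. Let M^{ij} = sqrt(det g) (S sigma)^{ij}, a tensor
    density, and let P^k = d_j M^{kj} + Gamma^k_{ij} M^{ij} be its covariant divergence. On an edge
    let e be the edge vector and nu = (e.2, - e.1) its Euclidean conormal. Four pointwise facts
    carry the proof: d/dt (kappa omega) = 1/2 d_k P^k ([kapvolE_time]); d/dt (k_e ds) = - 1/2 P.nu -
    1/2 d_e (sigma(n, tau)) ([geodE_time]); the angle at a corner changes at half the difference of
    the values of sigma(n, tau) on the two edges that meet there ([angle_time]); (S sigma)(n, grad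
    v) + sigma(tau, tau) d_n v = sigma(n, tau) d_tau v ([momE_conormal], [boundary_pointwise]).

    Integrating <S sigma, Hess v> by parts twice gives twice the integral of v d/dt (kappa omega),
    plus the boundary integrals of M(nu, grad v) - v P.nu. Adding the edge term sigma(tau, tau) d_n
    v of [b_h] turns M(nu, grad v) into sigma(n, tau) d_tau v. One more integration by parts, along
    the edge, leaves - v d_e (sigma(n, tau)), which together with - v P.nu is 2 v d/dt (k_e ds), and
    values at the endpoints. Collected by corner, these are - 2 v times the time derivative of the
    angles ([edge_load_integral], [tri_part_derive]).

    In the sum over triangles, [v] vanishes on the boundary, so boundary edges and boundary vertices
    contribute nothing to the curvature; the terms 2 pi v(z) are constant in time
    ([kappa_dist_tri_part]). Tangential-tangential continuity makes ds and sigma(tau, tau)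
    single-valued, so that jump terms split into one integral per side ([b_hE]).

    Two devices make this rigorous. The geometric quantities are represented by symbolic expressions
    in the partial derivatives of the metric, with a symbolic derivative ([is_derive_evalf]); the
    evolution formulas then become identities of rational functions. And since [v] is only H^2, the
    Green formulas are proved for C^1 functions and carried over by smooth approximants. Integrals
    over T and gradient traces pass to the limit by L^1 convergence, but the values of [v] on the
    edges require uniform convergence there ([approximants_edge]), which comes from a Sobolev-type
    bound on rectangles ([rect_point_bound]). *)

(** * Linearity of real-valued integrals *)

Section Integrable.
Context {R : realType} d {Y : measurableType d}.
Variables (mu : {measure set Y -> \bar R}) (B : set Y) (mB : measurable B).

Lemma integrable_add (u w : Y -> R) : mu.-integrable B (EFin \o u) -> mu.-integrable B (EFin \o w) ->
  mu.-integrable B (EFin \o (fun y => u y + w y)).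
Proof. by move=> iu iw; exact: (integrableD mB iu iw). Qed.

Lemma integrable_sub (u w : Y -> R) : mu.-integrable B (EFin \o u) -> mu.-integrable B (EFin \o w) ->
  mu.-integrable B (EFin \o (fun y => u y - w y)).
Proof. by move=> iu iw; exact: (integrableB mB iu iw). Qed.

Lemma integrable_scale (c : R) (u : Y -> R) : mu.-integrable B (EFin \o u) ->
  mu.-integrable B (EFin \o (fun y => c * u y)).
Proof. by move=> iu; exact: (integrableZl mB c iu). Qed.

Lemma Rintegral_add (u w : Y -> R) : mu.-integrable B (EFin \o u) -> mu.-integrable B (EFin \o w) ->
  \int[mu]_(y in B) (u y + w y) = \int[mu]_(y in B) u y + \int[mu]_(y in B) w y.
Proof. by move=> iu iw; exact: RintegralD. Qed.

Lemma Rintegral_sub (u w : Y -> R) : mu.-integrable B (EFin \o u) -> mu.-integrable B (EFin \o w) ->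
  \int[mu]_(y in B) (u y - w y) = \int[mu]_(y in B) u y - \int[mu]_(y in B) w y.
Proof. by move=> iu iw; exact: RintegralB. Qed.

Lemma Rintegral_scale (c : R) (u : Y -> R) : mu.-integrable B (EFin \o u) ->
  \int[mu]_(y in B) (c * u y) = c * \int[mu]_(y in B) u y.
Proof. by move=> iu; exact: RintegralZl. Qed.

End Integrable.

Lemma Rintegral_eq0 (R : realType) d (Y : measurableType d) (mu : {measure set Y -> \bar R})
    (B : set Y) (f : Y -> R) : {in B, forall y, f y = 0} -> \int[mu]_(y in B) f y = 0.
Proof. by move=> f0; rewrite (eq_Rintegral mu f0) /Rintegral integral0. Qed.

Lemma Rintegral_bigsum (R : realType) d (Y : measurableType d) (mu : {measure set Y -> \bar R})
    (B : set Y) (I : Type) (r : seq I) (P : pred I) (F : I -> Y -> R) : measurable B ->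
  (forall i, P i -> mu.-integrable B (EFin \o F i)) ->
  mu.-integrable B (EFin \o (fun y => \sum_(i <- r | P i) F i y)) /\
  \int[mu]_(y in B) (\sum_(i <- r | P i) F i y) = \sum_(i <- r | P i) \int[mu]_(y in B) F i y.
Proof.
move=> mB iF; elim: r => [|i r [IH1 IH2]].
  split; last by rewrite big_nil Rintegral_eq0// => y _; rewrite big_nil.
  have := integrable0 mu B; congr (integrable _ _ _).
  by apply/funext => y; rewrite /= big_nil.
have E y : \sum_(j <- i :: r | P j) F j y =
    if P i then F i y + \sum_(j <- r | P j) F j y else \sum_(j <- r | P j) F j y by rewrite big_cons.
have -> : (fun y => \sum_(j <- i :: r | P j) F j y) =
    fun y => if P i then F i y + \sum_(j <- r | P j) F j y else \sum_(j <- r | P j) F j y.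
  by apply/funext => y; exact: E.
rewrite big_cons; case: ifP => // Pi; split; first exact: (integrable_add mB (iF i Pi) IH1).
by rewrite (Rintegral_add mB (iF i Pi) IH1) IH2.
Qed.

(** * Directional derivatives: additivity in the direction, symmetry of second derivatives *)

Section Directional.
Variables (R : realType) (W : normedModType R).
Implicit Types (f : W -> R) (z u w : W) (U : set W).

Lemma is_derive_scale f z w (c d : R) :
  is_derive z w f d -> is_derive z (c *: w) f (c * d).
Proof.
move=> [df <-]; have [->|c0] := eqVneq c 0.
  by rewrite scale0r mul0r; exact: is_derive0.
have E : (fun h : R => h^-1 *: ((f \o shift z) (h *: (c *: w)) - f z)) =
   (fun k => c * (k^-1 *: ((f \o shift z) (k *: w) - f z))) \o (fun h => h * c).
  apply/funext => h /=; rewrite scalerA.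
  have [->|h0] := eqVneq h 0; first by rewrite mul0r invr0 !scale0r mulr0.
  by rewrite /GRing.scale /= !mulrA invfM [in RHS](mulrC c) -(mulrA h^-1) mulVf ?mulr1.
have cv : (fun k => c * (k^-1 *: ((f \o shift z) (k *: w) - f z))) @ 0^' -->
    c * 'D_w f z.
  by apply: cvgM; [exact: cvg_cst|exact: df].
have sub : (fun h : R => h * c) @ 0^' --> 0^'.
  move=> A /= [e e0 Ae].
  have e'0 : 0 < e / `|c| by rewrite divr_gt0 ?normr_gt0.
  exists (e / `|c|) => //= h; rewrite /ball_ /= sub0r normrN => he h0.
  apply: Ae; last by rewrite mulf_neq0.
  by rewrite /ball_ /= sub0r normrN normrM -ltr_pdivlMr ?normr_gt0.
have := @cvg_comp _ _ _ _ _ _ _ _ sub cv; rewrite -E => cE.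
split; first by apply/cvg_ex; exists (c * 'D_w f z).
exact: (cvg_lim _ cE).
Qed.

Lemma is_derive_line f z w d (s : R) :
  is_derive (s *: w + z) w f d -> is_derive s 1 (fun r => f (r *: w + z)) d.
Proof.
move=> [df <-].
have E : (fun h : R => h^-1 *: (((fun r => f (r *: w + z)) \o shift s) (h *: (1:R)) - f (s *: w + z)))
   = (fun h : R => h^-1 *: ((f \o shift (s *: w + z)) (h *: w) - f (s *: w + z))).
  by apply/funext => h /=; rewrite [h *: (1 : R)]mulr1 scalerDl addrA.
split; first by rewrite /derivable E.
by rewrite /derive E.
Qed.

Lemma line_derive f z w d (s : R) :
  is_derive s 1 (fun r => f (r *: w + z)) d -> is_derive (s *: w + z) w f d.
Proof.
move=> [df <-].
have E : (fun h : R => h^-1 *: (((fun r => f (r *: w + z)) \o shift s) (h *: (1:R)) - f (s *: w + z)))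
   = (fun h : R => h^-1 *: ((f \o shift (s *: w + z)) (h *: w) - f (s *: w + z))).
  by apply/funext => h /=; rewrite [h *: (1 : R)]mulr1 scalerDl addrA.
split; first by move: df; rewrite /derivable E.
by rewrite /derive E.
Qed.

Lemma is_derive_comp_real (phi : R -> R) f z w (d d' : R) :
  is_derive (f z) 1 phi d' -> is_derive z w f d -> is_derive z w (phi \o f) (d' * d).
Proof.
have E : z = 0 *: w + z by rewrite scale0r add0r.
move=> dphi; rewrite {1}E => /is_derive_line df; rewrite E; apply: line_derive.
by apply: is_derive1_comp; rewrite ?scale0r ?add0r.
Qed.

(* The mean value theorem on the segment from [z] to [z + h w]. *)
Lemma MVT_line f z w (h : R) : 0 < h ->
  (forall s, 0 <= s <= h -> derivable f (s *: w + z) w) ->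
  exists2 c, 0 <= c <= h & f (h *: w + z) - f z = h * 'D_w f (c *: w + z).
Proof.
move=> h0 df.
have D s : 0 <= s <= h -> is_derive s 1 (fun r => f (r *: w + z)) ('D_w f (s *: w + z)).
  by move=> /df fs; apply: is_derive_line; exact: derivableP.
have [||c ch E] := @MVT _ (fun r => f (r *: w + z)) (fun s => 'D_w f (s *: w + z)) 0 h h0.
- by move=> x; rewrite in_itv /= => /andP[/ltW ? /ltW ?]; apply: D; apply/andP.
- apply: derivable_within_continuous => x; rewrite in_itv /= => xh.
  by have [] := D _ xh.
- exists c; first by move: ch; rewrite in_itv /= => /andP[/ltW -> /ltW ->].
  by move: E; rewrite scale0r add0r subr0 mulrC.
Qed.

Lemma near_plane z u w (A : set W) : nbhs z A ->
  exists2 d : R, 0 < d & forall x y, `|x| <= d -> `|y| <= d -> A (x *: u + (y *: w + z)).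
Proof.
move=> zA.
have : {for (0 : R, 0 : R), continuous (fun p : R * R => p.1 *: u + (p.2 *: w + z))}.
  apply: cvgD; first by apply: cvgZ; [exact: cvg_fst|exact: cvg_cst].
  apply: cvgD; last exact: cvg_cst.
  by apply: cvgZ; [exact: cvg_snd|exact: cvg_cst].
move=> /(_ A) /=; rewrite !scale0r !add0r => /(_ zA).
move=> /nbhs_ballP[d /= d0 dA].
exists (d / 2); first by rewrite divr_gt0.
move=> x y xd yd; apply: (dA (x, y)); split; rewrite /ball /= sub0r normrN.
  by apply: le_lt_trans xd _; rewrite ltr_pdivrMr// ltr_pMr// ltr1n.
by apply: le_lt_trans yd _; rewrite ltr_pdivrMr// ltr_pMr// ltr1n.
Qed.

(** Only directional derivatives are at hand, so additivity in the direction is not automatic. The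
    increment along [u + w] splits into one along [w] from [z] and one along [u] from [h *: w + z].
    The mean value theorem turns the latter into a value of ['D_u f] near [z], and continuity of
    ['D_u f] concludes. *)
Lemma is_derive_add f z u w :
  (\forall x \near z, derivable f x u) -> derivable f z w ->
  {for z, continuous ('D_u f)} ->
  is_derive z (u + w) f ('D_u f z + 'D_w f z).
Proof.
move=> du dw cu.
set l := 'D_u f z + 'D_w f z.
suff cv : (fun h : R => h^-1 *: ((f \o shift z) (h *: (u + w)) - f z)) @ 0^' --> l.
  by split; [apply/cvg_ex; exists l|exact: (cvg_lim _ cv)].
have -> : (fun h : R => h^-1 *: ((f \o shift z) (h *: (u + w)) - f z)) =
  (fun h : R => h^-1 *: (f (h *: u + (h *: w + z)) - f (h *: w + z))
    + h^-1 *: ((f \o shift z) (h *: w) - f z)).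
  by apply/funext => h /=; rewrite -[RHS]scalerDr [h *: (u + w)]scalerDr -[_ + _ + z]addrA subrKA.
apply: cvgD; last exact: dw.
apply/cvgrPdist_le => e e0.
have /cvgrPdist_le/(_ _ e0) nu := cu.
have [d d0 dA] := near_plane u w (filterI nu du).
near=> h.
have h0 : h != 0 by near: h; exact: nbhs_dnbhs_neq.
have hd : `|h| <= d by near: h; apply: dnbhs0_le.
have [c cd ->] : exists2 c : R, `|c| <= d &
    f (h *: u + (h *: w + z)) - f (h *: w + z) = h * 'D_u f (c *: u + (h *: w + z)).
  have [hp|hn|h00] := ltgtP 0 h; last by rewrite h00 eqxx in h0.
  - have [|c /andP[c0 ch] E] := @MVT_line f (h *: w + z) u h hp.
      move=> s /andP[s0 sh]; apply: (dA _ _ _ hd).2 => //.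
      by rewrite ger0_norm//; apply: le_trans hd; rewrite ger0_norm// ltW.
    exists c => //; rewrite ger0_norm//; apply: le_trans hd.
    by rewrite ger0_norm// ltW.
  - have hn' : 0 < - h by rewrite oppr_gt0.
    have [|c /andP[c0 ch] E] := @MVT_line f (h *: u + (h *: w + z)) u (- h) hn'.
      move=> s /andP[s0 sh]; rewrite addrA -scalerDl; apply: (dA _ _ _ hd).2 => //.
      rewrite ler0_norm; last by rewrite -lerBrDr sub0r.
      by apply: le_trans hd; rewrite ltr0_norm// opprD gerDr oppr_le0.
    (* For [h < 0] the mean value theorem runs over a segment of length [- h] starting at
       [h *: u + (h *: w + z)]; counted from [h *: w + z], its point [c] has parameter [c + h]. *)
    exists (c + h).
      rewrite ler0_norm; last by rewrite -lerBrDr sub0r.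
      by apply: le_trans hd; rewrite ltr0_norm// opprD gerDr oppr_le0.
    move: E; rewrite addrA -scalerDl addNr scale0r add0r [c *: u + _]addrA -scalerDl.
    move=> /eqP; rewrite mulNr -opprB eqr_opp => /eqP <-.
    done.
rewrite [_ *: _]mulKf//.
exact: (dA _ _ cd hd).1.
Unshelve. all: end_near. Qed.

(** The second difference is the increment along [u] of [x |-> f (h *: w + x) - f x]; the mean value
    theorem is used for this function along [u], then for ['D_u f] along [w]. *)
Lemma second_difference f z u w (h : R) (A : set W) : 0 < h ->
  (forall x y, 0 <= x <= h -> 0 <= y <= h -> A (x *: u + (y *: w + z))) ->
  (forall x, A x -> derivable f x u) ->
  (forall x, A x -> derivable ('D_u f) x w) ->
  exists2 y, A y &
   f (h *: u + (h *: w + z)) - f (h *: w + z) - (f (h *: u + z) - f z)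
    = h ^+ 2 * 'D_w ('D_u f) y.
Proof.
move=> h0 hA du dwu.
pose F x := f (h *: w + x) - f x.
have hh : 0 <= h <= h by rewrite lexx ltW.
have z0 : 0 <= (0:R) <= h by rewrite lexx ltW.
have A1 s : 0 <= s <= h -> A (s *: u + z).
  by move=> sh; have := hA _ _ sh z0; rewrite scale0r add0r.
have sw x : h *: w + (x *: u + z) = x *: u + (h *: w + z) by rewrite addrCA.
have shiftD s : 0 <= s <= h -> is_derive (s *: u + z) u (fun x => f (h *: w + x)) ('D_u f (s *: u + (h *: w + z))).
  move=> sh; have ds := du _ (hA _ _ sh hh).
  have E : (fun k : R => k^-1 *: (((fun x => f (h *: w + x)) \o shift (s *: u + z)) (k *: u) - f (h *: w + (s *: u + z))))
    = (fun k : R => k^-1 *: ((f \o shift (s *: u + (h *: w + z))) (k *: u) - f (s *: u + (h *: w + z)))).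
    by apply/funext => k /=; rewrite sw addrCA (addrCA (h *: w)).
  by split; rewrite /derivable /derive E.
have DF s : 0 <= s <= h -> is_derive (s *: u + z) u F
   ('D_u f (s *: u + (h *: w + z)) - 'D_u f (s *: u + z)).
  move=> sh; have := shiftD _ sh; have := derivableP (du _ (A1 _ sh)) => d1 d2.
  exact: is_deriveB.
have [|c ch Ec] := @MVT_line F z u h h0.
  by move=> s /DF [].
have [|c' ch' Ec'] := @MVT_line ('D_u f) (c *: u + z) w h h0.
  by move=> s sh; apply: dwu; rewrite addrCA; exact: hA.
exists (c *: u + (c' *: w + z)); first exact: hA.
have -> : f (h *: u + (h *: w + z)) - f (h *: w + z) - (f (h *: u + z) - f z) =
   F (h *: u + z) - F z by rewrite /F sw; move: (f (h *: u + (h *: w + z))) (f (h *: w + z)) (f (h *: u + z)) (f z) => p q r k; ring.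
rewrite Ec; have [_ ->] := DF _ ch.
by rewrite -sw Ec' expr2 -mulrA (addrCA (c' *: w)).
Qed.

(** The second difference is symmetric in [u] and [w]. Evaluated in both orders it equates the two
    mixed derivatives at two points close to [z], and continuity moves both points to [z]. *)
Lemma schwarz f z u w (U : set W) : open U -> U z ->
  (forall x, U x -> derivable f x u) -> (forall x, U x -> derivable f x w) ->
  (forall x, U x -> derivable ('D_u f) x w) -> (forall x, U x -> derivable ('D_w f) x u) ->
  {for z, continuous ('D_w ('D_u f))} -> {for z, continuous ('D_u ('D_w f))} ->
  'D_w ('D_u f) z = 'D_u ('D_w f) z.
Proof.
move=> oU Uz du dw dwu duw c1 c2.
apply/eqP; rewrite -subr_eq0 -normr_le0; apply/ler_addgt0Pr => e e0.
rewrite add0r.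
have e2 : 0 < e / 2 by rewrite divr_gt0.
have /cvgrPdist_le/(_ _ e2) n1 := c1; have /cvgrPdist_le/(_ _ e2) n2 := c2.
have nU := open_nbhs_nbhs (conj oU Uz).
have [d d0 dA] := near_plane u w (filterI nU (filterI n1 n2)).
pose A := U `&` ([set x | `|'D_w ('D_u f) z - 'D_w ('D_u f) x| <= e / 2]
            `&` [set x | `|'D_u ('D_w f) z - 'D_u ('D_w f) x| <= e / 2]).
have hA x y : 0 <= x <= d -> 0 <= y <= d -> A (x *: u + (y *: w + z)).
  by move=> /andP[x0 xd] /andP[y0 yd]; apply: dA; rewrite ger0_norm.
have hA' x y : 0 <= x <= d -> 0 <= y <= d -> A (x *: w + (y *: u + z)).
  by move=> xd yd; rewrite addrCA; exact: hA.
have [x [_ [/= x1 _]] X] := second_difference d0 hA (fun x Ax => du x Ax.1) (fun x Ax => dwu x Ax.1).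
have [y [_ [_ /= y1]] Y] := second_difference d0 hA' (fun x Ax => dw x Ax.1) (fun x Ax => duw x Ax.1).
have XY : 'D_w ('D_u f) x = 'D_u ('D_w f) y.
  apply: (@mulfI _ (d ^+ 2)); first by rewrite expf_neq0 ?gt_eqF.
  apply: etrans (esym X) (etrans _ Y); rewrite (addrCA (d *: w)).
  by move: (f (d *: u + (d *: w + z))) (f (d *: w + z)) (f (d *: u + z)) (f z) => p q r k; ring.
have -> : 'D_w ('D_u f) z - 'D_u ('D_w f) z = ('D_w ('D_u f) z - 'D_w ('D_u f) x)
   - ('D_u ('D_w f) z - 'D_u ('D_w f) y) by rewrite XY opprB addrA subrK.
apply: le_trans (ler_normB _ _) _.
by rewrite [leRHS]splitr; exact: (lerD x1 y1).
Qed.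

End Directional.

(** * Calculus of smooth functions on an open set *)

Section SmoothCalculus.
Variables (R : realType) (W : normedModType R) (U : set W).
Hypothesis oU : open U.
Implicit Types (f g : W -> R).

Lemma eq_on_derive f g w z : {in U, f =1 g} -> U z -> 'D_w f z = 'D_w g z.
Proof.
move=> fg Uz; have [->|w0] := eqVneq w 0; first by rewrite !derive0.
apply: near_eq_derive => //.
have : \forall x \near z, U x by exact: open_nbhs_nbhs (conj oU Uz).
by apply: filterS => x /mem_set /fg.
Qed.

Lemma eq_on_is_derive f g w z d : {in U, f =1 g} -> U z ->
  is_derive z w f d -> is_derive z w g d.
Proof.
move=> fg Uz; have [->|w0] := eqVneq w 0.
  by case=> _ <-; rewrite derive0; exact: is_derive0.
apply: near_eq_is_derive => //.
have : \forall x \near z, U x by exact: open_nbhs_nbhs (conj oU Uz).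
by apply: filterS => x /mem_set /fg.
Qed.

Lemma smooth_D f w : smooth U f -> smooth U ('D_w f).
Proof. by move=> sf k; have [_ /(_ w) []] := sf k.+1. Qed.

Lemma smooth_cont f z : smooth U f -> U z -> {for z, continuous f}.
Proof. by move=> sf Uz; have [/(_ z Uz)] := sf 0%N. Qed.

Lemma smooth_derivable f w z : smooth U f -> U z -> derivable f z w.
Proof. by move=> sf Uz; have [_ /(_ w) [/(_ z Uz)]] := sf 1%N. Qed.

Lemma smooth_schwarz f u w z : smooth U f -> U z ->
  'D_w ('D_u f) z = 'D_u ('D_w f) z.
Proof.
move=> sf Uz; apply: (schwarz oU Uz) => [x Ux|x Ux|x Ux|x Ux||].
all: do ?[exact: smooth_derivable]; do ?[apply: smooth_derivable => //; exact: smooth_D].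
all: by apply: smooth_cont => //; do 2 apply: smooth_D.
Qed.

Lemma smooth_is_derive_add f u w z : smooth U f -> U z ->
  is_derive z (u + w) f ('D_u f z + 'D_w f z).
Proof.
move=> sf Uz; apply: is_derive_add; last first.
- by apply: smooth_cont => //; exact: smooth_D.
- exact: smooth_derivable.
- have : \forall x \near z, U x by exact: open_nbhs_nbhs (conj oU Uz).
  by apply: filterS => x Ux; exact: smooth_derivable.
Qed.

Lemma smooth_iter f w n : smooth U f -> smooth U (iter n (fun h => 'D_w h) f).
Proof. by move=> sf; elim: n => //= n IH; exact: smooth_D. Qed.

Lemma derive_iter_swap f u w n z : smooth U f -> U z ->
  'D_u (iter n (fun h => 'D_w h) f) z = iter n (fun h => 'D_w h) ('D_u f) z.
Proof.
move=> sf; elim: n z => //= n IH z Uz.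
rewrite smooth_schwarz//; last exact: smooth_iter.
by apply: eq_on_derive => // x /set_mem; exact: IH.
Qed.

Lemma eq_on_iter f g w n z : {in U, f =1 g} -> U z ->
  iter n (fun h => 'D_w h) f z = iter n (fun h => 'D_w h) g z.
Proof.
move=> fg; elim: n z => /= [z /mem_set /fg//|n IH z Uz].
by apply: eq_on_derive => // x /set_mem; exact: IH.
Qed.
End SmoothCalculus.

(** * Mixed partial derivatives in time and space *)

Section Jets.
Variable R : realType.
Local Notation W := (R * (R * R))%type.

Definition dirT : W := (1, (0, 0)).
Definition dirX : W := (0, (1, 0)).
Definition dirY : W := (0, (0, 1)).

(** The fixed order of differentiation ([dirY], then [dirX], then [dirT]) gives each mixed partial
    derivative one name; symmetry of second derivatives brings every derivative of a jet back to
    this form. *)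
Definition jet (f : W -> R) (a b c : nat) : W -> R :=
  iter a (fun h => 'D_dirT h) (iter b (fun h => 'D_dirX h) (iter c (fun h => 'D_dirY h) f)).

Variable U : set W.
Hypothesis oU : open U.
Variable f : W -> R.
Hypothesis sf : smooth U f.

Lemma smooth_jet a b c : smooth U (jet f a b c).
Proof. by do 3 apply: smooth_iter. Qed.

Lemma derive_jet_dirX a b c z : U z -> 'D_dirX (jet f a b c) z = jet f a b.+1 c z.
Proof. by move=> Uz; rewrite /jet (derive_iter_swap oU)//; do 2 apply: smooth_iter. Qed.

Lemma derive_jet_dirY a b c z : U z -> 'D_dirY (jet f a b c) z = jet f a b c.+1 z.
Proof.
move=> Uz; rewrite /jet (derive_iter_swap oU)//; last by do 2 apply: smooth_iter.
apply: (eq_on_iter oU) => // x /set_mem Ux.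
by rewrite (derive_iter_swap oU)//; exact: smooth_iter.
Qed.

Lemma is_derive_jet a b c z w : U z -> is_derive z w (jet f a b c)
  (w.1 * jet f a.+1 b c z + (w.2.1 * jet f a b.+1 c z + w.2.2 * jet f a b c.+1 z)).
Proof.
move=> Uz; have sj := smooth_jet a b c.
have E : w = w.1 *: dirT + (w.2.1 *: dirX + w.2.2 *: dirY).
  case: w => w0 [w1 w2]; congr (_, (_, _)) => /=; cbn; ring.
rewrite [w in is_derive _ w]E {E}.
apply: is_derive_eq; first exact: (smooth_is_derive_add oU).
have D u c' : is_derive z (c' *: u) (jet f a b c) (c' * 'D_u (jet f a b c) z).
  by apply: is_derive_scale; apply: derivableP; exact: (smooth_derivable (U := U)).
have [_ ->] := D dirT w.1.
have [_ ->] := smooth_is_derive_add oU (w.2.1 *: dirX) (w.2.2 *: dirY) sj Uz.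
have [_ ->] := D dirX w.2.1; have [_ ->] := D dirY w.2.2.
by rewrite derive_jet_dirX// derive_jet_dirY.
Qed.

End Jets.

(** * Symbolic expressions in the derivatives of the metric *)

Section Expressions.
Variable R : realType.
Local Notation W := (R * (R * R))%type.

(* [EJet i j a b c] stands for the derivative of order [a] in time and orders
   [b], [c] in space of the [(i, j)] component of the metric, where [false] is
   the first index and [true] the second. *)
Inductive expr :=
| ECst of R
| EJet of bool & bool & nat & nat & nat
| EAdd of expr & expr
| EOpp of expr
| EMul of expr & expr
| EInv of expr
| ESqrt of expr.

Definition jets := bool -> bool -> nat -> nat -> nat -> R.

Fixpoint evalE (J : jets) (e : expr) : R :=
  match e with
  | ECst r => r
  | EJet i j a b c => J i j a b c
  | EAdd e1 e2 => evalE J e1 + evalE J e2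
  | EOpp e1 => - evalE J e1
  | EMul e1 e2 => evalE J e1 * evalE J e2
  | EInv e1 => (evalE J e1)^-1
  | ESqrt e1 => Num.sqrt (evalE J e1)
  end.

(** Evaluation is total, with default values for inverses of zero and roots of negative numbers.
    This predicate singles out the jets at which the expression is differentiable, hence the strict
    sign under roots. *)
Fixpoint defined (J : jets) (e : expr) : Prop :=
  match e with
  | ECst _ | EJet _ _ _ _ _ => True
  | EAdd e1 e2 | EMul e1 e2 => defined J e1 /\ defined J e2
  | EOpp e1 => defined J e1
  | EInv e1 => evalE J e1 != 0 /\ defined J e1
  | ESqrt e1 => 0 < evalE J e1 /\ defined J e1
  end.

Inductive axis := DT | DX | DY.

Fixpoint ederiv (x : axis) (e : expr) : expr :=
  match e with
  | ECst _ => ECst 0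
  | EJet i j a b c => match x with
                     | DT => EJet i j a.+1 b c
                     | DX => EJet i j a b.+1 c
                     | DY => EJet i j a b c.+1
                     end
  | EAdd e1 e2 => EAdd (ederiv x e1) (ederiv x e2)
  | EOpp e1 => EOpp (ederiv x e1)
  | EMul e1 e2 => EAdd (EMul (ederiv x e1) e2) (EMul e1 (ederiv x e2))
  | EInv e1 => EOpp (EMul (ederiv x e1) (EMul (EInv e1) (EInv e1)))
  | ESqrt e1 => EMul (ederiv x e1) (EInv (EMul (ECst 2) (ESqrt e1)))
  end.

Lemma defined_ederiv J x e : defined J e -> defined J (ederiv x e).
Proof.
elim: e => //=.
- by case: x.
- by move=> e1 h1 e2 h2 [/h1 ? /h2 ?].
- by move=> e1 h1 e2 h2 [d1 d2]; split; split=> //; [exact: h1|exact: h2].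
- by move=> e1 h1 [? d]; split; [exact: h1|].
- move=> e1 h1 [? d]; split; [exact: h1|split => //].
  by rewrite mulf_neq0 ?pnatr_eq0// gt_eqF// sqrtr_gt0.
Qed.

Variable U : set W.
Hypothesis oU : open U.
Variable g : bool -> bool -> W -> R.
Hypothesis sg : forall i j, smooth U (g i j).

Definition jets_at (z : W) : jets := fun i j a b c => jet (g i j) a b c z.

Definition evalf (e : expr) (z : W) : R := evalE (jets_at z) e.

(** The chain rule for expressions. Through it every derivative of a geometric quantity is computed
    by [ederiv], and relations between such derivatives become algebra in the jets. *)
Lemma is_derive_evalf e z w : U z -> defined (jets_at z) e ->
  is_derive z w (evalf e)
   (w.1 * evalf (ederiv DT e) z + (w.2.1 * evalf (ederiv DX e) z + w.2.2 * evalf (ederiv DY e) z)).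
Proof.
move=> Uz; elim: e.
- move=> r _; rewrite /evalf /= !mulr0 !addr0; exact: is_derive_cst.
- move=> i j a b c _; exact: (is_derive_jet oU).
- move=> e1 h1 e2 h2 [/h1 d1 /h2 d2].
  apply: (is_derive_eq (is_deriveD d1 d2)); rewrite /evalf /=; ring.
- move=> e1 h1 /h1 d1; apply: (is_derive_eq (is_deriveN d1)).
  rewrite /evalf /=; ring.
- move=> e1 h1 e2 h2 [/h1 d1 /h2 d2]; apply: (is_derive_eq (is_deriveM d1 d2)).
  rewrite /evalf /=; move: (evalE _ _) (evalE _ _) (evalE _ _) (evalE _ _) => *.
  cbn; ring.
- move=> e1 h1 [n0 /h1 d1]; have n0' : evalf e1 z != 0 by [].
  have := is_derive_comp_real (is_deriveV n0' (is_derive_id _ _)) d1.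
  move=> /is_derive_eq; apply; rewrite /evalf /= expr2 invfM [_ *: _]mulr1; ring.
- move=> e1 h1 [n0 /h1 d1].
have s0 : 0 < evalf e1 z by [].
  apply: (is_derive_eq (is_derive_comp_real (is_derive1_sqrt s0) d1)).
  rewrite /evalf /=; ring.
Qed.

Lemma derivable_continuous_evalf e z : U z -> defined (jets_at z) e ->
  {for z, continuous (evalf e)}.
Proof.
move=> Uz; elim: e.
- move=> r _; exact: cvg_cst.
- move=> i j a b c _; apply: (smooth_cont (U := U)) => //; exact: smooth_jet.
- by move=> e1 h1 e2 h2 [/h1 d1 /h2 d2]; exact: cvgD.
- by move=> e1 h1 /h1 d1; exact: cvgN.
- by move=> e1 h1 e2 h2 [/h1 d1 /h2 d2]; exact: cvgM.
- by move=> e1 h1 [n0 /h1 d1]; exact: cvgV.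
- move=> e1 h1 [n0 /h1 d1].
  by apply: (@continuous_comp _ _ _ (evalf e1) Num.sqrt); [exact: d1|exact: sqrt_continuous].
Qed.

End Expressions.

Declare Scope expr_scope.
Delimit Scope expr_scope with J.
Bind Scope expr_scope with expr.
Notation "x + y" := (EAdd x y) : expr_scope.
Notation "x - y" := (EAdd x (EOpp y)) : expr_scope.
Notation "- x" := (EOpp x) : expr_scope.
Notation "x * y" := (EMul x y) : expr_scope.
Notation "x / y" := (EMul x (EInv y)) : expr_scope.

(** * Geometric quantities as expressions, and their evolution identities *)

Section Geometry.
Variable R : realType.
Local Notation ex := (expr R).
Local Open Scope expr_scope.
Definition sp (i : bool) : axis := if i then DY else DX.
Definition metE (i j : bool) : ex := EJet R i j 0 0 0.
Definition sigE (i j : bool) : ex := EJet R i j 1 0 0.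
Definition sumE (F : bool -> ex) : ex := F false + F true.

Definition detE : ex := metE false false * metE true true - metE false true * metE true false.
Definition volE : ex := ESqrt detE.
Definition invE (k l : bool) : ex :=
  (if k == l then metE (~~ k) (~~ l) else EOpp (metE k l)) / detE.
Definition chrE (k i j : bool) : ex :=
  EInv (ECst 2) * sumE (fun l => invE k l *
    (ederiv (sp i) (metE j l) + ederiv (sp j) (metE i l) - ederiv (sp l) (metE i j))).
Definition riemE (l k i j : bool) : ex :=
  ederiv (sp i) (chrE l j k) - ederiv (sp j) (chrE l i k)
  + sumE (fun m => chrE l i m * chrE m j k - chrE l j m * chrE m i k).
Definition kapvolE : ex :=
  sumE (fun l => metE l false * riemE l true false true) / detE * volE.
(** The contravariant components of [S sigma] times the volume density. In dimension two they are
    minus the cofactors of sigma divided by det g, so no inverse metric appears and one factor of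
    the volume remains in the denominator. *)
Definition momE (i j : bool) : ex :=
  (if i == j then EOpp (sigE (~~ i) (~~ j)) else sigE i j) / volE.
(** The covariant divergence of [momE]; since [momE] is a density, the term with the traced
    Christoffel symbol is absent. *)
Definition divE (k : bool) : ex :=
  sumE (fun j => ederiv (sp j) (momE k j)) +
  sumE (fun i => sumE (fun j => momE i j * chrE k i j)).
(* For a vector [e] along an edge: the square of its length, the geodesic
   curvature times the length of [e], the vector [det g] times the raised
   conormal, and [sigma(n, tau)]. *)
Definition vecE (e : R * R) (i : bool) : ex := ECst (if i then e.2 else e.1).
Definition bilE (F : bool -> bool -> ex) (u w : bool -> ex) : ex :=
  sumE (fun i => sumE (fun j => F i j * u i * w j)).
Definition normE (e : R * R) : ex := bilE metE (vecE e) (vecE e).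
Definition geodE (e : R * R) : ex :=
  volE / normE e * (vecE e false * bilE (chrE true) (vecE e) (vecE e)
                    - vecE e true * bilE (chrE false) (vecE e) (vecE e)).
Definition cornE (e : R * R) (k : bool) : ex :=
  if k then - (metE false true * vecE e true + metE false false * vecE e false)
  else metE true true * vecE e true + metE false true * vecE e false.
Definition shearE (e : R * R) : ex :=
  bilE sigE (cornE e) (vecE e) / (volE * normE e).

Local Close Scope expr_scope.

Definition symmetric_jets (J : jets R) :=
  forall a b c, J true false a b c = J false true a b c.


(** Sylvester's criterion for a positive definite metric, with symmetry demanded of all its
    derivatives too. *)
Record nondegenerate (J : jets R) : Prop := {
  nondeg_sym : symmetric_jets J;
  nondeg_diag : 0 < J false false 0 0 0;
  nondeg_det : 0 < evalE J detE }.


(** Serves the side conditions of [field] below: the polynomial that has to be nonzero is [normE]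
    cleared of its denominator, that is, multiplied by the first diagonal entry of the metric. *)
Lemma neq0_of_mul (c x y : R) : 0 < c -> 0 < x -> y = x * c -> y != 0.
Proof. by move=> c0 x0 ->; rewrite mulf_neq0 ?gt_eqF. Qed.

Section Identities.
Variable J : jets R.
Hypothesis nJ : nondegenerate J.
Local Notation E := (J false false).
Local Notation F := (J false true).
Local Notation G := (J true true).

(* All the identities below become identities of rational functions once the
   square root [v] of the determinant replaces [G]. *)
Lemma jets_param : exists v, [/\ 0 < v, Num.sqrt (E 0 0 0 * G 0 0 0 - F 0 0 0 * F 0 0 0) = v,
  E 0 0 0 * G 0 0 0 - F 0 0 0 * F 0 0 0 = v ^+ 2 & G 0 0 0 = (v ^+ 2 + F 0 0 0 ^+ 2) / E 0 0 0].
Proof.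
case: nJ => sJ E0 /=; rewrite sJ => D0; exists (Num.sqrt (E 0 0 0 * G 0 0 0 - F 0 0 0 * F 0 0 0)).
have vv := sqr_sqrtr (ltW D0); rewrite sqrtr_gt0; split => //.
by rewrite vv; field; rewrite gt_eqF.
Qed.

(** The linearized curvature: the curvature form evolves by half of the double divergence of
    [S sigma]. Once [G] is eliminated this is an identity of rational functions in the jets. *)
Lemma kapvolE_time : evalE J (ederiv DT kapvolE) =
  2^-1 * (evalE J (ederiv DX (divE false)) + evalE J (ederiv DY (divE true))).
Proof.
have [v [v0 vE dE GE]] := jets_param; case: nJ => sJ E0 _.
rewrite /= !sJ vE dE GE.
field.
by rewrite !gt_eqF.
Qed.

Lemma normE_gt0 (e : R * R) : e != 0 -> 0 < evalE J (normE e).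
Proof.
have [v [v0 vE dE GE]] := jets_param; case: nJ => sJ E0 _.
case: e => a b e0; rewrite /= !sJ GE.
(* Completing the square: multiplied by E > 0, the form becomes (E a + F b)^2 + v^2 b^2. *)
rewrite -(pmulr_rgt0 _ E0); set f := F 0 0 0.
rewrite [ltRHS](_ : _ = (E 0 0 0 * a + f * b) ^+ 2 + v ^+ 2 * b ^+ 2).
  2: by field; rewrite gt_eqF.
have [b0|b0] := eqVneq b 0.
  have a0 : a != 0 by apply: contraNneq e0 => a0; rewrite a0 b0.
  by rewrite b0 mulr0 addr0 expr0n mulr0 addr0 exprn_even_gt0 //= mulf_neq0// gt_eqF.
by rewrite ltr_wpDl ?sqr_ge0// mulr_gt0// exprn_even_gt0//= ?gt_eqF.
Qed.

(** The geodesic curvature form of an edge evolves by minus half the flux of [divE] through the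
    edge, minus half the derivative of sigma(n, tau) along it. The flux pairs [divE] with the
    conormal [(e.2, - e.1)]. *)
Lemma geodE_time (e : R * R) : e != 0 ->
  evalE J (ederiv DT (geodE e)) =
  - (2^-1 * (evalE J (divE false) * e.2 - evalE J (divE true) * e.1))
  - 2^-1 * (e.1 * evalE J (ederiv DX (shearE e)) + e.2 * evalE J (ederiv DY (shearE e))).
Proof.
move=> /normE_gt0; have [v [v0 vE dE GE]] := jets_param; case: nJ => sJ E0 _.
case: e => a b /=; rewrite !sJ vE dE GE => q0.
field.
by rewrite (gt_eqF E0) (gt_eqF v0) /= andbT; apply: (neq0_of_mul E0 q0); field; rewrite gt_eqF.
Qed.

(* The left-hand side pairs with the gradient of [v] to
   [(S sigma)(n, grad v) + sigma(tau, tau) d_n v]. *)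
Lemma momE_conormal (e : R * R) (k : bool) : e != 0 ->
  evalE J (momE k false) * e.2 - evalE J (momE k true) * e.1
  + evalE J (bilE sigE (vecE e) (vecE e) / normE e * volE * (cornE e k / detE))%J
  = evalE J (shearE e * vecE e k)%J.
Proof.
move=> /normE_gt0; have [v [v0 vE dE GE]] := jets_param; case: nJ => sJ E0 _.
case: e => a b; case: k => /=; rewrite !sJ vE dE GE => q0.
all: field.
all: by rewrite (gt_eqF E0) (gt_eqF v0) /= andbT; apply: (neq0_of_mul E0 q0); field; rewrite gt_eqF.
Qed.

(* Up to the factor [u.1 * w.2 - u.2 * w.1], the left-hand side is the time
   derivative of the cosine of the angle between [u] and [w], divided by its
   sine. *)
Lemma cosE_time (u w : R * R) : u != 0 -> w != 0 ->
  let b := bilE metE (vecE u) (vecE w) in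
  (evalE J (ederiv DT b)
    - evalE J b * (evalE J (ederiv DT (normE u)) / (2 * evalE J (normE u))
                   + evalE J (ederiv DT (normE w)) / (2 * evalE J (normE w))))
    / evalE J volE
  = 2^-1 * ((u.1 * w.2 - u.2 * w.1) * (evalE J (shearE w) - evalE J (shearE u))).
Proof.
move=> /normE_gt0 + /normE_gt0; have [v [v0 vE dE GE]] := jets_param; case: nJ => sJ E0 _.
case: u w => u1 u2 [w1 w2] /=; rewrite !sJ vE GE => qu qw.
field.
rewrite (gt_eqF E0) (gt_eqF v0) /=; apply/andP; split.
  by apply: (neq0_of_mul E0 qu); field; rewrite gt_eqF.
by apply: (neq0_of_mul E0 qw); field; rewrite gt_eqF.
Qed.

End Identities.
End Geometry.

(** * L^2 and L^1 convergence on sets of finite measure *)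

Section L2.
Context {R : realType} d {X : measurableType d}.
Variable mu : {measure set X -> \bar R}.
Variable D : set X.
Hypothesis mD : measurable D.
Hypothesis fD : (mu D < +oo)%E.

Let one : X -> R := (cst (1 : R)) \_ D.

Let norm_one : (Lnorm mu 2%:E (EFin \o one) < +oo)%E.
Proof.
rewrite unlock; apply: poweR_lty.
rewrite (_ : (\int[mu]_x _)%E = mu D)//.
rewrite -[RHS]mul1e -integral_cst// [RHS]integral_mkcond.
apply: eq_integral => x _; rewrite /one /= !patchE.
by case: ifP => _ /=; rewrite ?normr1 ?powR1// normr0 powR0// pnatr_eq0.
Qed.

(** Hölder's inequality against the indicator of [D], whose L^2 norm is finite. *)
Lemma L1_le_L2 (u : X -> R) : measurable_fun D u ->
  (\int[mu]_(x in D) `|(u x)%:E| <=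
     'N[mu]_2%:E[EFin \o (u \_ D)] * Lnorm mu 2%:E (EFin \o one))%E.
Proof.
move=> mu_.
have m1 : measurable_fun setT (u \_ D) by apply/(measurable_restrictT _ _).1.
have m2 : measurable_fun setT one by apply/(measurable_restrictT _ _).1.
have h2 : (2^-1 + 2^-1 = 1 :> R) by field.
apply: le_trans (@hoelder _ _ _ mu _ _ _ _ m1 m2 (ltr0n _ 2) (ltr0n _ 2) h2).
rewrite Lnorm1 integral_mkcond le_eqVlt; apply/orP; left; apply/eqP.
apply: eq_integral => x _.
by rewrite /one /= !patchE; case: ifP => _ /=; rewrite ?mulr1 ?mul0r ?normr0.
Qed.

Lemma L2_integrable (u : X -> R) : L2 mu D u -> mu.-integrable D (EFin \o u).
Proof.
move=> [mu_ fu]; apply/integrableP; split; first exact/measurable_EFinP.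
apply: le_lt_trans (L1_le_L2 mu_) _.
by rewrite lte_mul_pinfty// ?Lnorm_ge0// ge0_fin_numE ?Lnorm_ge0.
Qed.

Lemma L2_cvg_L1 (u_ : nat -> X -> R) (u : X -> R) :
  (forall n, measurable_fun D (u_ n)) -> measurable_fun D u ->
  L2_cvg mu D u_ u ->
  \int[mu]_(x in D) `|u_ n x - u x| @[n --> \oo] --> 0.
Proof.
move=> mu_ mu0 cu.
have : (\int[mu]_(x in D) `|(u_ n x - u x)%:E|)%E @[n --> \oo] --> 0%E.
  have N1 : Lnorm mu 2%:E (EFin \o one) \is a fin_num.
    by rewrite ge0_fin_numE ?Lnorm_ge0.
  have : ('N[mu]_2%:E[EFin \o ((u_ n \- u)%R \_ D)] * Lnorm mu 2%:E (EFin \o one))%E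
      @[n --> \oo] --> 0%E.
    rewrite -[X in _ --> X](mul0e (Lnorm mu 2%:E (EFin \o one))).
    apply: cvgeM => //; last exact: cvg_cst.
    by rewrite mule_def_fin.
  move=> cN; apply: (squeeze_cvge _ (cvg_cst 0%E) cN); apply: nearW => n.
  rewrite integral_ge0//= (L1_le_L2 (measurable_funB (mu_ n) mu0)) //.
by move/fine_cvg.
Qed.

End L2.

Section L1.
Context {R : realType} d {X : measurableType d}.
Variable mu : {measure set X -> \bar R}.
Variable D : set X.
Hypothesis mD : measurable D.

(** The integrals differ by at most a bound of [c] times the L^1 distance of [u_ n] and [u]. *)
Lemma cvg_integral_mul (u_ : nat -> X -> R) (u c : X -> R) :
  (forall n, mu.-integrable D (EFin \o u_ n)) -> mu.-integrable D (EFin \o u) ->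
  measurable_fun D c -> [bounded c x | x in D] ->
  \int[mu]_(x in D) `|u_ n x - u x| @[n --> \oo] --> 0 ->
  \int[mu]_(x in D) (u_ n x * c x) @[n --> \oo] --> \int[mu]_(x in D) (u x * c x).
Proof.
move=> iu_ iu mc bc cu.
have [M [_ Mc]] := bc.
have M1 : M < `|M| + 1 by rewrite ltr_pwDr// ler_norm.
have {Mc}cM := Mc _ M1; set K : R := `|M| + 1 in cM.
have iB n : mu.-integrable D (EFin \o (fun x => u_ n x - u x)) by exact: (integrableB mD (iu_ n) iu).
have iM (w : X -> R) : mu.-integrable D (EFin \o w) ->
   mu.-integrable D (EFin \o (fun x => w x * c x)).
  move=> iw; have := integrableMl mD iw mc bc; exact.
apply/subr_cvg0; apply: norm_cvg0.
have cK : K * \int[mu]_(x in D) `|u_ n x - u x| @[n --> \oo] --> 0.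
  by rewrite -[X in _ --> X](mulr0 K); apply: cvgM => //; exact: cvg_cst.
apply: (@squeeze_cvgr _ _ _ _ (cst 0) _ _ _ _ _ cK) => //; last exact: cvg_cst.
apply: nearW => n.
rewrite normr_ge0 /= -RintegralB//; [|exact: iM..].
have -> : \int[mu]_(x in D) (u_ n x * c x - u x * c x) =
    \int[mu]_(x in D) ((u_ n x - u x) * c x).
  by apply: eq_Rintegral => x _; rewrite mulrBl.
apply: le_trans (le_normr_Rintegral _ (iM _ (iB n))) _ => //.
rewrite -RintegralZl//; last exact: integrable_norm (iB n).
apply: le_Rintegral => //.
- exact: integrable_norm (iM _ (iB n)).
- apply: (eq_integrable mD (fun x => K%:E * (`|u_ n x - u x|)%:E)%E) => //.
  exact: integrableZl (integrable_norm (iB n)).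
- by move=> x Dx; rewrite normrM mulrC ler_wpM2r//; exact: cM.
Qed.

End L1.

(** * Measurability and compactness in the plane *)

Section Plane.
Variable R : realType.
Local Notation mR := (measurableTypeR R).
Local Notation mR2 := (mR * mR)%type.

(** An open set is the countable union of the open rectangles with rational sides that it contains.
    In [good] the other rectangles are replaced by the empty set, so that the union runs over all
    rational quadruples. *)
Lemma open_measurable_plane (O : set (R * R)) : open O -> measurable (O : set mR2).
Proof.
move=> oO.
pose rect (a b c d : rat) : set mR2 := `]ratr a, ratr b[ `*` `]ratr c, ratr d[.
pose good (a b c d : rat) : set mR2 := if pselect (rect a b c d `<=` O) then rect a b c d else set0.
have aux (u w e' lo hi : R) : u - e' < lo -> hi < u + e' -> lo < w -> w < hi ->
    `|u - w| < e'.
  by move=> *; rewrite ltr_norml; apply/andP; split; lra.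
have -> : O = \bigcup_(a in [set: rat]) \bigcup_(b in [set: rat]) \bigcup_(c in [set: rat]) \bigcup_(d in [set: rat]) good a b c d.
  apply/seteqP; split => [[x y] Oxy|p [/= a _ [/= b _ [/= c _ [/= d _]]]]]; last first.
    by rewrite /good; case: pselect => ?? /=; auto.
  have /nbhs_ballP[e /= e0 eO] := open_nbhs_nbhs (conj oO Oxy).
  have xl : x - e < x by rewrite ltrBlDr ltrDl.
  have xr : x < x + e by rewrite ltrDl.
  have yl : y - e < y by rewrite ltrBlDr ltrDl.
  have yr : y < y + e by rewrite ltrDl.
  have [a] := rat_in_itvoo xl; rewrite in_itv /= => /andP[a1 a2].
  have [b] := rat_in_itvoo xr; rewrite in_itv /= => /andP[b1 b2].
  have [c] := rat_in_itvoo yl; rewrite in_itv /= => /andP[c1 c2].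
  have [d] := rat_in_itvoo yr; rewrite in_itv /= => /andP[d1 d2].
  exists a => //; exists b => //; exists c => //; exists d => //.
  rewrite /good; case: pselect => [? /=|].
    by split; rewrite /= in_itv /=; apply/andP.
  case=> -[x' y'] [/=]; rewrite !in_itv /= => /andP[x1 x2] /andP[y1 y2].
  by apply: eO; split; [exact: aux a1 b2 x1 x2|exact: aux c1 d2 y1 y2].
apply: bigcupT_measurable_rat => a; apply: bigcupT_measurable_rat => b.
apply: bigcupT_measurable_rat => c; apply: bigcupT_measurable_rat => d.
rewrite /good; case: pselect => ? /=; last exact: measurable0.
apply: measurableX; exact: measurable_itv.
Qed.

Lemma within_continuous_measurable_plane (D : set mR2) (f : mR2 -> mR) :
  measurable D -> {within (D : set (R * R)), continuous (f : R * R -> R)} ->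
  measurable_fun D f.
Proof.
move=> mD /continuousP cf; apply: (measurability _ (RGenOpens.measurableE R)).
move=> _ [_ [a [b ->] <-]].
have /open_subspaceP[V oV VD] := cf _ (@interval_open R (BRight a) (BLeft b) isT isT).
rewrite setIC -VD; apply: measurableI => //; exact: open_measurable_plane.
Qed.

Local Notation T := (@tri_ref R).

Lemma closed_tri_ref : closed T.
Proof.
have -> : T = [set p : R * R | 0 <= p.1] `&` [set p | 0 <= p.2] `&` [set p | p.1 + p.2 <= 1].
  by apply/seteqP; split => p /= => [[]|[[]]].
apply: closedI; first apply: closedI.
- apply: (@closed_comp _ _ fst [set x : R | 0 <= x]); last exact: closed_ge.
  by move=> p _; exact: cvg_fst.
- apply: (@closed_comp _ _ snd [set x : R | 0 <= x]); last exact: closed_ge.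
  by move=> p _; exact: cvg_snd.
- apply: (@closed_comp _ _ (fun p : R * R => p.1 + p.2) [set x : R | x <= 1]); last exact: closed_le.
  by move=> p _; apply: cvgD; [exact: cvg_fst|exact: cvg_snd].
Qed.

Lemma compact_tri_ref : compact T.
Proof.
apply: (subclosed_compact closed_tri_ref (compact_setX (@segment_compact R 0 1) (@segment_compact R 0 1))).
move=> p [p1 p2 p12]; split; rewrite /= in_itv /=; apply/andP; split => //; lra.
Qed.

Lemma closed_measurable_plane (A : set (R * R)) : closed A -> measurable (A : set mR2).
Proof.
by move/closed_openC/open_measurable_plane/measurableC; rewrite setCK.
Qed.

Lemma measurable_tri_ref : measurable (T : set mR2).
Proof. exact: closed_measurable_plane closed_tri_ref. Qed.

Lemma leb2E : leb2 R = (lebesgue_measure \x lebesgue_measure)%E :> (set mR2 -> \bar R).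
Proof. by []. Qed.

Lemma leb2_rect (a b c d : R) : a <= b -> c <= d ->
  leb2 R (`[a, b]%classic `*` `[c, d]%classic) = ((b - a) * (d - c))%:E.
Proof.
have L (u v : R) : u <= v -> (@lebesgue_measure R) `[u, v]%classic = (v - u)%:E.
  by rewrite lebesgue_measure_itv /= lte_fin; case: ltgtP => // -> _; rewrite subrr.
by move=> ab cd; rewrite leb2E product_measure1E//= !L// EFinM.
Qed.

Lemma leb2_tri_ref_lty : (leb2 R T < +oo)%E.
Proof.
apply: (@le_lt_trans _ _ (leb2 R (`[0, 1]%classic `*` `[0, 1]%classic))); last first.
  by rewrite leb2_rect ?ler01// ltry.
apply: le_measure; rewrite ?inE.
- exact: measurable_tri_ref.
- by apply: measurableX; exact: measurable_itv.
- move=> p [p1 p2 p12]; split; rewrite /= in_itv /=; apply/andP; split => //; lra.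
Qed.

Lemma within_continuous_integrable_tri (f : R * R -> R) :
  {within T, continuous f} -> (leb2 R).-integrable T (EFin \o f).
Proof.
move=> cf; apply: measurable_bounded_integrable.
- exact: measurable_tri_ref.
- exact: leb2_tri_ref_lty.
- by apply: within_continuous_measurable_plane => //; exact: measurable_tri_ref.
- have /compact_bounded[M [_ mrt]] := continuous_compact cf compact_tri_ref.
  by exists M; split; rewrite ?num_real // => ? ? ? ?; exact: mrt.
Qed.

Lemma within_continuous_bounded (V : topologicalType) (A : set V) (f : V -> R) :
  compact A -> {within A, continuous f} -> [bounded f x | x in A].
Proof.
move=> cA cf; have /compact_bounded[M [_ mrt]] := continuous_compact cf cA.
by exists M; split; rewrite ?num_real // => ? ? ? ?; exact: mrt.
Qed.

End Plane.

(** * Iterated integrals over the triangle and over rectangles inside it *)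

Section Fubini.
Variable R : realType.
Local Notation mR := (measurableTypeR R).
Local Notation mR2 := (mR * mR)%type.
Local Notation T := (@tri_ref R).
Local Notation mu := (@lebesgue_measure R).

Lemma integral_plane_yx (A : set mR2) (F : mR2 -> R) : measurable A ->
  (leb2 R).-integrable A (EFin \o F) ->
  (\int[leb2 R]_(p in A) (F p)%:E = \int[mu]_y \int[mu]_x ((F \_ A) (x, y))%:E)%E.
Proof.
move=> mA iF; rewrite integral_mkcond.
have iF' : (leb2 R).-integrable setT ((EFin \o F) \_ A).
  by apply/(integrable_mkcond _ mA).1.
rewrite -(integral21_prod_meas1 iF').
by apply: eq_integral => y _; apply: eq_integral => x _; rewrite restrict_EFin.
Qed.

Lemma integral_plane_xy (A : set mR2) (F : mR2 -> R) : measurable A ->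
  (leb2 R).-integrable A (EFin \o F) ->
  (\int[leb2 R]_(p in A) (F p)%:E = \int[mu]_x \int[mu]_y ((F \_ A) (x, y))%:E)%E.
Proof.
move=> mA iF; rewrite integral_mkcond.
have iF' : (leb2 R).-integrable setT ((EFin \o F) \_ A).
  by apply/(integrable_mkcond _ mA).1.
rewrite -(integral12_prod_meas1 iF').
by apply: eq_integral => y _; apply: eq_integral => x _; rewrite restrict_EFin.
Qed.

(* The two iterated integrals of a function that vanishes off a region lying
   over [lo, hi] whose slice at [y] is [0, len y] or, for a rectangle, [a, b]. *)
Lemma iterated_integral_patch (F : R -> R -> R) (I : set R) (J : R -> set R) (B : set (R * R)) :
  measurable (I : set mR) -> (forall y, measurable (J y : set mR)) ->
  (forall x y, B (x, y) <-> I y /\ J y x) ->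
  (\int[mu]_y \int[mu]_x (((fun p => F p.1 p.2) \_ B) (x, y))%:E =
   \int[mu]_(y in I) \int[mu]_(x in J y) (F x y)%:E)%E.
Proof.
move=> mI mJ BE; rewrite [RHS]integral_mkcond; apply: eq_integral => y _.
rewrite patchE; case: ifPn => [/set_mem Iy|/negP yI].
  rewrite [RHS]integral_mkcond; apply: eq_integral => x _; rewrite !patchE.
  case: ifPn => [/set_mem/BE[_ Jx]|/negP nB]; first by rewrite mem_set.
  by case: ifPn => // /set_mem Jx; case: nB; apply/mem_set/BE.
rewrite integral0_eq// => x _; rewrite patchE; case: ifPn => // /set_mem/BE[Iy _].
by case: yI; exact: mem_set.
Qed.

Lemma integral_tri_yx (F : R * R -> R) : {within T, continuous F} ->
  (\int[leb2 R]_(p in T) (F p)%:E =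
   \int[mu]_(y in `[0%R, 1%R]) \int[mu]_(x in `[0%R, (1 - y)%R]) (F (x, y))%:E)%E.
Proof.
move=> cF; rewrite integral_plane_yx; last 2 first.
- exact: measurable_tri_ref.
- exact: within_continuous_integrable_tri.
rewrite -(@iterated_integral_patch (fun x y => F (x, y)) _ _ T).
- by apply: eq_integral => y _; apply: eq_integral => x _; congr (_%:E); rewrite !patchE.
- exact: measurable_itv.
- by move=> y; exact: measurable_itv.
- move=> x y; rewrite /tri_ref /= !in_itv /=; split=> [[x0 y0 xy]|[/andP[? ?] /andP[? ?]]].
    by split; apply/andP; split => //; lra.
  by split => //; lra.
Qed.

Lemma integral_tri_xy (F : R * R -> R) : {within T, continuous F} ->
  (\int[leb2 R]_(p in T) (F p)%:E =
   \int[mu]_(x in `[0%R, 1%R]) \int[mu]_(y in `[0%R, (1 - x)%R]) (F (x, y))%:E)%E.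
Proof.
move=> cF; rewrite integral_plane_xy; last 2 first.
- exact: measurable_tri_ref.
- exact: within_continuous_integrable_tri.
rewrite -(@iterated_integral_patch (fun y x => F (x, y)) _ _ [set p | T (p.2, p.1)]).
- by apply: eq_integral => y _; apply: eq_integral => x _; congr (_%:E); rewrite !patchE /= !mem_setE.
- exact: measurable_itv.
- by move=> y; exact: measurable_itv.
- move=> x y; rewrite /tri_ref /= !in_itv /=; split=> [[x0 y0 xy]|[/andP[? ?] /andP[? ?]]].
    by split; apply/andP; split => //; lra.
  by split => //; lra.
Qed.

Lemma integral_rect_le (a b c d : R) (F : R * R -> R) :
  `[a, b]%classic `*` `[c, d]%classic `<=` T ->
  {within T, continuous F} -> (forall p, T p -> 0 <= F p) ->
  (\int[mu]_(y in `[c, d]) \int[mu]_(x in `[a, b]) (F (x, y))%:E <=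
   \int[leb2 R]_(p in T) (F p)%:E)%E.
Proof.
move=> QT cF F0.
have mQ : measurable (`[a, b]%classic `*` `[c, d]%classic : set mR2).
  by apply: measurableX; exact: measurable_itv.
have iF := within_continuous_integrable_tri cF.
have iFQ : (leb2 R).-integrable (`[a, b]%classic `*` `[c, d]%classic) (EFin \o F).
  by apply: integrableS iF => //; exact: measurable_tri_ref.
have <- : (\int[leb2 R]_(p in `[a, b]%classic `*` `[c, d]%classic) (F p)%:E =
  \int[mu]_(y in `[c, d]) \int[mu]_(x in `[a, b]) (F (x, y))%:E)%E.
  rewrite -(@iterated_integral_patch (fun x y => F (x, y)) _ _ (`[a, b]%classic `*` `[c, d]%classic)).
  - rewrite integral_plane_yx//.
  - exact: measurable_itv.
  - by move=> y; exact: measurable_itv.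
  - by move=> x y; split=> -[].
apply: ge0_subset_integral => //; first exact: measurable_tri_ref.
  apply/measurable_EFinP; apply: within_continuous_measurable_plane => //.
  exact: measurable_tri_ref.
Qed.

End Fubini.

(** * Restriction to curves and the fundamental theorem of calculus *)

Section Curves.
Variable R : realType.
Local Notation mu := (@lebesgue_measure R).

Lemma within_continuous_curve (V W : topologicalType) (A : set V) (B : set W) (f : W -> R) (c : V -> W) :
  continuous c -> (forall s, A s -> B (c s)) -> {within B, continuous f} ->
  {within A, continuous (f \o c)}.
Proof.
move=> cc AB /subspace_continuousP cf; apply/subspace_continuousP => x Ax.
have fB := cf _ (AB _ Ax).
apply: (@cvg_comp _ _ _ c f _ (within B (nbhs (c x)))) fB.
move=> N NB; have h : \forall y \near x, B (c y) -> N (c y) := cc x _ NB.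
change (\forall y \near x, A y -> N (c y)).
by apply: filterS h => y h Ay; apply: h; exact: AB.
Qed.

Lemma continuous_pairr (V W : topologicalType) (y : W) : continuous (fun x : V => (x, y)).
Proof.
move=> x; apply: (@cvg_pair _ _ _ (nbhs x) (nbhs x) (nbhs y) _ _ _ id (cst y)).
  exact: cvg_id.
exact: cvg_cst.
Qed.

Lemma continuous_pairl (V W : topologicalType) (x : V) : continuous (fun y : W => (x, y)).
Proof.
move=> y; apply: (@cvg_pair _ _ _ (nbhs y) (nbhs x) (nbhs y) _ _ _ (cst x) id).
  exact: cvg_cst.
exact: cvg_id.
Qed.

Lemma FTC2_closed (F f : R -> R) (a b : R) : a <= b ->
  (forall x, a <= x <= b -> is_derive x 1 F (f x)) ->
  {within `[a, b], continuous f} ->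
  (\int[mu]_(x in `[a, b]) (f x)%:E = (F b - F a)%:E)%E.
Proof.
rewrite le_eqVlt => /predU1P[<- _ _|ab dF cf].
  by rewrite set_itv1 integral_set1 subrr.
have cF x : a <= x <= b -> {for x, continuous F}.
  by move=> /dF[dFx _]; apply/differentiable_continuous/derivable1_diffP.
rewrite (@continuous_FTC2 _ _ F _ _ ab cf) ?EFinB//.
  split.
  - by move=> x; rewrite in_itv /= => /andP[/ltW ax /ltW xb]; have [] := dF x _; first exact/andP.
  - by apply: cvg_at_right_filter; apply: cF; rewrite lexx ltW.
  - by apply: cvg_at_left_filter; apply: cF; rewrite lexx ltW.
move=> x; rewrite in_itv /= => /andP[/ltW ax /ltW xb]; rewrite derive1E.
by have [] := dF x _; first exact/andP.
Qed.

Lemma derive_slice1 (f : R * R -> R) (x y d : R) : is_derive (x, y) (bvec R 0) f d ->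
  is_derive x 1 (fun r => f (r, y)) d.
Proof.
have E r : (r, y) = r *: bvec R 0 + (0, y).
  by rewrite /bvec /=; congr (_, _); rewrite /= ?[_ *: _]mulr1 ?[_ *: _]mulr0 ?addr0 ?add0r.
rewrite E => /is_derive_line.
by rewrite (_ : (fun r => _) = (fun r => f (r, y)))//; apply/funext => r; rewrite -E.
Qed.

Lemma derive_slice2 (f : R * R -> R) (x y d : R) : is_derive (x, y) (bvec R 1) f d ->
  is_derive y 1 (fun r => f (x, r)) d.
Proof.
have E r : (x, r) = r *: bvec R 1 + (x, 0).
  by rewrite /bvec /=; congr (_, _); rewrite /= ?[_ *: _]mulr1 ?[_ *: _]mulr0 ?addr0 ?add0r.
rewrite E => /is_derive_line.
by rewrite (_ : (fun r => _) = (fun r => f (x, r)))//; apply/funext => r; rewrite -E.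
Qed.

End Curves.

(** * Edges of the reference triangle and Green's formula for C^1 functions *)

Section Edges.
Variable R : realType.
Local Notation mu := (@lebesgue_measure R).
Local Notation T := (@tri_ref R).

Definition h0 : 'I_3 := @Ordinal 3 0 isT.
Definition h1 : 'I_3 := @Ordinal 3 1 isT.
Definition h2 : 'I_3 := @Ordinal 3 2 isT.

Lemma I3_ind (P : 'I_3 -> Prop) : P h0 -> P h1 -> P h2 -> forall h, P h.
Proof.
move=> P0 P1 P2 [[|[|[|//]]] i].
- by rewrite (_ : Ordinal i = h0)//; exact: val_inj.
- by rewrite (_ : Ordinal i = h1)//; exact: val_inj.
- by rewrite (_ : Ordinal i = h2)//; exact: val_inj.
Qed.

Lemma sum3 (V : nmodType) (F : 'I_3 -> V) : \sum_h F h = F h0 + (F h1 + F h2).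
Proof.
by rewrite !big_ord_recl big_ord0 addr0; congr (F _ + (F _ + F _)); exact: val_inj.
Qed.

Lemma sum2 (V : nmodType) (F : 'I_2 -> V) : \sum_i F i = F 0 + F 1.
Proof. by rewrite !big_ord_recl big_ord0 addr0; congr (F _ + F _); exact: val_inj. Qed.

Lemma coord0 (u : R * R) : coord 0 u = u.1. Proof. by []. Qed.
Lemma coord1 (u : R * R) : coord 1 u = u.2. Proof. by []. Qed.

Lemma edge_vec0 : edge_vec R h0 = (1, 0).
Proof. by rewrite /edge_vec /corner /=; congr (_, _) => /=; rewrite subr0. Qed.
Lemma edge_vec1 : edge_vec R h1 = (-1, 1).
Proof. by rewrite /edge_vec /corner /=; congr (_, _) => /=; rewrite ?subr0 ?sub0r. Qed.
Lemma edge_vec2 : edge_vec R h2 = (0, -1).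
Proof. by rewrite /edge_vec /corner /=; congr (_, _) => /=; rewrite ?subr0 ?sub0r. Qed.
Definition edge_vecE := (edge_vec0, edge_vec1, edge_vec2).

Lemma edge_pt0 (s : R) : edge_pt h0 s = (s, 0).
Proof. by rewrite /edge_pt edge_vec0; congr (_, _); cbn; ring. Qed.
Lemma edge_pt1 (s : R) : edge_pt h1 s = (1 - s, s).
Proof. by rewrite /edge_pt edge_vec1; congr (_, _); cbn; ring. Qed.
Lemma edge_pt2 (s : R) : edge_pt h2 s = (0, 1 - s).
Proof. by rewrite /edge_pt edge_vec2; congr (_, _); cbn; ring. Qed.
Definition edge_ptE := (edge_pt0, edge_pt1, edge_pt2).

Lemma edge_pt_tri h (s : R) : 0 <= s <= 1 -> T (edge_pt h s).
Proof.
by case/andP; elim/I3_ind: h => s0 s1; rewrite edge_ptE /tri_ref /=; split; lra.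
Qed.

Lemma continuous_edge_pt h : continuous (@edge_pt R h).
Proof.
move=> s; apply: cvgD; first exact: cvg_cst.
by apply: cvgZr_tmp; exact: cvg_id.
Qed.

(** At boundary points of [A] the derivatives use the extension of [f] beyond [A], while continuity
    is only relative to [A]; this fits functions that are smooth near the closed triangle. *)
Record C1_on (A : set (R * R)) (f : R * R -> R) (df : 'I_2 -> R * R -> R) : Prop := {
  C1_derive : forall p i, A p -> is_derive p (bvec R i) f (df i p);
  C1_cont : {within A, continuous f};
  C1_dcont : forall i, {within A, continuous (df i)} }.

Lemma edge_continuous h (f : R * R -> R) : {within T, continuous f} ->
  {within `[0, 1], continuous (fun s => f (edge_pt h s))}.
Proof.
apply: within_continuous_curve; first exact: continuous_edge_pt.
by move=> s; rewrite /= in_itv /=; exact: edge_pt_tri.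
Qed.

Lemma edge_integrable h (f : R * R -> R) : {within T, continuous f} ->
  mu.-integrable `[0, 1] (fun s => (f (edge_pt h s))%:E).
Proof.
move=> cf; apply: continuous_compact_integrable; first exact: segment_compact.
exact: edge_continuous.
Qed.

Lemma Rintegral_onem (f : R -> R) : {within `[0, 1], continuous f} ->
  \int[mu]_(s in `[0, 1]) f (1 - s) = \int[mu]_(s in `[0, 1]) f s.
Proof.
move=> cf; have r01 : 0 <= (1 : R) <= 1 by rewrite ler01 lexx.
rewrite (Rintegration_by_substitution_onem r01 cf).
by rewrite -[X in Interval (BLeft X)](subrr (1 : R)).
Qed.

(** The fundamental theorem of calculus on the slices parallel to axis [i]. Each slice joins the
    hypotenuse [h1] to one leg, and the [i]-th component of the conormal vanishes on the other
    leg. *)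
Lemma green_smooth f df i : C1_on T f df ->
  \int[leb2 R]_(p in T) df i p =
  \sum_h \int[mu]_(s in `[0, 1]) (f (edge_pt h s) * coord i (conormal R h)).
Proof.
case=> dF cf cdf; rewrite sum3 /conormal !edge_vecE /=.
have h01 (s : R) : s \in `[0%R, 1] -> 0 <= s <= 1 by rewrite in_itv.
have cT0 : {within `[0, 1], continuous (fun s => f (edge_pt h0 s))} by exact: edge_continuous.
have cT1 : {within `[0, 1], continuous (fun s => f (edge_pt h1 s))} by exact: edge_continuous.
have cT2 : {within `[0, 1], continuous (fun s => f (edge_pt h2 s))} by exact: edge_continuous.
have iT (g : R -> R) : {within `[0, 1], continuous g} -> mu.-integrable `[0, 1] (EFin \o g).
  by move=> cg; apply: continuous_compact_integrable => //; exact: segment_compact.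
have mI : measurable (`[0, 1]%classic : set (measurableTypeR R)) by exact: measurable_itv.
have onemC (g : R -> R) : {within `[0, 1], continuous g} -> {within `[0, 1], continuous (fun s : R => g (1 - s))}.
  apply: within_continuous_curve => [s|s]; first by apply: cvgB; [exact: cvg_cst|exact: cvg_id].
  by rewrite /= !in_itv /= => /andP[? ?]; apply/andP; split; lra.
have [->|->] : i = 0 \/ i = 1.
  by case: i => [[|[|//]]] ?; [left|right]; exact: val_inj.
- rewrite !coord0 /= !RintegralZr//; [|exact: iT..].
  rewrite mulr0 mulr1 mulrN1 add0r.
  (* The leg [h2] runs downwards when the boundary is traversed counterclockwise, so its point at
     height [y] has parameter [1 - y]. *)
  have -> : \int[leb2 R]_(p in T) df 0 p =
      \int[mu]_(y in `[0, 1]) (f (edge_pt h1 y) - f (edge_pt h2 (1 - y))).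
    rewrite /Rintegral integral_tri_yx//; congr fine; apply: eq_integral => y /set_mem /h01 /andP[y0 y1].
    rewrite edge_pt1 edge_pt2 subKr.
    apply: (@FTC2_closed _ (fun x => f (x, y)) (fun x => df 0 (x, y))).
    - by rewrite subr_ge0.
    - move=> x /andP[x0 x1]; apply: derive_slice1; apply: dF; split => //=; lra.
    - apply: (@within_continuous_curve _ _ _ _ T (df 0) (fun x => (x, y))) => //.
        exact: continuous_pairr.
      by move=> x; rewrite /= in_itv /= => /andP[x0 x1]; split => //=; lra.
  rewrite (Rintegral_sub mI (iT _ cT1) (iT _ (onemC _ cT2))).
  by rewrite (Rintegral_onem cT2).
- rewrite !coord1 /= !RintegralZr//; [|exact: iT..].
  rewrite oppr0 mulr0 opprK mulr1 mulrN1 addr0 addrC.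
  have -> : \int[leb2 R]_(p in T) df 1 p =
      \int[mu]_(x in `[0, 1]) (f (edge_pt h1 (1 - x)) - f (edge_pt h0 x)).
    rewrite /Rintegral integral_tri_xy//; congr fine; apply: eq_integral => x /set_mem /h01 /andP[x0 x1].
    rewrite edge_pt1 edge_pt0 subKr.
    apply: (@FTC2_closed _ (fun y => f (x, y)) (fun y => df 1 (x, y))).
    - by rewrite subr_ge0.
    - move=> y /andP[y0 y1]; apply: derive_slice2; apply: dF; split => //=; lra.
    - apply: (@within_continuous_curve _ _ _ _ T (df 1) (fun y => (x, y))) => //.
        exact: continuous_pairl.
      by move=> y; rewrite /= in_itv /= => /andP[y0 y1]; split => //=; lra.
  rewrite (Rintegral_sub mI (iT _ (onemC _ cT1)) (iT _ cT0)).
  by rewrite (Rintegral_onem cT1).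
Qed.

End Edges.

(** * A Sobolev-type pointwise bound on rectangles *)

Lemma le_Rintegral_subset d (X : measurableType d) (R : realType) (m : {measure set X -> \bar R})
    (A B : set X) (f : X -> R) : measurable A -> measurable B -> A `<=` B ->
  m.-integrable B (EFin \o f) -> (forall x, 0 <= f x) ->
  \int[m]_(x in A) f x <= \int[m]_(x in B) f x.
Proof.
move=> mA mB AB iB f0; have iA := integrableS mB mA AB iB.
apply: fine_le; [exact: integrable_fin_num iA|exact: integrable_fin_num iB|].
apply: ge0_subset_integral => //; first by case/integrableP: iB.
by move=> x _; rewrite lee_fin.
Qed.

Section SupBound.
Variable R : realType.
Local Notation mR := (measurableTypeR R).
Local Notation mR2 := (mR * mR)%type.
Local Notation mu := (@lebesgue_measure R).
Local Notation T := (@tri_ref R).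

Lemma within_continuous_integrable_itv (a b : R) (f : R -> R) :
  {within `[a, b], continuous f} -> mu.-integrable `[a, b] (EFin \o f).
Proof. by move=> cf; apply: continuous_compact_integrable => //; exact: segment_compact. Qed.

Lemma within_continuous_norm (V : topologicalType) (A : set V) (f : V -> R) :
  {within A, continuous f} -> {within A, continuous (fun x => `|f x|)}.
Proof. by move=> cf x; apply: cvg_norm; exact: cf. Qed.

Lemma Rintegral_itv_cst (a b r : R) : a <= b -> \int[mu]_(x in `[a, b]) r = (b - a) * r.
Proof.
move=> ab; rewrite Rintegral_cst; last exact: measurable_itv.
rewrite mulrC; congr (_ * _).
have E : (@lebesgue_measure R) `[a, b]%classic = (b - a)%:E.
  by rewrite lebesgue_measure_itv /= lte_fin; move: ab; case: ltgtP => // -> _; rewrite subrr.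
exact: (congr1 fine E).
Qed.

Lemma increment_bound (g dg : R -> R) (a b u w : R) :
  (forall r, a <= r <= b -> is_derive r 1 g (dg r)) ->
  {within `[a, b], continuous dg} -> a <= u <= b -> a <= w <= b ->
  `|g w - g u| <= \int[mu]_(r in `[a, b]) `|dg r|.
Proof.
move=> dgP cdg.
wlog uw : u w / u <= w.
  move=> H uab wab; have [uw|/ltW wu] := leP u w; first exact: H.
  by rewrite distrC; exact: H.
move=> /andP[au ub] /andP[aw wb].
have sub : `[u, w] `<=` `[a, b].
  by move=> r /=; rewrite !in_itv /= => /andP[ur rw]; rewrite (le_trans au ur) (le_trans rw wb).
have cdg' : {within `[u, w], continuous dg} by exact: continuous_subspaceW sub cdg.
have gu r : u <= r <= w -> is_derive r 1 g (dg r).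
  by move=> /andP[ur rw]; apply: dgP; rewrite (le_trans au ur) (le_trans rw wb).
have -> : g w - g u = \int[mu]_(r in `[u, w]) dg r.
  by rewrite /Rintegral (FTC2_closed uw gu cdg').
apply: le_trans (le_normr_Rintegral _ _) _ => //; first exact: within_continuous_integrable_itv.
have icd := within_continuous_integrable_itv (within_continuous_norm cdg).
exact: le_Rintegral_subset.
Qed.

(** By [increment_bound], |g x| is at most |g r| plus the integral of |g'|, for every r; averaging
    over r gives the bound. *)
Lemma point_bound (g dg : R -> R) (a b x : R) : a <= x <= b ->
  (forall r, a <= r <= b -> is_derive r 1 g (dg r)) ->
  {within `[a, b], continuous dg} ->
  (b - a) * `|g x| <= \int[mu]_(r in `[a, b]) (`|g r| + (b - a) * `|dg r|).
Proof.
move=> xab dgP cdg.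
have ab : a <= b by case/andP: xab; exact: le_trans.
have cg : {within `[a, b], continuous g}.
  apply: derivable_within_continuous => r; rewrite in_itv /= => /dgP[]; exact.
set K := \int[mu]_(r in `[a, b]) `|dg r|.
have icg := within_continuous_integrable_itv (within_continuous_norm cg).
have icd := within_continuous_integrable_itv (within_continuous_norm cdg).
have icK : mu.-integrable `[a, b] (EFin \o (fun r => (b - a) * `|dg r|)).
  exact: (integrableZl _ (b - a) icd).
rewrite RintegralD// RintegralZl// -/K -Rintegral_itv_cst// -[X in _ <= _ + X]Rintegral_itv_cst//.
have icst r : mu.-integrable `[a, b] (EFin \o (fun _ : R => r)).
  by apply: within_continuous_integrable_itv => ?; exact: cvg_cst.
rewrite -RintegralD//; apply: le_Rintegral => //.
  exact: (integrableD _ icg (icst K)).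
move=> r /=; rewrite in_itv /= => rab.
by rewrite -lerBlDl; apply: le_trans (lerB_dist _ _) _; exact: increment_bound.
Qed.

(** Monotonicity of the outer integral needs measurability of the inner one, which Tonelli's theorem
    provides for [F] extended by zero off the rectangle. *)
Lemma integral_rect_ge (a b c d : R) (F : R * R -> R) (phi : R -> R) :
  `[a, b]%classic `*` `[c, d]%classic `<=` T ->
  {within T, continuous F} -> (forall p, T p -> 0 <= F p) ->
  measurable_fun (`[c, d] : set mR) phi -> (forall y, c <= y <= d -> 0 <= phi y) ->
  (forall y, c <= y <= d -> ((phi y)%:E <= \int[mu]_(x in `[a, b]) (F (x, y))%:E)%E) ->
  (\int[mu]_(y in `[c, d]) (phi y)%:E <= \int[leb2 R]_(p in T) (F p)%:E)%E.
Proof.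
move=> QT cF F0 mphi phi0 hphi; apply: le_trans (integral_rect_le QT cF F0).
have mQ : measurable (`[a, b]%classic `*` `[c, d]%classic : set mR2).
  by apply: measurableX; exact: measurable_itv.
set G := fun y => (\int[mu]_x ((F \_ (`[a, b]%classic `*` `[c, d]%classic)) (x, y))%:E)%E.
have mG : measurable_fun setT G.
  apply: (@measurable_fun_fubini_tonelli_G _ _ mR mR R mu (fun p => ((F \_ (`[a, b]%classic `*` `[c, d]%classic)) p)%:E)).
    apply/measurable_EFinP/(measurable_restrictT _ _).1 => //.
    apply: measurable_funS (within_continuous_measurable_plane _ cF) => //; exact: measurable_tri_ref.
  by move=> p; rewrite lee_fin patchE; case: ifPn => // /set_mem /QT /F0.
have GE y : c <= y <= d -> G y = (\int[mu]_(x in `[a, b]) (F (x, y))%:E)%E.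
  move=> ycd; rewrite /G [RHS]integral_mkcond; apply: eq_integral => x _; rewrite !patchE.
  case: ifPn => [/set_mem[/= xab _]|/negP nQ]; first by rewrite mem_set.
  by case: ifPn => // /set_mem xab; case: nQ; apply/mem_set; split => //=; rewrite in_itv.
rewrite [leRHS](_ : _ = \int[mu]_(y in `[c, d]) G y)%E; last first.
  by apply: eq_integral => y /set_mem /=; rewrite in_itv /= => /GE ->.
apply: ge0_le_integral => //.
- exact/measurable_EFinP.
- exact: measurable_funTS.
- by move=> y /=; rewrite in_itv /= => ycd; rewrite GE//; exact: hphi.
Qed.

End SupBound.

Section Approximation.
Variable R : realType.
Local Notation mR := (measurableTypeR R).
Local Notation mR2 := (mR * mR)%type.
Local Notation mu := (@lebesgue_measure R).
Local Notation T := (@tri_ref R).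

Lemma C1_onB A (f g : R * R -> R) df dg : C1_on A f df -> C1_on A g dg ->
  C1_on A (fun p => f p - g p) (fun i p => df i p - dg i p).
Proof.
move=> [Df cf cdf] [Dg cg cdg]; split.
- by move=> p i Ap; apply: is_deriveB; [exact: Df|exact: Dg].
- by move=> p; apply: cvgB; [exact: cf|exact: cg].
- by move=> i p; apply: cvgB; [exact: cdf|exact: cdg].
Qed.

Lemma C1_onM A (f g : R * R -> R) df dg : C1_on A f df -> C1_on A g dg ->
  C1_on A (fun p => f p * g p) (fun i p => df i p * g p + f p * dg i p).
Proof.
move=> [Df cf cdf] [Dg cg cdg]; split.
- move=> p i Ap; have := is_deriveM (Df p i Ap) (Dg p i Ap).
  by move=> /is_derive_eq; apply; rewrite addrC mulrC.
- by move=> p; apply: cvgM; [exact: cf|exact: cg].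
- move=> i p; apply: cvgD; apply: cvgM.
  + exact: cdf.
  + exact: cg.
  + exact: cf.
  + exact: cdg.
Qed.

Lemma smooth_C1_on (A : set (R * R)) (f : R * R -> R) : smooth setT f ->
  C1_on A f (fun i => 'D_(bvec R i) f).
Proof.
move=> sf; have cont h : smooth [set: R * R] h -> {within A, continuous h}.
  by move=> sh; apply: continuous_subspaceT => p; exact: (smooth_cont (U := setT)).
split.
- by move=> p i _; apply: derivableP; exact: (smooth_derivable (U := setT)).
- exact: cont.
- by move=> i; apply: cont; exact: smooth_D.
Qed.

(** [point_bound] is applied vertically to [u], and then horizontally to both [u] and its vertical
    derivative. Thus the mixed derivative is the only second derivative involved. Side lengths of at
    most one permit dropping them as coefficients on the right. *)
Lemma rect_point_bound (u : R * R -> R) du w (a b c d x y : R) :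
  `[a, b]%classic `*` `[c, d]%classic `<=` T -> b - a <= 1 -> d - c <= 1 ->
  C1_on T u du -> C1_on T (du 1) w -> a <= x <= b -> c <= y <= d ->
  (b - a) * (d - c) * `|u (x, y)| <=
  \int[leb2 R]_(p in T) (`|u p| + `|du 0 p| + `|du 1 p| + `|w 0 p|).
Proof.
move=> QT ba1 dc1 [Du cu cdu] [Dv _ cw] xab ycd.
have ab : 0 <= b - a by rewrite subr_ge0; case/andP: xab; exact: le_trans.
have cd : 0 <= d - c by rewrite subr_ge0; case/andP: ycd; exact: le_trans.
have inT (r s : R) : a <= r <= b -> c <= s <= d -> T (r, s).
  by move=> ? ?; apply: QT; split; rewrite /= in_itv.
have ch (f : R * R -> R) (s : R) : {within T, continuous f} -> c <= s <= d ->
    {within `[a, b], continuous (fun r : R => f (r, s))}.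
  move=> cf scd. apply: (@within_continuous_curve _ _ _ _ T f (fun r => (r, s))) => //.
    exact: continuous_pairr.
  by move=> r; rewrite /= in_itv /= => ?; exact: inT.
have cv (f : R * R -> R) : {within T, continuous f} ->
    {within `[c, d], continuous (fun s : R => f (x, s))}.
  move=> cf; apply: (@within_continuous_curve _ _ _ _ T f (fun s => (x, s))) => //.
    exact: continuous_pairl.
  by move=> s; rewrite /= in_itv /= => ?; exact: inT.
have nrm := @within_continuous_norm R.
set F := fun p : R * R => `|u p| + `|du 0 p| + `|du 1 p| + `|w 0 p|.
have cF : {within T, continuous F}.
  move=> p; do 3 (apply: cvgD; last by apply: nrm; first [exact: cdu|exact: cw]).
  by apply: nrm.
have F0 p : T p -> 0 <= F p by move=> _; rewrite /F !addr_ge0.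
(* The integrand of [point_bound] on the vertical segment through [x], times the width of the
   rectangle; the horizontal estimates bound it by the integral of [F] over the slice at height
   [s]. *)
pose phi s := (b - a) * (`|u (x, s)| + (d - c) * `|du 1 (x, s)|).
have cphi : {within `[c, d], continuous phi}.
  move=> s; apply: cvgM; first exact: cvg_cst.
  apply: cvgD; first by apply: nrm; exact: cv.
  by apply: cvgM; [exact: cvg_cst|apply: nrm; exact: cv].
have iphi := within_continuous_integrable_itv cphi.
have := @integral_rect_ge R a b c d F phi QT cF F0.
have -> : (\int[leb2 R]_(p in T) (F p)%:E)%E = (\int[leb2 R]_(p in T) F p)%:E.
  by rewrite /Rintegral fineK//; apply: integrable_fin_num (within_continuous_integrable_tri cF); exact: measurable_tri_ref.
have -> : (\int[mu]_(s in `[c, d]) (phi s)%:E)%E = (\int[mu]_(s in `[c, d]) phi s)%:E.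
  by rewrite /Rintegral fineK//; exact: integrable_fin_num iphi.
rewrite lee_fin => key.
have : \int[mu]_(s in `[c, d]) phi s <= \int[leb2 R]_(p in T) F p.
  apply: key.
  - by have /integrableP[/measurable_EFinP] := iphi.
  - by move=> s _; rewrite /phi; apply: mulr_ge0 => //; apply: addr_ge0 => //; apply: mulr_ge0.
  - move=> s scd.
    have cFs := ch F s cF scd.
    have iFs := within_continuous_integrable_itv cFs.
    have -> : (\int[mu]_(r in `[a, b]) (F (r, s))%:E)%E = (\int[mu]_(r in `[a, b]) F (r, s))%:E.
      by rewrite /Rintegral fineK//; exact: integrable_fin_num iFs.
    rewrite lee_fin.
    have B1 := @point_bound R (fun r => u (r, s)) (fun r => du 0 (r, s)) a b x xab
      (fun r rab => derive_slice1 (Du _ 0 (inT r s rab scd))) (ch _ s (cdu 0) scd).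
    have B2 := @point_bound R (fun r => du 1 (r, s)) (fun r => w 0 (r, s)) a b x xab
      (fun r rab => derive_slice1 (Dv _ 0 (inT r s rab scd))) (ch _ s (cw 0) scd).
    have B2' := ler_wpM2l cd B2.
    have c1 : {within `[a, b], continuous (fun r : R => `|u (r, s)| + (b - a) * `|du 0 (r, s)|)}.
      move=> r; apply: cvgD; first by apply: nrm; exact: ch.
      by apply: cvgM; [exact: cvg_cst|apply: nrm; exact: ch].
    have c2 : {within `[a, b], continuous (fun r : R => `|du 1 (r, s)| + (b - a) * `|w 0 (r, s)|)}.
      move=> r; apply: cvgD; first by apply: nrm; exact: ch.
      by apply: cvgM; [exact: cvg_cst|apply: nrm; exact: ch].
    have c3 : {within `[a, b], continuous (fun r : R => (d - c) * (`|du 1 (r, s)| + (b - a) * `|w 0 (r, s)|))}.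
      by move=> r; apply: cvgM; [exact: cvg_cst|exact: c2].
    have i1 := within_continuous_integrable_itv c1; have i2 := within_continuous_integrable_itv c2.
    have i3 := within_continuous_integrable_itv c3.
    rewrite -RintegralZl// in B2'.
    have := lerD B1 B2'; rewrite -RintegralD// => B.
    apply: (le_trans _ (le_trans B _)).
      by rewrite /phi mulrDr mulrCA.
    apply: le_Rintegral => //.
      exact: (integrableD _ i1 i3).
    move=> r _; rewrite /F.
    have h1 : (b - a) * `|du 0 (r, s)| <= `|du 0 (r, s)| by rewrite ler_piMl.
    have h2 : (d - c) * `|du 1 (r, s)| <= `|du 1 (r, s)| by rewrite ler_piMl.
    have h3 : (d - c) * ((b - a) * `|w 0 (r, s)|) <= `|w 0 (r, s)|.
      by rewrite mulrA ler_piMl// mulr_ile1.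
    by rewrite mulrDr -!addrA lerD2l; lra.
apply: le_trans.
rewrite /phi RintegralZl//; last first.
  apply: within_continuous_integrable_itv => s; apply: cvgD; first by apply: nrm; exact: cv.
  by apply: cvgM; [exact: cvg_cst|apply: nrm; exact: cv].
rewrite -mulrA; apply: ler_wpM2l => //.
apply: (@point_bound R (fun s => u (x, s)) (fun s => du 1 (x, s))) => //; last exact: cv.
by move=> s scd; apply: derive_slice2; apply: Du; exact: inT.
Qed.

End Approximation.

(** * Uniform convergence of smooth approximants on the edges *)

Section Traces.
Variable R : realType.
Local Notation mR := (measurableTypeR R).
Local Notation mR2 := (mR * mR)%type.
Local Notation mu := (@lebesgue_measure R).
Local Notation T := (@tri_ref R).
Local Notation nrm := (@within_continuous_norm R _ _ _).

Definition L1dist (f g : R * R -> R) : R := \int[leb2 R]_(p in T) `|f p - g p|.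

(** The approximation from the definition of the gradient trace, weakened from L^2 to L^1, which is
    what limits of integrals against bounded functions require. *)
Record approximants (v : H2fun R) (phi : nat -> R * R -> R) : Prop := {
  appr_smooth : forall n, smooth setT (phi n);
  appr_val : L1dist (phi n) v @[n --> \oo] --> 0;
  appr_grad : forall i, L1dist ('D_(bvec R i) (phi n)) (h2_grad v i) @[n --> \oo] --> 0;
  appr_hess : forall i j, L1dist ('D_(bvec R j) ('D_(bvec R i) (phi n))) (h2_hess v i j) @[n --> \oo] --> 0;
  appr_trace : forall h i,
    \int[mu]_(s in `[0, 1]) `|'D_(bvec R i) (phi n) (edge_pt h s) - h2_trace v h i s| @[n --> \oo] --> 0 }.

Lemma continuous_measurable_tri (f : R * R -> R) : {within T, continuous f} ->
  measurable_fun (T : set mR2) (f : mR2 -> mR).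
Proof. by apply: within_continuous_measurable_plane; exact: measurable_tri_ref. Qed.

Lemma h2_integrable (v : H2fun R) : (leb2 R).-integrable T (EFin \o v).
Proof. by apply: within_continuous_integrable_tri; exact: h2_cont. Qed.

Lemma h2_grad_integrable (v : H2fun R) i : (leb2 R).-integrable T (EFin \o h2_grad v i).
Proof.
apply: L2_integrable; [exact: measurable_tri_ref|exact: leb2_tri_ref_lty|].
by have [] := h2_is_H2 v.
Qed.

Lemma h2_hess_integrable (v : H2fun R) i j : (leb2 R).-integrable T (EFin \o h2_hess v i j).
Proof.
apply: L2_integrable; [exact: measurable_tri_ref|exact: leb2_tri_ref_lty|].
by have [] := h2_is_H2 v.
Qed.

Lemma lebesgue01_lty : (mu `[0%R, 1%R] < +oo)%E.
Proof. by rewrite lebesgue_measure_itv /= lte_fin ltr01 oppr0 adde0 ltry. Qed.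

Lemma h2_trace_integrable (v : H2fun R) h i : mu.-integrable `[0, 1] (EFin \o h2_trace v h i).
Proof.
apply: L2_integrable => //; [exact: lebesgue01_lty|exact: h2_trace_L2].
Qed.

Lemma h2_approximants (v : H2fun R) : exists phi, approximants v phi.
Proof.
have [phi [sphi vphi gphi hphi tphi]] := h2_is_trace v.
exists phi.
have cphi n := smooth_C1_on T (sphi n).
have cphi2 n i := smooth_C1_on T (smooth_D (bvec R i) (sphi n)).
have mT := @measurable_tri_ref R; have fT := @leb2_tri_ref_lty R.
split => //.
- apply: L2_cvg_L1 => //.
  + by move=> n; apply: continuous_measurable_tri; exact: C1_cont (cphi n).
  + by apply: continuous_measurable_tri; exact: h2_cont.
- move=> i; apply: L2_cvg_L1 => //.
  + by move=> n; apply: continuous_measurable_tri; exact: C1_cont (cphi2 n i).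
  + by have /integrableP[/measurable_EFinP] := h2_grad_integrable v i.
- move=> i j; apply: L2_cvg_L1 => //.
  + by move=> n; apply: continuous_measurable_tri; exact: C1_dcont (cphi2 n i) j.
  + by have /integrableP[/measurable_EFinP] := h2_hess_integrable v i j.
- move=> h i; apply: L2_cvg_L1 => //.
  + exact: lebesgue01_lty.
  + move=> n; have := edge_integrable h (C1_cont (cphi2 n i)).
    by move=> /integrableP[/measurable_EFinP].
  + by have /integrableP[/measurable_EFinP] := h2_trace_integrable v h i.
Qed.

Lemma subinterval (a b x e : R) : e <= b - a -> 0 <= e -> a <= x <= b ->
  exists c, [/\ a <= c, c + e <= b & c <= x <= c + e].
Proof.
move=> eba e0 /andP[ax xb]; have [h|h] := leP (x + e) b.
  by exists x; split => //; apply/andP; split; lra.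
by exists (b - e); split; try (apply/andP; split); lra.
Qed.

Lemma le_of_cvg0 (x y : R) (u : nat -> R) : u n @[n --> \oo] --> 0 ->
  (forall n, x <= y + u n) -> x <= y.
Proof.
move=> u0 xyu; apply/ler_addgt0Pr => e e0.
have /cvgrPdist_le /(_ _ e0) [m _ /(_ m (leqnn m))] := u0.
rewrite /= sub0r normrN => ume; apply: le_trans (xyu m) _.
by rewrite lerD2l; apply: le_trans ume; exact: ler_norm.
Qed.

Lemma bound_closure (f : R -> R) (B : R) : {within `[0, 1], continuous f} ->
  (forall s, 0 < s < 1 -> f s <= B) -> forall s, 0 <= s <= 1 -> f s <= B.
Proof.
move=> cf fB s s01; rewrite leNgt; apply/negP => Bf.
have s01' : `[0, 1]%classic s by rewrite /= in_itv.
have /subspace_continuousP /(_ _ s01') /cvgrPdist_lt := cf.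
have fB0 : 0 < f s - B by rewrite subr_gt0.
move=> /(_ _ fB0); rewrite /within /= => /nbhs_ballP[e /= e0 he].
pose q := Num.min (e / 2) (1 / 4).
have q0 : 0 < q by rewrite lt_min !divr_gt0.
have qe : q < e by apply: (@le_lt_trans _ _ (e / 2)); [rewrite ge_min lexx|lra].
have q1 : q <= 1 / 4 by rewrite ge_min lexx orbT.
clearbody q.
(* A point of the open interval at distance [q] from [s], on the far side from the nearer
   endpoint. *)
pose r := if s <= 1 / 2 then s + q else s - q.
have r01 : 0 < r < 1.
  by rewrite /r; case/andP: s01 => ? ?; case: (leP s (1 / 2)) => ?; apply/andP; split; lra.
have sr : `|s - r| < e.
  by rewrite /r; case: (leP s (1 / 2)) => ?; rewrite ltr_norml; apply/andP; split; lra.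
have r01' : `[0, 1]%classic r by case/andP: r01 => /ltW ? /ltW ?; rewrite /= in_itv; apply/andP.
have : `|f s - f r| < f s - B by exact: (he r sr r01').
by move=> /ltr_normlW; have := fB r r01; lra.
Qed.

Lemma edge_vec_decomp h : edge_vec R h = (edge_vec R h).1 *: bvec R 0 + (edge_vec R h).2 *: bvec R 1.
Proof.
rewrite (_ : bvec R 0 = (1, 0))// (_ : bvec R 1 = (0, 1))//.
by case: (edge_vec R h) => a b; congr (_, _); cbn; ring.
Qed.

Lemma smooth_edge_derive (f : R * R -> R) (h : 'I_3) (s : R) : smooth setT f ->
  is_derive s 1 (fun r => f (edge_pt h r))
    (\sum_i coord i (edge_vec R h) * 'D_(bvec R i) f (edge_pt h s)).
Proof.
move=> sf; have H p : is_derive p (edge_vec R h) f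
    (\sum_i coord i (edge_vec R h) * 'D_(bvec R i) f p).
  rewrite sum2 !coord0 !coord1 [in is_derive _ _ _]edge_vec_decomp.
  have D i c : is_derive p (c *: bvec R i) f (c * 'D_(bvec R i) f p).
    by apply: is_derive_scale; apply: derivableP; apply: (smooth_derivable (U := setT)).
  have [_ <-] := D 0 (edge_vec R h).1; have [_ <-] := D 1 (edge_vec R h).2.
  exact: (smooth_is_derive_add (U := setT) openT).
have E r : edge_pt h r = r *: edge_vec R h + corner R h by rewrite addrC.
have := is_derive_line (H (s *: edge_vec R h + corner R h)); rewrite -E.
by rewrite (_ : (fun r => _) = (fun r => f (edge_pt h r)))//; apply/funext => r; rewrite E.
Qed.

Section EdgeConvergence.
Variables (v : H2fun R) (phi : nat -> R * R -> R).
Hypothesis vphi : approximants v phi.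
Let sphi := appr_smooth vphi.

Let mT := @measurable_tri_ref R.

Let iphi n : (leb2 R).-integrable T (EFin \o phi n).
Proof. by apply: within_continuous_integrable_tri; exact: C1_cont (smooth_C1_on T (sphi n)). Qed.

Let idphi n i : (leb2 R).-integrable T (EFin \o 'D_(bvec R i) (phi n)).
Proof. by apply: within_continuous_integrable_tri; exact: C1_dcont (smooth_C1_on T (sphi n)) i. Qed.

Let iddphi n i j : (leb2 R).-integrable T (EFin \o 'D_(bvec R j) ('D_(bvec R i) (phi n))).
Proof.
apply: within_continuous_integrable_tri.
exact: C1_dcont (smooth_C1_on T (smooth_D (bvec R i) (sphi n))) j.
Qed.

Let iB (f g : R * R -> R) : (leb2 R).-integrable T (EFin \o f) -> (leb2 R).-integrable T (EFin \o g) ->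
  (leb2 R).-integrable T (EFin \o (fun p => `|f p - g p|)).
Proof. by move=> i_f ig; exact: (integrable_norm (integrableB mT i_f ig)). Qed.

Lemma L1dist_triangle (f g h : R * R -> R) : (leb2 R).-integrable T (EFin \o f) ->
  (leb2 R).-integrable T (EFin \o g) -> (leb2 R).-integrable T (EFin \o h) ->
  L1dist f g <= L1dist f h + L1dist g h.
Proof.
move=> i_f ig ih; rewrite /L1dist -RintegralD//; [|exact: iB..].
apply: le_Rintegral => //; first exact: iB.
  exact: (integrableD _ (iB i_f ih) (iB ig ih)).
by move=> p _; rewrite (distrC (g p)); exact: ler_distD.
Qed.

(** The distance from [phi n] to [v] measured by the norms on the right of [rect_point_bound]. *)
Let E n := L1dist (phi n) v + L1dist ('D_(bvec R 0) (phi n)) (h2_grad v 0)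
  + L1dist ('D_(bvec R 1) (phi n)) (h2_grad v 1)
  + L1dist ('D_(bvec R 0) ('D_(bvec R 1) (phi n))) (h2_hess v 1 0).

Let E_cvg : E n @[n --> \oo] --> 0.
Proof.
rewrite -[X in _ --> X](addr0 0) -[X in _ --> X + _](addr0 0) -[X in _ --> X + _ + _](addr0 0).
apply: cvgD; last exact: (appr_hess vphi).
apply: cvgD; last exact: (appr_grad vphi).
apply: cvgD; last exact: (appr_grad vphi).
exact: (appr_val vphi).
Qed.

Section Rectangle.
Variables a b c d : R.
Hypothesis QT : `[a, b]%classic `*` `[c, d]%classic `<=` T.
Hypotheses (ab : a < b) (cd : c < d) (ba1 : b - a <= 1) (dc1 : d - c <= 1).
Let K := (b - a) * (d - c).

Lemma approximants_cauchy n m x y : a <= x <= b -> c <= y <= d ->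
  K * `|phi n (x, y) - phi m (x, y)| <= E n + E m.
Proof.
move=> xab ycd.
have S n' := smooth_C1_on T (sphi n').
have S1 n' := smooth_C1_on T (smooth_D (bvec R 1) (sphi n')).
have := rect_point_bound QT ba1 dc1 (C1_onB (S n) (S m)) (C1_onB (S1 n) (S1 m)) xab ycd.
move=> /le_trans; apply.
have i0 := iB (iphi n) (iphi m); have i1 := iB (idphi n 0) (idphi m 0).
have i2 := iB (idphi n 1) (idphi m 1); have i3 := iB (iddphi n 1 0) (iddphi m 1 0).
have i01 := integrableD mT i0 i1; have i012 := integrableD mT i01 i2.
rewrite (RintegralD mT i012 i3) (RintegralD mT i01 i2) (RintegralD mT i0 i1).
have t0 := L1dist_triangle (iphi n) (iphi m) (h2_integrable v).
have t1 i := L1dist_triangle (idphi n i) (idphi m i) (h2_grad_integrable v i).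
have t2 := L1dist_triangle (iddphi n 1 0) (iddphi m 1 0) (h2_hess_integrable v 1 0).
apply: le_trans (lerD (lerD (lerD t0 (t1 0)) (t1 1)) t2) _.
by rewrite (addrACA (L1dist (phi n) v)) (addrACA (L1dist (phi n) v + _)) (addrACA (L1dist (phi n) v + _ + _)).
Qed.

(** This is [approximants_cauchy] with [m] sent to infinity, although [phi m] is so far known to
    approach [v] only in L^1. A violation at one point would, by continuity, persist with a margin
    on a small square; there [phi m] would stay away from [v], against L^1 convergence. *)
Lemma approximants_bound n x y : a <= x <= b -> c <= y <= d ->
  K * `|phi n (x, y) - v (x, y)| <= E n.
Proof.
move=> xab ycd; rewrite leNgt; apply/negP => lt_.
have K0 : 0 < K by rewrite mulr_gt0// subr_gt0.
pose q p := K * `|phi n p - v p|.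
have cq : {within T, continuous q}.
  move=> p; apply: cvgM; first exact: cvg_cst.
  apply: cvg_norm; apply: cvgB; last exact: h2_cont.
  exact: C1_cont (smooth_C1_on T (sphi n)) p.
set eta := (q (x, y) - E n) / 2.
have eta0 : 0 < eta by rewrite divr_gt0// subr_gt0.
have Tp : T (x, y) by apply: QT; split; rewrite /= in_itv.
have [e e0 he] : exists2 e : R, 0 < e & forall r s, T (r, s) -> `|x - r| < e -> `|y - s| < e ->
    E n + eta < q (r, s).
  have /subspace_continuousP /(_ _ Tp) := cq.
  move=> /cvgrPdist_lt /(_ _ eta0).
  rewrite /within /= => /nbhs_ballP[e /= e0 he].
  exists e => // r s Trs xr ys.
  have : `|q (x, y) - q (r, s)| < eta by exact: (he (r, s) (conj xr ys) Trs).
  by rewrite /eta => /ltr_normlW; move: (q _) (q _) (E n) => *; lra.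
clearbody eta.
pose e' := Num.min (e / 2) (Num.min (b - a) (d - c)).
have e'0 : 0 < e' by rewrite !lt_min !subr_gt0 ab cd divr_gt0.
have [e'e [e'b e'd]] : e' < e /\ e' <= b - a /\ e' <= d - c.
  split; last by split; rewrite !ge_min lexx ?orbT.
  by apply: (@le_lt_trans _ _ (e / 2)); [rewrite ge_min lexx|lra].
have [a' [aa' ab' xa']] := subinterval e'b (ltW e'0) xab.
have [c' [cc' cd' yc']] := subinterval e'd (ltW e'0) ycd.
pose Q : set mR2 := `[a', a' + e']%classic `*` `[c', c' + e']%classic.
have inQ r s : Q (r, s) -> [/\ a <= r <= b, c <= s <= d, T (r, s) & E n + eta < q (r, s)].
  move=> [/=]; rewrite !in_itv /= => /andP[r1 r2] /andP[s1 s2].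
  have rab : a <= r <= b by apply/andP; split; lra.
  have scd : c <= s <= d by apply/andP; split; lra.
  have Trs : T (r, s) by apply: QT; split; rewrite /= in_itv.
  case/andP: xa' => xa1 xa2; case/andP: yc' => ya1 ya2.
  by split => //; apply: he => //; rewrite ltr_norml; apply/andP; split; lra.
have mQ : measurable Q by apply: measurableX; exact: measurable_itv.
have iQ m : (leb2 R).-integrable Q (EFin \o (fun p => `|phi m p - v p|)).
  apply: integrableS (iB (iphi m) (h2_integrable v)) => //.
  by move=> [r s] /inQ[].
have area : fine (leb2 R Q) = e' ^+ 2.
  rewrite /Q leb2_rect; [|by rewrite lerDl ltW..].
  by rewrite /= !(addrC _ e') !addrK expr2.
(* On the square [Q], of area [e' ^+ 2], the distance of [phi m] to [v] exceeds [(eta - E m) / K],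
   while its integral is at most [E m]. *)
have low m : (eta - E m) / K * e' ^+ 2 <= E m.
  apply: (@le_trans _ _ (L1dist (phi m) v)); last first.
    rewrite /E -!addrA lerDl !addr_ge0// /L1dist; exact: Rintegral_ge0.
  apply: (@le_trans _ _ (\int[leb2 R]_(p in Q) `|phi m p - v p|)); last first.
    apply: le_Rintegral_subset => //; first by move=> [r s] /inQ[].
    exact: iB (iphi m) (h2_integrable v).
  rewrite -area -Rintegral_cst//.
  apply: le_Rintegral => //.
    apply: measurable_bounded_integrable => //.
      by rewrite /Q leb2_rect ?ltry// lerDl ltW.
    exact: bounded_cst.
  move=> [r s] /inQ[rab scd _]; rewrite /q => h1.
  have h2 := approximants_cauchy n m rab scd.
  rewrite ler_pdivrMr// mulrC.
  have h3 : `|phi n (r, s) - v (r, s)| <= `|phi n (r, s) - phi m (r, s)| + `|phi m (r, s) - v (r, s)|.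
    exact: ler_distD.
  have := ler_wpM2l (ltW K0) h3; rewrite mulrDr.
  by move: h1 h2; move: (K * _) (K * _) (K * _) (E n) (E m) => *; lra.
have e2 : 0 < e' ^+ 2 by rewrite exprn_gt0.
(* This constant solves [(eta - x) / K * e' ^+ 2 = x]; as soon as [E m] falls below it, [low] is
   contradicted. *)
have small : 0 < eta * e' ^+ 2 / (K + e' ^+ 2) by rewrite divr_gt0 ?mulr_gt0// addr_gt0.
have /cvgrPdist_lt /(_ _ small) [m _ /(_ m (leqnn m))] := E_cvg.
rewrite /= sub0r normrN => /ltr_normlW; rewrite ltr_pdivlMr ?addr_gt0// => Em.
have := low m; rewrite mulrAC ler_pdivrMr//.
by move: Em; move: (E m) (e' ^+ 2) => Em e2'; lra.
Qed.

End Rectangle.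



(** The rectangle [0, r] x [0, 1 - r] has its upper right corner on the hypotenuse. With the [r]
    chosen for each edge it contains the given point, and its area is positive exactly because [s]
    is not an endpoint. *)
Lemma approximants_edge_interior h s : 0 < s < 1 ->
  `|phi n (edge_pt h s) - v (edge_pt h s)| @[n --> \oo] --> 0.
Proof.
move=> s01.
pose r := if h == h1 then 1 - s else s.
have [r0 r1] : 0 < r /\ r < 1.
  by rewrite /r; case/andP: s01 => ? ?; case: ifP => _; split; lra.
have QT : `[0, r]%classic `*` `[0, 1 - r]%classic `<=` T.
  move=> [x y] [/=]; rewrite !in_itv /= => /andP[x0 xr] /andP[y0 yr].
  by split => //=; lra.
have [ex ey] : 0 <= (edge_pt h s).1 <= r /\ 0 <= (edge_pt h s).2 <= 1 - r.
  rewrite /r; case/andP: s01 => ? ?.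
  by elim/I3_ind: h {r r0 r1 QT}; rewrite edge_ptE /=; split; apply/andP; split; lra.
have K0 : 0 < (r - 0) * (1 - r - 0) by rewrite mulr_gt0// subr0// subr_gt0.
have B n : `|phi n (edge_pt h s) - v (edge_pt h s)| <= E n / ((r - 0) * (1 - r - 0)).
  rewrite ler_pdivlMr// mulrC [edge_pt h s]surjective_pairing.
  apply: (approximants_bound QT) => //; lra.
have cE : E n / ((r - 0) * (1 - r - 0)) @[n --> \oo] --> 0.
  by rewrite -[X in _ --> X](mul0r ((r - 0) * (1 - r - 0))^-1); apply: cvgM => //; exact: cvg_cst.
apply: (@squeeze_cvgr _ _ _ _ (cst 0) _ _ _ _ _ cE); last exact: cvg_cst.
by apply: nearW => n; rewrite normr_ge0 B.
Qed.

Definition trace_tangent h s : R := \sum_i coord i (edge_vec R h) * h2_trace v h i s.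

(** Dominates the L^1 distance on the edge between the derivative of [phi n] along the edge and
    [trace_tangent]. *)
Let A h n := \sum_i `|coord i (edge_vec R h)| *
  \int[mu]_(s in `[0, 1]) `|'D_(bvec R i) (phi n) (edge_pt h s) - h2_trace v h i s|.

Let A_cvg h : A h n @[n --> \oo] --> 0.
Proof.
rewrite /A; have -> : (fun n => \sum_i `|coord i (edge_vec R h)| *
  \int[mu]_(s in `[0, 1]) `|'D_(bvec R i) (phi n) (edge_pt h s) - h2_trace v h i s|) =
  (fun n => `|coord 0 (edge_vec R h)| *
  \int[mu]_(s in `[0, 1]) `|'D_(bvec R 0) (phi n) (edge_pt h s) - h2_trace v h 0 s| +
  `|coord 1 (edge_vec R h)| *
  \int[mu]_(s in `[0, 1]) `|'D_(bvec R 1) (phi n) (edge_pt h s) - h2_trace v h 1 s|).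
  by apply/funext => n; rewrite sum2.
have c i : `|coord i (edge_vec R h)| *
    \int[mu]_(s in `[0, 1]) `|'D_(bvec R i) (phi n) (edge_pt h s) - h2_trace v h i s|
    @[n --> \oo] --> 0.
  rewrite -[X in _ --> X](mulr0 (`|coord i (edge_vec R h)|)).
  by apply: cvgM; [exact: cvg_cst|exact: (appr_trace vphi)].
by rewrite -[X in _ --> X](addr0 0); apply: cvgD.
Qed.

Let itr n h i : mu.-integrable `[0, 1]
  (EFin \o (fun s => `|'D_(bvec R i) (phi n) (edge_pt h s) - h2_trace v h i s|)).
Proof.
have cd : {within T, continuous 'D_(bvec R i) (phi n)} := @C1_dcont _ _ _ _ (smooth_C1_on T (sphi n)) i.
have i1 := edge_integrable h cd.
apply: (@integrable_norm _ mR _ _ _ (fun s : mR => 'D_(bvec R i) (phi n) (edge_pt h s) - h2_trace v h i s)).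
exact: (integrableB _ i1 (h2_trace_integrable v h i)).
Qed.

(** The increment of [phi n - phi m] along the edge is controlled by its tangential derivative, and
    both tangential derivatives are close to the same trace. *)
Lemma edge_cauchy h n m s r : 0 <= s <= 1 -> 0 <= r <= 1 ->
  `|(phi n (edge_pt h s) - phi m (edge_pt h s)) - (phi n (edge_pt h r) - phi m (edge_pt h r))|
   <= A h n + A h m.
Proof.
move=> s01 r01.
pose D n' i (s' : R) := 'D_(bvec R i) (phi n') (edge_pt h s').
pose e i := coord i (edge_vec R h).
have cD n' i : {within `[0, 1], continuous (D n' i)}.
  exact: (@edge_continuous _ h ('D_(bvec R i) (phi n')) (@C1_dcont _ _ _ _ (smooth_C1_on T (sphi n')) i)).
pose dg (s' : R) := (e 0 * D n 0 s' + e 1 * D n 1 s') - (e 0 * D m 0 s' + e 1 * D m 1 s').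
have cdg : {within `[0, 1], continuous dg}.
  move=> s'; apply: cvgB; apply: cvgD; (apply: cvgM; first exact: cvg_cst).
  - exact: (cD n 0 s').
  - exact: (cD n 1 s').
  - exact: (cD m 0 s').
  - exact: (cD m 1 s').
have := @increment_bound R (fun s' => phi n (edge_pt h s') - phi m (edge_pt h s')) dg 0 1 r s _ cdg r01 s01.
move=> /(_ _)/le_trans; apply.
  move=> s' _; apply: is_deriveB.
    by have := smooth_edge_derive h s' (sphi n); rewrite sum2.
  by have := smooth_edge_derive h s' (sphi m); rewrite sum2.
pose F n' i (s' : R) := `|D n' i s' - h2_trace v h i s'|.
have iF n' i : mu.-integrable `[0, 1] (EFin \o F n' i) by exact: itr.
have ieF n' i : mu.-integrable `[0, 1] (EFin \o (fun s' => `|e i| * F n' i s')).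
  exact: integrable_scale.
have mI : measurable (`[0, 1]%classic : set mR) by exact: measurable_itv.
have i2 n' := integrable_add mI (ieF n' 0) (ieF n' 1).
have i4 := integrable_add mI (i2 n) (i2 m).
have -> : A h n + A h m = \int[mu]_(s' in `[0, 1])
   ((`|e 0| * F n 0 s' + `|e 1| * F n 1 s') + (`|e 0| * F m 0 s' + `|e 1| * F m 1 s')).
  rewrite (Rintegral_add mI (i2 n) (i2 m)) (Rintegral_add mI (ieF n 0) (ieF n 1)).
  rewrite (Rintegral_add mI (ieF m 0) (ieF m 1)) !(fun n' i => Rintegral_scale mI `|e i| (iF n' i)).
  have AE n' : A h n' = `|e 0| * \int[mu]_(s' in `[0, 1]) F n' 0 s' + `|e 1| * \int[mu]_(s' in `[0, 1]) F n' 1 s'.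
    exact: sum2.
  by rewrite (AE n) (AE m).
apply: le_Rintegral => //.
  exact: within_continuous_integrable_itv (within_continuous_norm cdg).
move=> s' _; rewrite /dg.
have -> : e 0 * D n 0 s' + e 1 * D n 1 s' - (e 0 * D m 0 s' + e 1 * D m 1 s') =
  (e 0 * (D n 0 s' - h2_trace v h 0 s') + e 1 * (D n 1 s' - h2_trace v h 1 s')) -
  (e 0 * (D m 0 s' - h2_trace v h 0 s') + e 1 * (D m 1 s' - h2_trace v h 1 s')).
  by move: (D _ _ _) (D _ _ _) (D _ _ _) (D _ _ _) (h2_trace _ _ _ _) (h2_trace _ _ _ _) => *; ring.
apply: le_trans (ler_normB _ _) _; apply: lerD; apply: le_trans (ler_normD _ _) _.
  by rewrite !normrM.
by rewrite !normrM.
Qed.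

(** The midpoint is covered by [approximants_edge_interior], and [edge_cauchy] with [m] sent to
    infinity bounds the oscillation of [phi n - v] along the open edge by [A h n]. Continuity then
    includes the endpoints, where the rectangles of the interior estimate degenerate. *)
Lemma approximants_edge h : exists2 B : nat -> R, B n @[n --> \oo] --> 0 &
  forall n s, 0 <= s <= 1 -> `|phi n (edge_pt h s) - v (edge_pt h s)| <= B n.
Proof.
pose d n s := phi n (edge_pt h s) - v (edge_pt h s).
have half : 0 < (1 / 2 : R) < 1 by apply/andP; split; lra.
exists (fun n => `|d n (1 / 2)| + A h n).
  rewrite -[X in _ --> X](addr0 0); apply: cvgD => //.
  exact: approximants_edge_interior.
move=> n; apply: (@bound_closure (fun s => `|d n s|)).
  apply: within_continuous_norm => s; apply: cvgB.
    exact: (@edge_continuous _ h (phi n) (C1_cont (smooth_C1_on T (sphi n))) s).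
  exact: (@edge_continuous _ h v (@h2_cont _ v) s).
move=> s s01.
apply: (@le_of_cvg0 _ _ (fun m => A h m + (`|d m s| + `|d m (1 / 2)|))).
  rewrite -[X in _ --> X](addr0 0); apply: cvgD => //.
  rewrite -[X in _ --> X](addr0 0); apply: cvgD; exact: approximants_edge_interior.
move=> m.
have s01' : 0 <= s <= 1 by case/andP: s01 => /ltW -> /ltW ->.
have half' : 0 <= (1 / 2 : R) <= 1 by apply/andP; split; lra.
have := @edge_cauchy h n m _ _ s01' half'.
rewrite /d; move: (phi n (edge_pt h s)) (phi n (edge_pt h (1 / 2))) (phi m (edge_pt h s))
  (phi m (edge_pt h (1 / 2))) (v (edge_pt h s)) (v (edge_pt h (1 / 2))) => p1 p2 q1 q2 v1 v2.
(* The oscillation bounded by [edge_cauchy], two errors of [phi m] that vanish as [m] grows, and the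
   error of [phi n] at the midpoint. *)
have -> : p1 - v1 = ((p1 - q1) - (p2 - q2)) + (q1 - v1) - (q2 - v2) + (p2 - v2) by ring.
set w := p1 - q1 - (p2 - q2) => H.
have n1 := ler_normD (w + (q1 - v1) - (q2 - v2)) (p2 - v2).
have n2 := ler_normB (w + (q1 - v1)) (q2 - v2).
have n3 := ler_normD w (q1 - v1).
apply: le_trans n1 _; rewrite [leLHS]addrC -[leRHS]addrA lerD2l.
apply: le_trans n2 _; rewrite [leRHS]addrA [leRHS]addrA lerD2r.
by apply: le_trans n3 _; rewrite lerD2r.
Qed.

End EdgeConvergence.


End Traces.

(** * Green's formula and integration by parts for H^2 functions *)

Section Green.
Variable R : realType.
Local Notation mR := (measurableTypeR R).
Local Notation mR2 := (mR * mR)%type.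
Local Notation mu := (@lebesgue_measure R).
Local Notation T := (@tri_ref R).
Variable v : H2fun R.

Let mT := @measurable_tri_ref R.
Let mI : measurable (`[0, 1]%classic : set mR). Proof. exact: measurable_itv. Qed.

Lemma mul_tri_integrable (a b : R * R -> R) : (leb2 R).-integrable T (EFin \o a) ->
  {within T, continuous b} -> (leb2 R).-integrable T (EFin \o (fun p => a p * b p)).
Proof.
move=> ia cb; have bb : [bounded b x | x in T].
  by apply: within_continuous_bounded => //; exact: compact_tri_ref.
exact: (integrableMl mT ia (continuous_measurable_tri cb) bb).
Qed.

Lemma mul_edge_integrable (a b : R -> R) : mu.-integrable `[0, 1] (EFin \o a) ->
  {within `[0, 1], continuous b} -> mu.-integrable `[0, 1] (EFin \o (fun p => a p * b p)).
Proof.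
move=> ia cb; have bb : [bounded b x | x in `[0, 1]].
  by apply: within_continuous_bounded => //; exact: segment_compact.
have mb : measurable_fun (`[0, 1]%classic : set mR) (b : mR -> mR).
  by have /integrableP[/measurable_EFinP] := within_continuous_integrable_itv cb.
exact: (integrableMl mI ia mb bb).
Qed.

Lemma cvg_tri_mul (u_ : nat -> R * R -> R) (u c : R * R -> R) :
  (forall n, {within T, continuous (u_ n)}) -> (leb2 R).-integrable T (EFin \o u) ->
  {within T, continuous c} -> L1dist (u_ n) u @[n --> \oo] --> 0 ->
  \int[leb2 R]_(p in T) (u_ n p * c p) @[n --> \oo] --> \int[leb2 R]_(p in T) (u p * c p).
Proof.
move=> cu iu cc cv; apply: cvg_integral_mul => //.
- by move=> n; exact: within_continuous_integrable_tri.
- exact: continuous_measurable_tri.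
- by apply: within_continuous_bounded => //; exact: compact_tri_ref.
Qed.

Lemma cvg_edge_mul (u_ : nat -> R -> R) (u c : R -> R) :
  (forall n, {within `[0, 1], continuous (u_ n)}) -> mu.-integrable `[0, 1] (EFin \o u) ->
  {within `[0, 1], continuous c} ->
  \int[mu]_(s in `[0, 1]) `|u_ n s - u s| @[n --> \oo] --> 0 ->
  \int[mu]_(s in `[0, 1]) (u_ n s * c s) @[n --> \oo] --> \int[mu]_(s in `[0, 1]) (u s * c s).
Proof.
move=> cu iu cc cv; apply: cvg_integral_mul => //.
- by move=> n; exact: within_continuous_integrable_itv.
- by have /integrableP[/measurable_EFinP] := within_continuous_integrable_itv cc.
- by apply: within_continuous_bounded => //; exact: segment_compact.
Qed.

Lemma cvg_edge_val phi h : approximants v phi ->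
  \int[mu]_(s in `[0, 1]) `|phi n (edge_pt h s) - v (edge_pt h s)| @[n --> \oo] --> 0.
Proof.
move=> vphi; have [B B0 hB] := approximants_edge vphi h.
have c1 n : {within `[0, 1], continuous (fun s => phi n (edge_pt h s))}.
  exact: (@edge_continuous _ h (phi n) (C1_cont (smooth_C1_on T (appr_smooth vphi n)))).
have c2 : {within `[0, 1], continuous (fun s => v (edge_pt h s))}.
  exact: (@edge_continuous _ h v (@h2_cont _ v)).
apply: (@squeeze_cvgr _ _ _ _ (cst 0) _ _ _ _ _ B0); last exact: cvg_cst.
apply: nearW => n; rewrite /= Rintegral_ge0//=.
rewrite -[leRHS]mul1r -[in leRHS](subr0 1) -Rintegral_itv_cst//.
apply: le_Rintegral => //.
- apply: within_continuous_integrable_itv; apply: within_continuous_norm => s.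
  by apply: cvgB; [exact: c1|exact: c2].
- by apply: within_continuous_integrable_itv => ?; exact: cvg_cst.
- by move=> s /=; rewrite in_itv /=; exact: hB.
Qed.

Lemma edge_mul_continuous h (f : R * R -> R) (r : R) : {within T, continuous f} ->
  {within `[0, 1], continuous (fun s => f (edge_pt h s) * r)}.
Proof.
move=> cf s; apply: cvgM; last exact: cvg_cst.
exact: (@edge_continuous _ h f cf s).
Qed.

(** The limit of [green_smooth] for the products [phi n * f]; the boundary terms converge by
    [cvg_edge_val]. In [green_h2_grad] a derivative of [phi n] replaces [phi n], and its boundary
    terms converge by the choice of the trace. *)
Lemma green_h2_value f df i : C1_on T f df ->
  \int[leb2 R]_(p in T) (h2_grad v i p * f p + v p * df i p) =
  \sum_h \int[mu]_(s in `[0, 1]) (v (edge_pt h s) * (f (edge_pt h s) * coord i (conormal R h))).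
Proof.
move=> Cf; have [phi vphi] := h2_approximants v.
have S n := smooth_C1_on T (appr_smooth vphi n).
have cf := C1_cont Cf; have cdf : {within T, continuous (df i)} := @C1_dcont _ _ _ _ Cf i.
have cv : {within T, continuous v} := @h2_cont _ v.
have int2 (a b c d : R * R -> R) : (leb2 R).-integrable T (EFin \o a) -> {within T, continuous b} ->
    (leb2 R).-integrable T (EFin \o c) -> {within T, continuous d} ->
    \int[leb2 R]_(p in T) (a p * b p + c p * d p) =
    \int[leb2 R]_(p in T) (a p * b p) + \int[leb2 R]_(p in T) (c p * d p).
  move=> ia cb ic cd; apply: RintegralD => //.
  + exact: mul_tri_integrable.
  + exact: mul_tri_integrable.
have cdphi n : {within T, continuous 'D_(bvec R i) (phi n)} := @C1_dcont _ _ _ _ (S n) i.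
have L : \int[leb2 R]_(p in T) ('D_(bvec R i) (phi n) p * f p + phi n p * df i p) @[n --> \oo] -->
    \int[leb2 R]_(p in T) (h2_grad v i p * f p + v p * df i p).
  rewrite int2//; [|exact: h2_grad_integrable|exact: h2_integrable].
  have -> : (fun n => \int[leb2 R]_(p in T) ('D_(bvec R i) (phi n) p * f p + phi n p * df i p)) =
     (fun n => \int[leb2 R]_(p in T) ('D_(bvec R i) (phi n) p * f p) + \int[leb2 R]_(p in T) (phi n p * df i p)).
    apply/funext => n; rewrite int2//; first exact: within_continuous_integrable_tri.
    by apply: within_continuous_integrable_tri; exact: C1_cont (S n).
  apply: cvgD; apply: cvg_tri_mul => //.
  + exact: h2_grad_integrable.
  + exact: (appr_grad vphi).
  + by move=> n; exact: C1_cont (S n).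
  + exact: h2_integrable.
  + exact: (appr_val vphi).
have Rh h : \int[mu]_(s in `[0, 1]) (phi n (edge_pt h s) * (f (edge_pt h s) * coord i (conormal R h)))
    @[n --> \oo] -->
    \int[mu]_(s in `[0, 1]) (v (edge_pt h s) * (f (edge_pt h s) * coord i (conormal R h))).
  apply: cvg_edge_mul.
  + by move=> n; exact: (@edge_continuous _ h (phi n) (C1_cont (S n))).
  + exact: edge_integrable.
  + exact: edge_mul_continuous.
  + exact: cvg_edge_val.
have Rs : (\sum_h \int[mu]_(s in `[0, 1]) (phi n (edge_pt h s) * (f (edge_pt h s) * coord i (conormal R h))))
    @[n --> \oo] -->
    \sum_h \int[mu]_(s in `[0, 1]) (v (edge_pt h s) * (f (edge_pt h s) * coord i (conormal R h))).
  rewrite sum3; under eq_fun do rewrite sum3.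
  by apply: cvgD => //; exact: cvgD.
rewrite -(cvg_lim (@Rhausdorff R) L) -(cvg_lim (@Rhausdorff R) Rs).
congr (lim (_ @ \oo)); apply/funext => n; rewrite (green_smooth i (C1_onM (S n) Cf)).
by apply: eq_bigr => h _; apply: eq_Rintegral => s _; rewrite mulrA.
Qed.

Lemma green_h2_grad f df i j : C1_on T f df ->
  \int[leb2 R]_(p in T) (h2_hess v i j p * f p + h2_grad v i p * df j p) =
  \sum_h \int[mu]_(s in `[0, 1]) (h2_trace v h i s * (f (edge_pt h s) * coord j (conormal R h))).
Proof.
move=> Cf; have [phi vphi] := h2_approximants v.
have S n := smooth_C1_on T (smooth_D (bvec R i) (appr_smooth vphi n)).
have cf := C1_cont Cf; have cdf : {within T, continuous (df j)} := @C1_dcont _ _ _ _ Cf j.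
have cphi n : {within T, continuous 'D_(bvec R i) (phi n)} := C1_cont (S n).
have cdphi n : {within T, continuous 'D_(bvec R j) ('D_(bvec R i) (phi n))} :=
  @C1_dcont _ _ _ _ (S n) j.
have int2 (a b : R * R -> R) : (leb2 R).-integrable T (EFin \o a) ->
    (leb2 R).-integrable T (EFin \o b) ->
    \int[leb2 R]_(p in T) (a p * f p + b p * df j p) =
    \int[leb2 R]_(p in T) (a p * f p) + \int[leb2 R]_(p in T) (b p * df j p).
  by move=> ia ib; apply: RintegralD => //; exact: mul_tri_integrable.
have L : \int[leb2 R]_(p in T) ('D_(bvec R j) ('D_(bvec R i) (phi n)) p * f p + 'D_(bvec R i) (phi n) p * df j p)
    @[n --> \oo] --> \int[leb2 R]_(p in T) (h2_hess v i j p * f p + h2_grad v i p * df j p).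
  rewrite int2//; [|exact: h2_hess_integrable|exact: h2_grad_integrable].
  have -> : (fun n => \int[leb2 R]_(p in T) ('D_(bvec R j) ('D_(bvec R i) (phi n)) p * f p + 'D_(bvec R i) (phi n) p * df j p)) =
     (fun n => \int[leb2 R]_(p in T) ('D_(bvec R j) ('D_(bvec R i) (phi n)) p * f p) +
               \int[leb2 R]_(p in T) ('D_(bvec R i) (phi n) p * df j p)).
    by apply/funext => n; rewrite int2//; exact: within_continuous_integrable_tri.
  apply: cvgD; apply: cvg_tri_mul => //.
  + exact: h2_hess_integrable.
  + exact: (appr_hess vphi).
  + exact: h2_grad_integrable.
  + exact: (appr_grad vphi).
have Rh h : \int[mu]_(s in `[0, 1]) ('D_(bvec R i) (phi n) (edge_pt h s) * (f (edge_pt h s) * coord j (conormal R h)))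
    @[n --> \oo] -->
    \int[mu]_(s in `[0, 1]) (h2_trace v h i s * (f (edge_pt h s) * coord j (conormal R h))).
  apply: cvg_edge_mul.
  + by move=> n; exact: (@edge_continuous _ h _ (cphi n)).
  + exact: h2_trace_integrable.
  + exact: edge_mul_continuous.
  + exact: (appr_trace vphi).
have Rs : (\sum_h \int[mu]_(s in `[0, 1]) ('D_(bvec R i) (phi n) (edge_pt h s) * (f (edge_pt h s) * coord j (conormal R h))))
    @[n --> \oo] -->
    \sum_h \int[mu]_(s in `[0, 1]) (h2_trace v h i s * (f (edge_pt h s) * coord j (conormal R h))).
  rewrite sum3; under eq_fun do rewrite sum3.
  by apply: cvgD => //; exact: cvgD.
rewrite -(cvg_lim (@Rhausdorff R) L) -(cvg_lim (@Rhausdorff R) Rs).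
congr (lim (_ @ \oo)); apply/funext => n; rewrite (green_smooth j (C1_onM (S n) Cf)).
by apply: eq_bigr => h _; apply: eq_Rintegral => s _; rewrite mulrA.
Qed.

(** The endpoint values of [v] are limits of those of [phi n] because [approximants_edge] is uniform
    on the closed edge. *)
Lemma edge_by_parts (h : 'I_3) (f df : R -> R) :
  (forall s : R, 0 <= s <= 1 -> is_derive s 1 f (df s)) ->
  {within `[0, 1], continuous df} ->
  \int[mu]_(s in `[0, 1]) (trace_tangent v h s * f s + v (edge_pt h s) * df s) =
  v (edge_pt h 1) * f 1 - v (edge_pt h 0) * f 0.
Proof.
move=> Df cdf; have [phi vphi] := h2_approximants v.
have cf : {within `[0, 1], continuous f}.
  by apply: derivable_within_continuous => r; rewrite in_itv /= => /Df[].
have S n := smooth_C1_on T (appr_smooth vphi n).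
pose e i := coord i (edge_vec R h).
have cef i : {within `[0, 1], continuous (fun s => f s * e i)}.
  by move=> s; apply: cvgM; [exact: cf|exact: cvg_cst].
have cD n i : {within `[0, 1], continuous (fun s => 'D_(bvec R i) (phi n) (edge_pt h s))}.
  exact: (@edge_continuous _ h ('D_(bvec R i) (phi n)) (@C1_dcont _ _ _ _ (S n) i)).
have cphi n : {within `[0, 1], continuous (fun s => phi n (edge_pt h s))}.
  exact: (@edge_continuous _ h (phi n) (C1_cont (S n))).
have cv : {within `[0, 1], continuous (fun s => v (edge_pt h s))}.
  exact: (@edge_continuous _ h v (@h2_cont _ v)).
have iw := @within_continuous_integrable_itv R 0 1.
have int3 (a b c : R -> R) : mu.-integrable `[0, 1] (EFin \o a) -> mu.-integrable `[0, 1] (EFin \o b) ->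
    mu.-integrable `[0, 1] (EFin \o c) ->
    \int[mu]_(s in `[0, 1]) ((e 0 * a s + e 1 * b s) * f s + c s * df s) =
    \int[mu]_(s in `[0, 1]) (a s * (f s * e 0)) + \int[mu]_(s in `[0, 1]) (b s * (f s * e 1))
    + \int[mu]_(s in `[0, 1]) (c s * df s).
  move=> ia ib ic.
  have ia' := mul_edge_integrable ia (cef 0); have ib' := mul_edge_integrable ib (cef 1).
  have ic' := mul_edge_integrable ic cdf; have iab := integrableD mI ia' ib'.
  rewrite -(RintegralD mI ia' ib') -(RintegralD mI iab ic').
  by apply: eq_Rintegral => s _; rewrite mulrDl (mulrC (e 0)) (mulrC (e 1)) -!mulrA !(mulrC (e _)).
have L : \int[mu]_(s in `[0, 1]) ((e 0 * 'D_(bvec R 0) (phi n) (edge_pt h s) +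
     e 1 * 'D_(bvec R 1) (phi n) (edge_pt h s)) * f s + phi n (edge_pt h s) * df s) @[n --> \oo] -->
   \int[mu]_(s in `[0, 1]) (trace_tangent v h s * f s + v (edge_pt h s) * df s).
  have -> : \int[mu]_(s in `[0, 1]) (trace_tangent v h s * f s + v (edge_pt h s) * df s) =
     \int[mu]_(s in `[0, 1]) ((e 0 * h2_trace v h 0 s + e 1 * h2_trace v h 1 s) * f s + v (edge_pt h s) * df s).
    by apply: eq_Rintegral => s _; rewrite /trace_tangent sum2.
  rewrite int3; [|exact: h2_trace_integrable..|exact: iw].
  have -> : (fun n => \int[mu]_(s in `[0, 1]) ((e 0 * 'D_(bvec R 0) (phi n) (edge_pt h s) +
     e 1 * 'D_(bvec R 1) (phi n) (edge_pt h s)) * f s + phi n (edge_pt h s) * df s)) =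
   (fun n => \int[mu]_(s in `[0, 1]) ('D_(bvec R 0) (phi n) (edge_pt h s) * (f s * e 0)) +
     \int[mu]_(s in `[0, 1]) ('D_(bvec R 1) (phi n) (edge_pt h s) * (f s * e 1))
    + \int[mu]_(s in `[0, 1]) (phi n (edge_pt h s) * df s)).
    by apply/funext => n; rewrite int3//; exact: iw.
  apply: cvgD; first apply: cvgD.
  - by apply: cvg_edge_mul => //; [exact: h2_trace_integrable|exact: (appr_trace vphi)].
  - by apply: cvg_edge_mul => //; [exact: h2_trace_integrable|exact: (appr_trace vphi)].
  - by apply: cvg_edge_mul => //; [exact: iw|exact: cvg_edge_val].
have P (s : R) : 0 <= s <= 1 -> phi n (edge_pt h s) @[n --> \oo] --> v (edge_pt h s).
  move=> s01; apply/subr_cvg0; apply: norm_cvg0.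
  have [B B0 hB] := approximants_edge vphi h.
  apply: (@squeeze_cvgr _ _ _ _ (cst 0) _ _ _ _ _ B0); last exact: cvg_cst.
  by apply: nearW => n; rewrite normr_ge0 hB.
have Rs : phi n (edge_pt h 1) * f 1 - phi n (edge_pt h 0) * f 0 @[n --> \oo] -->
   v (edge_pt h 1) * f 1 - v (edge_pt h 0) * f 0.
  by apply: cvgB; apply: cvgM; try exact: cvg_cst; apply: P; rewrite ler01 lexx.
rewrite -(cvg_lim (@Rhausdorff R) L) -(cvg_lim (@Rhausdorff R) Rs).
congr (lim (_ @ \oo)); apply/funext => n.
have D (s : R) : 0 <= s <= 1 -> is_derive s 1 (fun r => phi n (edge_pt h r) * f r)
   ((e 0 * 'D_(bvec R 0) (phi n) (edge_pt h s) + e 1 * 'D_(bvec R 1) (phi n) (edge_pt h s)) * f s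
     + phi n (edge_pt h s) * df s).
  move=> s01; have := smooth_edge_derive h s (appr_smooth vphi n); rewrite sum2 => d1.
  have := is_deriveM d1 (Df s s01); move=> /is_derive_eq; apply.
  by rewrite [RHS]addrC; congr (_ + _); exact: mulrC.
rewrite /Rintegral (FTC2_closed ler01 D)//.
move=> s; apply: cvgD; apply: cvgM.
- apply: cvgD; (apply: cvgM; first exact: cvg_cst).
  + exact: (cD n 0 s).
  + exact: (cD n 1 s).
- exact: cf.
- exact: cphi.
- exact: cdf.
Qed.

End Green.

(** * Symmetry and positivity of the jets of the metric on one triangle *)

Section OneTriangle.
Variable R : realType.
Local Notation W := (R * (R * R))%type.
Local Notation T := (@tri_ref R).

Lemma derive_space (f : W -> R) t p w d : is_derive (t, p) (0, w) f d ->
  is_derive p w (fun q => f (t, q)) d.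
Proof.
have E (r : R) : r *: ((0, w) : W) + (t, p) = (t, r *: w + p).
  by congr (_, _); rewrite /= scaler0 add0r.
move=> H; have {H}H : is_derive (0 *: ((0, w) : W) + (t, p)) (0, w) f d.
  by rewrite scale0r add0r.
have := is_derive_line H.
have -> : (fun r => f (r *: ((0, w) : W) + (t, p))) = (fun r => (fun q => f (t, q)) (r *: w + p)).
  by apply/funext => r; rewrite E.
by move=> /(@line_derive _ _ (fun q => f (t, q))); rewrite scale0r add0r.
Qed.

Lemma derive_time (f : W -> R) t p d : is_derive (t, p) (dirT R) f d ->
  is_derive t 1 (fun s => f (s, p)) d.
Proof.
have E (r : R) : r *: dirT R + (0, p) = (r, p).
  by congr (_, _); rewrite /= ?scaler0 ?add0r ?addr0//; exact: mulr1.
rewrite -(E t) => /is_derive_line.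
by rewrite (_ : (fun r => _) = (fun s => f (s, p)))//; apply/funext => r; rewrite E.
Qed.

Definition ob (b : bool) : 'I_2 := if b then 1 else 0.

Lemma sumb (V : nmodType) (F : 'I_2 -> V) : \sum_i F i = F (ob false) + F (ob true).
Proof. exact: sum2. Qed.

Lemma obP (i : 'I_2) : exists b, i = ob b.
Proof. by case: i => [[|[|//]]] ?; [exists false|exists true]; exact: val_inj. Qed.

Lemma det_mx2 (A : 'M[R]_2) : \det A = A 0 0 * A 1 1 - A 0 1 * A 1 0.
Proof.
rewrite (expand_det_row _ 0) sum2 /cofactor !det_mx11 !mxE /=.
by congr (_ * _ + _); rewrite ?expr0 ?expr1 ?mul1r ?mulN1r ?mulrN; do ?congr (- _); do ?congr (_ * _);
  congr (A _ _); exact: val_inj.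
Qed.

Lemma invmx2 (A : 'M[R]_2) k l : \det A != 0 ->
  invmx A (ob k) (ob l) =
  (if k == l then A (ob (~~ k)) (ob (~~ l)) else - A (ob k) (ob l)) / \det A.
Proof.
move=> dA; have uA : A \in unitmx by rewrite unitmxE unitfE.
have obK b : (ob b != 0) = b by case: b.
pose B : 'M[R]_2 := \matrix_(i, j) (let k := (i != 0) in let l := (j != 0) in
  (if k == l then A (ob (~~ k)) (ob (~~ l)) else - A (ob k) (ob l)) / \det A).
have AB : A *m B = 1%:M.
  apply/matrixP => i j; have [bi ->] := obP i; have [bj ->] := obP j.
  rewrite !mxE sumb !mxE /= !obK; move: dA; rewrite det_mx2.
  by case: bi; case: bj => /= dA; rewrite ?eqxx /ob /=; field.
have -> : invmx A = B by rewrite -[invmx A]mulmx1 -AB mulmxA mulVmx// mul1mx.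
by rewrite mxE /= !obK.
Qed.

Section Family.
Variables (a b : R) (g : R -> metric R) (U : set W).
Hypothesis oU : open U.
Hypothesis TU : forall t p, a < t < b -> T p -> U (t, p).
Hypothesis sg : forall i j, smooth U (fun z => g z.1 z.2 i j).
Hypothesis rg : forall t, a < t < b -> riemannian (g t).

Definition comp (i j : bool) (z : W) : R := g z.1 z.2 (ob i) (ob j).

Let sc i j : smooth U (comp i j). Proof. exact: sg. Qed.

Local Notation jets_of := (jets_at comp).
Local Notation ev := (evalf comp).

(** At a boundary point of the triangle a derivative involves the extension outside, on which
    nothing is assumed. Still, the derivatives agree at interior points, and continuity extends this
    to the closed triangle. *)
Lemma eq_on_tri_derive (f1 f2 : W -> R) w : smooth U f1 -> smooth U f2 ->
  (forall t p, a < t < b -> T p -> f1 (t, p) = f2 (t, p)) ->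
  forall t p, a < t < b -> T p -> 'D_w f1 (t, p) = 'D_w f2 (t, p).
Proof.
move=> s1 s2 f12 t p tab Tp; have Uz := TU tab Tp.
pose V : set W := [set z | a < z.1 < b /\ [/\ 0 < z.2.1, 0 < z.2.2 & z.2.1 + z.2.2 < 1]].
have oV : open V.
  have -> : V = [set z : W | a < z.1] `&` [set z | z.1 < b] `&` [set z | 0 < z.2.1]
     `&` [set z | 0 < z.2.2] `&` [set z | z.2.1 + z.2.2 < 1].
    apply/seteqP; split=> z /=; first by case=> /andP[? ?] [].
    by case=> [[[[az zb] ?] ?] ?]; split; [apply/andP|].
  have c1 : continuous (fun z : W => z.1) by move=> z; exact: cvg_fst.
  have c21 : continuous (fun z : W => z.2.1).
    by move=> z; apply: (@continuous_comp _ _ _ (fun z : W => z.2) fst); [exact: cvg_snd|exact: cvg_fst].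
  have c22 : continuous (fun z : W => z.2.2).
    by move=> z; apply: (@continuous_comp _ _ _ (fun z : W => z.2) snd); [exact: cvg_snd|exact: cvg_snd].
  apply: openI; [apply: openI; [apply: openI; [apply: openI|]|]|].
  - by apply: (@open_comp _ _ (fun z : W => z.1) [set x | a < x]) => [z _|]; [exact: c1|exact: open_gt].
  - by apply: (@open_comp _ _ (fun z : W => z.1) [set x | x < b]) => [z _|]; [exact: c1|exact: open_lt].
  - by apply: (@open_comp _ _ (fun z : W => z.2.1) [set x | 0 < x]) => [z _|]; [exact: c21|exact: open_gt].
  - by apply: (@open_comp _ _ (fun z : W => z.2.2) [set x | 0 < x]) => [z _|]; [exact: c22|exact: open_gt].
  - apply: (@open_comp _ _ (fun z : W => z.2.1 + z.2.2) [set x | x < 1]) => [z _|]; last exact: open_lt.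
    by apply: cvgD; [exact: c21|exact: c22].
have VE z : V z -> 'D_w f1 z = 'D_w f2 z.
  move=> Vz; apply: (eq_on_derive oV) => // -[s q] /set_mem [/= sab [q1 q2 q12]].
  by apply: f12 => //; split; exact: ltW.
pose F z := 'D_w f1 z - 'D_w f2 z.
have cF : {for (t, p), continuous F}.
  apply: cvgB; first exact: (@smooth_cont _ _ U ('D_w f1) _ (smooth_D w s1) Uz).
  exact: (@smooth_cont _ _ U ('D_w f2) _ (smooth_D w s2) Uz).
apply/eqP; rewrite -subr_eq0 -normr_le0; apply/ler_addgt0Pr => e e0; rewrite add0r.
have /cvgrPdist_le /(_ _ e0) nF := cF.
(* An interior point: moving from [p] towards it by a positive fraction [r] of at most 1/2 enters
   the interior. *)
pose c : R * R := (1 / 4, 1 / 4).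
have [d d0 hd] := near_plane (0, c - p) 0 nF.
pose r := Num.min d (1 / 2).
have r0 : 0 < r by rewrite lt_min d0 divr_gt0.
have r1 : r <= 1 / 2 by rewrite ge_min lexx orbT.
have rd : `|r| <= d by rewrite (ger0_norm (ltW r0)) /r ge_min lexx.
have d0' : `|0 : R| <= d by rewrite normr0 ltW.
have := hd r 0 rd d0'; rewrite scaler0 add0r.
have Vr : V (r *: ((0, c - p) : W) + (t, p)).
  case: p Tp {Uz cF nF hd} => x y [/= x0 y0 xy]; split => /=; first by cbn; rewrite mulr0 add0r.
  clearbody r; split; cbn; nra.
by rewrite [F (r *: _ + _)](_ : _ = 0) ?subr0//; rewrite /F VE// subrr.
Qed.

Lemma eq_on_tri_iter (f1 f2 : W -> R) w n : smooth U f1 -> smooth U f2 ->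
  (forall t p, a < t < b -> T p -> f1 (t, p) = f2 (t, p)) ->
  forall t p, a < t < b -> T p ->
  iter n (fun h => 'D_w h) f1 (t, p) = iter n (fun h => 'D_w h) f2 (t, p).
Proof.
move=> s1 s2 f12; elim: n => // n IH /= s q sab Tq.
by apply: eq_on_tri_derive => //; exact: smooth_iter.
Qed.

(** The metric is symmetric on the triangle only; [eq_on_tri_iter] passes this on to all its
    derivatives, up to the boundary. *)
Lemma jets_of_symmetric t p : a < t < b -> T p -> symmetric_jets (jets_of (t, p)).
Proof.
move=> tab Tp n1 n2 n3; rewrite /jets_at /jet.
have sy i j n := smooth_iter (dirY R) n (sc i j).
have sx i j n m := smooth_iter (dirX R) m (sy i j n).
apply: (eq_on_tri_iter _ _ (sx true false n3 n2) (sx false true n3 n2)) => // {tab Tp}t {}p tab Tp.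
apply: (eq_on_tri_iter _ _ (sy true false n3) (sy false true n3)) => // {tab Tp}t {}p tab Tp.
apply: (eq_on_tri_iter _ _ (sc true false) (sc false true)) => // {tab Tp}t {}p tab Tp.
have [gT _] := rg tab Tp.
by rewrite /comp /= -[in LHS]gT mxE.
Qed.

Lemma jets_of_nondegenerate t p : a < t < b -> T p -> nondegenerate (jets_of (t, p)).
Proof.
move=> tab Tp; have sJ := jets_of_symmetric tab Tp; have [_ pos] := rg tab Tp.
have bilE_ u w : bil (g t p) u w = comp false false (t, p) * u.1 * w.1 +
   comp false true (t, p) * u.1 * w.2 + (comp true false (t, p) * u.2 * w.1 + comp true true (t, p) * u.2 * w.2).
  by rewrite /bil !sumb.
have E0 : 0 < comp false false (t, p).
  have /pos : ((1, 0) : R * R) != 0 by apply/eqP => -[/eqP]; rewrite oner_eq0.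
  by rewrite bilE_ /= !mulr1 !mulr0 !addr0.
have sy : comp true false (t, p) = comp false true (t, p) := sJ 0%N 0%N 0%N.
split => //=; rewrite /jets_at /jet /=.
(* At the vector (- F, E) the quadratic form takes the value E (E G - F^2). *)
have /pos : ((- comp false true (t, p), comp false false (t, p)) : R * R) != 0.
  by apply/eqP => -[_ /eqP]; rewrite gt_eqF.
rewrite bilE_ sy /=; move: E0; move: (comp false false _) (comp false true _) (comp true true _) => E F G E0.
rewrite (_ : _ + _ = E * (E * G - F * F)); last by ring.
by rewrite pmulr_rgt0.
Qed.

End Family.
End OneTriangle.

(** * The expressions are defined at nondegenerate jets *)

Section Defined.
Variables (R : realType) (J : jets R).

Lemma defined_chrE k i j : evalE J (detE R) != 0 -> defined J (chrE R k i j).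
Proof. by move=> d0; case: k; case: i; case: j; rewrite /= pnatr_eq0; do !split. Qed.

Lemma defined_riemE l k i j : evalE J (detE R) != 0 -> defined J (riemE R l k i j).
Proof.
move=> d0; have c k' i' j' := defined_chrE k' i' j' d0.
by rewrite /riemE; repeat first [exact: c|exact: (@defined_ederiv _ _ _ _ (c _ _ _))|split].
Qed.

Hypothesis nJ : nondegenerate J.
Let det0 : 0 < evalE J (detE R). Proof. by case: nJ. Qed.
Let detN0 : evalE J (detE R) != 0. Proof. by rewrite gt_eqF. Qed.

Lemma volE_neq0 : evalE J (volE R) != 0.
Proof. by rewrite /= gt_eqF// sqrtr_gt0. Qed.

Lemma defined_volE : defined J (volE R).
Proof. by do !split. Qed.

Lemma defined_kapvolE : defined J (kapvolE R).
Proof.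
have r l k i j := @defined_riemE l k i j detN0; have := defined_volE.
by rewrite /kapvolE /sumE => dv; repeat first [exact: r|exact: dv|exact: detN0|split].
Qed.

Lemma defined_momE i j : defined J (momE R i j).
Proof.
have := defined_volE; have := volE_neq0.
by rewrite /momE; case: i; case: j => ? ?; do !split.
Qed.

Lemma defined_divE k : defined J (divE R k).
Proof.
have m i j := defined_momE i j; have c k' i' j' := defined_chrE k' i' j' detN0.
by rewrite /divE /sumE; repeat first [exact: m|exact: c|exact: (@defined_ederiv _ _ _ _ (m _ _))|split].
Qed.

Lemma defined_bilE F u w : (forall i j, defined J (F i j)) -> (forall i, defined J (u i)) ->
  (forall i, defined J (w i)) -> defined J (bilE F u w).
Proof. by move=> *; rewrite /bilE /sumE; do !split. Qed.

Variable e : R * R.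
Hypothesis e0 : e != 0.

Lemma normE_neq0 : evalE J (normE e) != 0.
Proof. by rewrite gt_eqF// normE_gt0. Qed.

Lemma defined_normE : defined J (normE e).
Proof. exact: defined_bilE. Qed.

Lemma defined_geodE : defined J (geodE e).
Proof.
have c k' i' j' := defined_chrE k' i' j' detN0.
have b k : defined J (bilE (chrE R k) (vecE e) (vecE e)) by exact: defined_bilE.
have := normE_neq0; have := defined_normE; have := defined_volE.
by rewrite /geodE => dv dn n0; repeat first [exact: b|exact: dv|exact: dn|exact: n0|split].
Qed.

Lemma defined_shearE : defined J (shearE e).
Proof.
have b : defined J (bilE (@sigE R) (cornE e) (vecE e)).
  by apply: defined_bilE => // -[]; do !split.
have := normE_neq0; have := defined_normE; have := defined_volE; have := volE_neq0.
rewrite /shearE => v0 dv dn n0; split; first exact: b.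
by split; [exact: mulf_neq0|split].
Qed.

End Defined.

Local Arguments jets_at : simpl never.

(** * Agreement of the geometric definitions with the expressions *)

Section Links.
Variable R : realType.
Local Notation W := (R * (R * R))%type.
Local Notation T := (@tri_ref R).
Variables (a b : R) (g : R -> metric R) (U : set W).
Hypothesis oU : open U.
Hypothesis TU : forall t p, a < t < b -> T p -> U (t, p).
Hypothesis sg : forall i j, smooth U (fun z => g z.1 z.2 i j).
Hypothesis rg : forall t, a < t < b -> riemannian (g t).

Let sc i j : smooth U (comp g i j). Proof. exact: sg. Qed.
Local Notation J := (jets_at (comp g)).
Local Notation ev := (evalf (comp g)).

Let nd t p (tab : a < t < b) (Tp : T p) : nondegenerate (J (t, p)) :=
  jets_of_nondegenerate TU sg rg tab Tp.

Lemma evalf_space t p i e : U (t, p) -> defined (J (t, p)) e ->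
  is_derive p (bvec R (ob i)) (fun q => ev e (t, q)) (ev (ederiv (sp i) e) (t, p)).
Proof.
move=> Uz de; apply: derive_space.
have := @is_derive_evalf R U oU (comp g) sc e _ (0, bvec R (ob i)) Uz de.
move=> /is_derive_eq; apply.
by case: i; rewrite /bvec /= !mul0r !add0r ?mul1r ?addr0.
Qed.

Lemma evalf_time t p e : U (t, p) -> defined (J (t, p)) e ->
  is_derive t 1 (fun s => ev e (s, p)) (ev (ederiv DT e) (t, p)).
Proof.
move=> Uz de; apply: derive_time.
have := @is_derive_evalf R U oU (comp g) sc e _ (dirT R) Uz de.
move=> /is_derive_eq; apply.
by rewrite /= !mul0r !addr0 mul1r.
Qed.

Lemma det_ev t p : \det (g t p) = ev (detE R) (t, p).
Proof. by rewrite det_mx2. Qed.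

Lemma vol_ev t p : vol (g t) p = ev (volE R) (t, p).
Proof. by rewrite /vol det_ev. Qed.

Lemma invmx_ev t p k l : ev (detE R) (t, p) != 0 ->
  invmx (g t p) (ob k) (ob l) = ev (invE R k l) (t, p).
Proof.
move=> d0; rewrite invmx2 ?det_ev// /evalf /invE /=; congr (_ / _).
by case: eqP.
Qed.

Lemma christoffel_ev t p k i j : U (t, p) -> ev (detE R) (t, p) != 0 ->
  christoffel (g t) (ob k) (ob i) (ob j) p = ev (chrE R k i j) (t, p).
Proof.
move=> Uz d0; have I k1 k2 := invmx_ev k1 k2 d0.
rewrite /christoffel sumb !I.
have D i' j' l' : 'D_(bvec R (ob i')) (fun q => g t q (ob j') (ob l')) p =
   ev (ederiv (sp i') (metE R j' l')) (t, p).
  by have [|_ <-] := @evalf_space t p i' (metE R j' l') Uz.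
by rewrite !D /evalf /chrE /sumE /=.
Qed.

(** Differentiating Christoffel symbols at a boundary point needs their formula on a full
    neighbourhood, which leaves the triangle; a nonzero determinant is the open condition that makes
    it valid there. *)
Lemma near_det t p : U (t, p) -> ev (detE R) (t, p) != 0 ->
  \forall q \near p, U (t, q) /\ ev (detE R) (t, q) != 0.
Proof.
move=> Uz d0.
have cd : {for (t, p), continuous (ev (detE R))}.
  by apply: derivable_continuous_evalf => //; do !split.
have n1 : \forall z \near (t, p), U z /\ ev (detE R) z != 0.
  apply: filterI; first exact: open_nbhs_nbhs (conj oU Uz).
  exact: (cd _ (open_nbhs_nbhs (conj (@open_neq R 0) d0))).
exact: (@continuous_pairl R (R * R)%type t p _ n1).
Qed.

Lemma riem_ev t p l k i j : U (t, p) -> ev (detE R) (t, p) != 0 ->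
  riem (g t) (ob l) (ob k) (ob i) (ob j) p = ev (riemE R l k i j) (t, p).
Proof.
move=> Uz d0; rewrite /riem !sumb.
have D x l' i' j' : 'D_(bvec R (ob x)) (christoffel (g t) (ob l') (ob i') (ob j')) p =
  ev (ederiv (sp x) (chrE R l' i' j')) (t, p).
  have [|_ <-] := @evalf_space t p x (chrE R l' i' j') Uz; first exact: defined_chrE.
  apply: near_eq_derive; apply: filterS (near_det Uz d0) => q [Uq dq].
  exact: christoffel_ev.
rewrite !D !christoffel_ev//.
Qed.

Lemma sum_bvec (x : 'I_2 -> R) : \sum_k x k *: bvec R k = (x 0, x 1).
Proof.
rewrite sum2 (_ : bvec R 0 = (1, 0))// (_ : bvec R 1 = (0, 1))//.
by congr (_, _); cbn; ring.
Qed.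

Lemma bil_ev t p u w : bil (g t p) u w = ev (bilE (@metE R) (vecE u) (vecE w)) (t, p).
Proof. by rewrite /bil !sumb. Qed.

Section AtPoint.
Variables (t : R) (p : R * R).
Hypotheses (tab : a < t < b) (Tp : T p).
Let nJ := nd tab Tp.
Let Uz := TU tab Tp.
Let det0 : 0 < ev (detE R) (t, p). Proof. by case: nJ. Qed.
Let detN0 : ev (detE R) (t, p) != 0. Proof. by rewrite gt_eqF. Qed.

Lemma curvature_ev : gauss_curv (g t) p * vol (g t) p = ev (kapvolE R) (t, p).
Proof.
rewrite vol_ev /gauss_curv det_ev sumb.
by rewrite (riem_ev false true false true Uz detN0) (riem_ev true true false true Uz detN0).
Qed.

Lemma time_deriv_ev i j :
  derive1 (fun s => g s p (ob i) (ob j)) t = ev (sigE R i j) (t, p).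
Proof. by rewrite derive1E; have [|_ <-] := @evalf_time t p (metE R i j) Uz. Qed.


(** The contraction with two inverse metrics collapses to [momE] by the cofactor form of [S] in
    dimension two. *)
Lemma stress_ev (H : 'M[R]_2) :
  inner2 (g t) p (S_op (g t) p (\matrix_(i, j) derive1 (fun s => g s p i j) t)) H * vol (g t) p =
  ev (momE R false false) (t, p) * H (ob false) (ob false)
  + ev (momE R false true) (t, p) * H (ob false) (ob true)
  + (ev (momE R true false) (t, p) * H (ob true) (ob false)
     + ev (momE R true true) (t, p) * H (ob true) (ob true)).
Proof.
have gE i j : g t p (ob i) (ob j) = ev (metE R i j) (t, p) by [].
rewrite /inner2 /S_op /tr_g vol_ev !sumb !invmx_ev// !mxE !gE !time_deriv_ev.
have [v [v0 vE dE GE]] := jets_param nJ; have [sJ E0 _] := nJ.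
rewrite /evalf /= !sJ vE dE GE.
move: (H _ _) (H _ _) (H _ _) (H _ _) => H00 H01 H10 H11.
field.
by rewrite !gt_eqF.
Qed.

Definition len_at (h : 'I_3) : R := Num.sqrt (bil (g t p) (edge_vec R h) (edge_vec R h)).

Variable h : 'I_3.
Local Notation e := (edge_vec R h).

Lemma edge_vec_neq0 : e != 0.
Proof.
elim/I3_ind: h; rewrite edge_vecE; apply/eqP => -[] /eqP; rewrite ?oner_eq0 ?oppr_eq0 ?oner_eq0//.
Qed.

Let norm0 : 0 < ev (normE e) (t, p). Proof. by apply: normE_gt0; [exact: nJ|exact: edge_vec_neq0]. Qed.

Lemma raise_conormal : raise (g t p) (conormal R h) =
  (ev (cornE e false / detE R)%J (t, p), ev (cornE e true / detE R)%J (t, p)).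
Proof.
rewrite /raise sum_bvec !sumb /conormal -[0]/(ob false) -[1]/(ob true) !invmx_ev//.
have sJ := nondeg_sym nJ.
rewrite /evalf /= !sJ; move: detN0; rewrite /evalf /= !sJ.
by case: (e) => x y /= d0; rewrite !coord0 !coord1; congr (_, _) => /=; field.
Qed.

(** The raised conormal has squared length [normE / detE], so the factor [len_at h] removes the root
    of [normE] and leaves only the volume. *)
Lemma nor_ev k : coord (ob k) (nor (g t) h p) * len_at h =
  ev (volE R * (cornE e k / detE R))%J (t, p).
Proof.
rewrite /nor /normalize raise_conormal /len_at !bil_ev.
have sJ := nondeg_sym nJ.
set c0 := ev (cornE e false / detE R)%J (t, p); set c1 := ev (cornE e true / detE R)%J (t, p).
have -> : ev (bilE (@metE R) (vecE (c0, c1)) (vecE (c0, c1))) (t, p) =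
    ev (normE e) (t, p) / ev (detE R) (t, p).
  rewrite /c0 /c1 /evalf /= !sJ; move: detN0; rewrite /evalf /= !sJ.
  by case: (e) => x y /= d0; field.
have -> : ev (bilE (@metE R) (vecE e) (vecE e)) (t, p) = ev (normE e) (t, p) by [].
rewrite sqrtrM ?(ltW norm0)// sqrtrV ?(ltW det0)//.
have -> : coord (ob k) ((Num.sqrt (ev (normE e) (t, p)) / Num.sqrt (ev (detE R) (t, p)))^-1 *: (c0, c1)) =
  (Num.sqrt (ev (normE e) (t, p)) / Num.sqrt (ev (detE R) (t, p)))^-1 * (if k then c1 else c0).
  by case: k.
have -> : ev (volE R * (cornE e k / detE R))%J (t, p) =
  Num.sqrt (ev (detE R) (t, p)) * (if k then c1 else c0) by rewrite /c0 /c1; case: k.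
have s1 : Num.sqrt (ev (normE e) (t, p)) != 0 by rewrite gt_eqF// sqrtr_gt0.
have s2 : Num.sqrt (ev (detE R) (t, p)) != 0 by rewrite gt_eqF// sqrtr_gt0.
move: (if k then c1 else c0) s1 s2; move: (Num.sqrt _) (Num.sqrt _) => x y w x0 y0.
by field; rewrite x0 y0.
Qed.

Lemma tau_ev (A : 'M[R]_2) : bil A (tau (g t) h p) (tau (g t) h p) =
  bil A e e / ev (normE e) (t, p).
Proof.
rewrite /tau /normalize.
have -> : bil A ((Num.sqrt (bil (g t p) e e))^-1 *: e) ((Num.sqrt (bil (g t p) e e))^-1 *: e) =
   (Num.sqrt (bil (g t p) e e))^-1 ^+ 2 * bil A e e.
  by rewrite /bil !sumb /coord /=; cbn; ring.
by rewrite exprVn sqr_sqrtr bil_ev ?(ltW norm0)// mulrC.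
Qed.

(** The unit tangent is a function times a constant vector, so its componentwise derivative is a
    multiple [d] of the edge vector, which is orthogonal to the normal. Only the Christoffel term
    contributes. *)
Lemma geod_curv_ev : geod_curv (g t) h p * len_at h = ev (geodE e) (t, p).
Proof.
pose ell := Num.sqrt (ev (normE e) (t, p)).
have ell0 : 0 < ell by rewrite sqrtr_gt0.
have ellE : ell ^+ 2 = ev (normE e) (t, p) by rewrite sqr_sqrtr// ltW.
have tauE q k : coord (ob k) (tau (g t) h q) = ev (EInv (ESqrt (normE e)) * vecE e k)%J (t, q).
  by rewrite /tau /normalize bil_ev; case: k.
have [d dE] : exists d, forall k,
    'D_(tau (g t) h p) (fun q => coord (ob k) (tau (g t) h q)) p = d * evalE (J (t, p)) (vecE e k).
  pose w : W := (0, tau (g t) h p).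
  have dn : defined (J (t, p)) (EInv (ESqrt (normE e))).
    split; first by rewrite /= -/ell gt_eqF.
    by split => //; exact: defined_normE.
  set A := EInv (ESqrt (normE e)) in tauE dn.
  exists ((tau (g t) h p).1 * ev (ederiv DX A) (t, p) + (tau (g t) h p).2 * ev (ederiv DY A) (t, p)).
  move=> k.
  have -> : (fun q => coord (ob k) (tau (g t) h q)) = (fun q => ev (A * vecE e k)%J (t, q)).
    exact/funext.
  have dAk : defined (J (t, p)) (A * vecE e k)%J by split.
  have [_ ->] := derive_space (@is_derive_evalf R U oU (comp g) sc (A * vecE e k)%J _ w Uz dAk).
  clear tauE dAk dn; clearbody A.
  have EM x : ev (ederiv x (A * vecE e k)%J) (t, p) = ev (ederiv x A) (t, p) * evalE (J (t, p)) (vecE e k).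
    by rewrite /evalf /= mulr0 addr0.
  rewrite !EM; move: (evalE _ (vecE e k)) => z; rewrite /w /= mul0r add0r.
  by rewrite mulrDl !mulrA.
rewrite /geod_curv /nabla_tau_tau sum_bvec !sumb -[0]/(ob false) -[1]/(ob true) !christoffel_ev// !dE !tauE.
set nn := nor (g t) h p.
have nE k : coord (ob k) nn = ev (volE R * (cornE e k / detE R))%J (t, p) / ell.
  by rewrite -nor_ev /len_at bil_ev mulfK// gt_eqF.
rewrite /bil !sumb !nE /len_at bil_ev -/ell {nE dE tauE nn}.
have t0 : ev (EInv (ESqrt (normE e)) * vecE e false)%J (t, p) = ell^-1 * e.1 by [].
have t1 : ev (EInv (ESqrt (normE e)) * vecE e true)%J (t, p) = ell^-1 * e.2 by [].
rewrite !t0 !t1 {t0 t1} !coord0 !coord1.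
have gE i j : g t p (ob i) (ob j) = ev (metE R i j) (t, p) by [].
have -> : ev (geodE e) (t, p) = ev (volE R) (t, p) / ell ^+ 2 *
   (e.1 * (ev (chrE R true false false) (t, p) * e.1 * e.1 + ev (chrE R true false true) (t, p) * e.1 * e.2
     + (ev (chrE R true true false) (t, p) * e.2 * e.1 + ev (chrE R true true true) (t, p) * e.2 * e.2))
   - e.2 * (ev (chrE R false false false) (t, p) * e.1 * e.1 + ev (chrE R false false true) (t, p) * e.1 * e.2
     + (ev (chrE R false true false) (t, p) * e.2 * e.1 + ev (chrE R false true true) (t, p) * e.2 * e.2))).
  by rewrite ellE.
move: (ev (chrE R true false false) _) (ev (chrE R true false true) _) (ev (chrE R true true false) _)
 (ev (chrE R true true true) _) (ev (chrE R false false false) _) (ev (chrE R false false true) _)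
 (ev (chrE R false true false) _) (ev (chrE R false true true) _) => c100 c101 c110 c111 c000 c001 c010 c011.
have cE k : ev (volE R * (cornE e k / detE R))%J (t, p) = ev (volE R) (t, p) *
  (evalE (J (t, p)) (cornE e k) / ev (detE R) (t, p)) by [].
rewrite !cE !gE {cE gE ellE}; move: (ev (volE R) _) => v.
have sJ := nondeg_sym nJ.
move: detN0 ell0; rewrite /evalf /= !sJ; clearbody ell.
case: (e) => x y /= d0 /lt0r_neq0 l0.
field.
by rewrite l0.
Qed.

End AtPoint.
End Links.

(** * Time derivative of an angle *)

Section Angle.
Variable R : realType.
Local Notation W := (R * (R * R))%type.
Local Notation T := (@tri_ref R).
Variables (a b : R) (g : R -> metric R) (U : set W).
Hypothesis oU : open U.
Hypothesis TU : forall t p, a < t < b -> T p -> U (t, p).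
Hypothesis sg : forall i j, smooth U (fun z => g z.1 z.2 i j).
Hypothesis rg : forall t, a < t < b -> riemannian (g t).
Local Notation J := (jets_at (comp g)).
Local Notation ev := (evalf (comp g)).

Definition prev_vec (i : 'I_3) : R * R := corner R (ordS (ordS i)) - corner R i.

Lemma prev_vecE i : prev_vec i = - edge_vec R (ordS (ordS i)).
Proof.
by rewrite /prev_vec /edge_vec opprB; congr (_ - corner R _); elim/I3_ind: i; exact: val_inj.
Qed.

Lemma cross_corner (i : 'I_3) :
  (edge_vec R i).1 * (prev_vec i).2 - (edge_vec R i).2 * (prev_vec i).1 = 1.
Proof.
by rewrite prev_vecE; elim/I3_ind: i; rewrite /edge_vec /corner /=; cbn; ring.
Qed.

Lemma shearE_opp J0 (u : R * R) : evalE J0 (shearE (- u)) = evalE J0 (shearE u).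
Proof.
by case: u => x y /=; congr (_ / (_ * _)); ring.
Qed.

Lemma tri_corner i : T (corner R i).
Proof. by elim/I3_ind: i; rewrite /corner /tri_ref /=; split; rewrite ?addr0 ?add0r. Qed.

(** The arc cosine is differentiated through [cosE_time]. Its sine comes from Lagrange's identity
    |u|^2 |w|^2 - g(u, w)^2 = det g, valid since the cross product of [u] and [w] is 1 at every
    corner. The vector [w] is the preceding edge reversed, and sigma(n, tau) does not change when an
    edge is reversed. *)
Lemma angle_time t i : a < t < b ->
  is_derive t 1 (fun s => angle (g s) i)
    (2^-1 * (ev (shearE (edge_vec R i)) (t, corner R i)
             - ev (shearE (edge_vec R (ordS (ordS i)))) (t, corner R i))).
Proof.
move=> tab; have Tp := tri_corner i; set p := corner R i in Tp *.
have nJ := jets_of_nondegenerate TU sg rg tab Tp.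
set u := edge_vec R i; set w := prev_vec i.
have uw : u.1 * w.2 - u.2 * w.1 = 1 by exact: cross_corner.
have u0 : u != 0 by exact: edge_vec_neq0.
have w0 : w != 0.
  by apply: contra_eq_neq uw => ->; rewrite /= !mulr0 subr0 eq_sym oner_neq0.
pose B := bilE (@metE R) (vecE u) (vecE w).
pose C := (B / (ESqrt (normE u) * ESqrt (normE w)))%J.
have -> : (fun s => angle (g s) i) = (fun s => acos (ev C (s, p))).
  by apply/funext => s; rewrite /angle !bil_ev.
have qu := normE_gt0 nJ u0; have qw := normE_gt0 nJ w0.
have su : 0 < Num.sqrt (evalE (J (t, p)) (normE u)) by rewrite sqrtr_gt0.
have sw : 0 < Num.sqrt (evalE (J (t, p)) (normE w)) by rewrite sqrtr_gt0.
have dC : defined (J (t, p)) C.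
  split; first exact: defined_bilE.
  split; first by rewrite /= mulf_neq0// gt_eqF.
  by split; split => //; exact: defined_normE.
have det0 := nondeg_det nJ.
have v0 : 0 < Num.sqrt (evalE (J (t, p)) (detE R)) by rewrite sqrtr_gt0.
have main := cosE_time nJ u0 w0; cbv zeta in main.
rewrite uw mul1r -/B in main.
have sJ := nondeg_sym nJ.
have lagrange : evalE (J (t, p)) (normE u) * evalE (J (t, p)) (normE w) - evalE (J (t, p)) B ^+ 2
   = evalE (J (t, p)) (detE R).
  rewrite -[RHS]mulr1 -(expr1n R 2) -[in RHS]uw /B; case: (u) => u1 u2; case: (w) => w1 w2.
  by rewrite /= !sJ; ring.
have CE : ev C (t, p) = evalE (J (t, p)) B / (Num.sqrt (evalE (J (t, p)) (normE u)) * Num.sqrt (evalE (J (t, p)) (normE w))) by [].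
have squ := sqr_sqrtr (ltW qu); have sqw := sqr_sqrtr (ltW qw).
have sqv := sqr_sqrtr (ltW det0).
have sin2 : 1 - ev C (t, p) ^+ 2 = (Num.sqrt (evalE (J (t, p)) (detE R)) /
   (Num.sqrt (evalE (J (t, p)) (normE u)) * Num.sqrt (evalE (J (t, p)) (normE w)))) ^+ 2.
  rewrite CE !exprMn !exprVn !exprMn squ sqw sqv -lagrange.
  by field; rewrite !gt_eqF.
have sin0 : 0 < Num.sqrt (evalE (J (t, p)) (detE R)) /
   (Num.sqrt (evalE (J (t, p)) (normE u)) * Num.sqrt (evalE (J (t, p)) (normE w))).
  by rewrite divr_gt0// mulr_gt0.
have c1 : -1 < ev C (t, p) < 1.
  rewrite -ltr_norml -(@ltr_pXn2r _ 2)// ?nnegrE// expr1n real_normK ?num_real//.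
  by rewrite -subr_gt0 sin2 exprn_gt0.
have dt := @evalf_time R g U oU sg t p C (TU tab Tp) dC.
have da := @is_derive1_comp R acos (fun s => ev C (s, p)) t _ _ (is_derive1_acos c1) dt.
apply: (is_derive_eq da).
rewrite sin2 sqrtr_sqr gtr0_norm// /evalf.
have -> : evalE (J (t, p)) (shearE (edge_vec R (ordS (ordS i)))) = evalE (J (t, p)) (shearE w).
  by rewrite /w prev_vecE shearE_opp.
rewrite -opprB mulrN -main /C.
change (evalE (J (t, p)) (volE R)) with (Num.sqrt (evalE (J (t, p)) (detE R))).
cbn [ederiv evalE].
move: squ sqw su sw v0; clear.
move: (Num.sqrt (evalE (J (t, p)) (normE u))) (Num.sqrt (evalE (J (t, p)) (normE w))) (Num.sqrt (evalE (J (t, p)) (detE R))).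
move: (evalE _ (normE u)) (evalE _ (normE w)) (evalE _ B) (evalE _ (ederiv _ B)) (evalE _ (ederiv _ (normE u))) (evalE _ (ederiv _ (normE w))).
move=> qu qw x x' qu' qw' su sw v <- <- su0 sw0 v0.
by field; rewrite !gt_eqF.
Qed.

End Angle.

(** * Differentiation under the integral sign *)

Section Under.
Context {R : realType} d {Y : measurableType d}.
Variable mu : {measure set Y -> \bar R}.

Lemma is_derive_under_integral (B : set Y) (w : Y -> R) (F dF : R -> Y -> R) (u v t M : R) :
  measurable B -> mu.-integrable B (EFin \o w) -> u < t < v ->
  (forall s, u < s < v -> measurable_fun B (F s)) ->
  (forall s, u < s < v -> [bounded F s y | y in B]) ->
  (forall s y, u < s < v -> B y -> is_derive s 1 (F ^~ y) (dF s y)) ->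
  (forall s y, u < s < v -> B y -> `|dF s y| <= M) ->
  is_derive t 1 (fun s => \int[mu]_(y in B) (F s y * w y)) (\int[mu]_(y in B) (dF t y * w y)).
Proof.
move=> mB iw tuv mF bF DF bdF.
have Iu : `]u, v[%classic t by rewrite /= in_itv.
pose f s y := F s y * w y.
have D s y : u < s < v -> B y -> is_derive s 1 (f ^~ y) (dF s y * w y).
  move=> suv By; have := is_deriveM (DF s y suv By) (is_derive_cst (w y) s 1).
  by move=> /is_derive_eq; apply; rewrite scaler0 add0r; exact: mulrC.
have intf s : `]u, v[%classic s -> mu.-integrable B (EFin \o f s).
  by rewrite /= in_itv /= => suv; exact: (integrableMr mB (mF s suv) (bF s suv) iw).
have derf s y : `]u, v[%classic s -> B y -> derivable (f ^~ y) s 1.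
  by rewrite /= in_itv /= => suv By; have [] := D s y suv By.
have E s y : `]u, v[%classic s -> B y -> partial1of2 f s y = dF s y * w y.
  by rewrite /= in_itv /= => suv By; rewrite partial1of2E; have [_ ->] := D s y suv By.
have G0 y : 0 <= `|M| * `|w y| by rewrite mulr_ge0.
have iG : mu.-integrable B (EFin \o (fun y => `|M| * `|w y|)).
  exact: (integrableZl mB (`|M|) (integrable_norm iw)).
have bG s y : `]u, v[%classic s -> B y -> `|partial1of2 f s y| <= `|M| * `|w y|.
  move=> suv By; rewrite E// normrM ler_wpM2r//.
  apply: le_trans (bdF s y _ By) _; last exact: ler_norm.
  by move: suv; rewrite /= in_itv.
split; first exact: (derivable_under_integral mB Iu intf derf G0 iG bG).
rewrite -derive1E (differentiation_under_integral mB Iu intf derf G0 iG bG).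
by apply: eq_Rintegral => y /set_mem By; rewrite E.
Qed.

End Under.

Section Triangle.
Variable R : realType.
Local Notation W := (R * (R * R))%type.
Local Notation mR := (measurableTypeR R).
Local Notation mR2 := (mR * mR)%type.
Local Notation mu := (@lebesgue_measure R).
Local Notation T := (@tri_ref R).
Variables (a b : R) (g : R -> metric R) (U : set W).
Hypothesis oU : open U.
Hypothesis TU : forall t p, a < t < b -> T p -> U (t, p).
Hypothesis sg : forall i j, smooth U (fun z => g z.1 z.2 i j).
Hypothesis rg : forall t, a < t < b -> riemannian (g t).
Local Notation J := (jets_at (comp g)).
Local Notation ev := (evalf (comp g)).

Definition regular (e : expr R) := forall t p, a < t < b -> T p -> defined (J (t, p)) e.

Let nd t p (tab : a < t < b) (Tp : T p) : nondegenerate (J (t, p)) :=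
  jets_of_nondegenerate TU sg rg tab Tp.

Lemma regular_ederiv x e : regular e -> regular (ederiv x e).
Proof. by move=> re t p tab Tp; apply: defined_ederiv; exact: re. Qed.

Lemma regular_cont e t p : regular e -> a < t < b -> T p -> {for (t, p), continuous (ev e)}.
Proof.
move=> re tab Tp; apply: (@derivable_continuous_evalf R U) => [i j||]; first exact: sg.
  exact: TU.
exact: re.
Qed.

Lemma regular_slice e t : regular e -> a < t < b -> {within T, continuous (fun p => ev e (t, p))}.
Proof.
move=> re tab; apply: continuous_in_subspaceT => p /set_mem Tp.
apply: (@continuous_comp _ _ _ (fun q => (t, q)) (ev e)); first exact: continuous_pairl.
exact: regular_cont.
Qed.

Lemma regular_edge e t h : regular e -> a < t < b ->
  {within `[0, 1], continuous (fun s => ev e (t, edge_pt h s))}.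
Proof. by move=> re tab; exact: (@edge_continuous _ h (fun p => ev e (t, p)) (regular_slice re tab)). Qed.

Lemma regular_C1 e t : regular e -> a < t < b ->
  C1_on T (fun p => ev e (t, p)) (fun i p => ev (ederiv (sp (i != 0)) e) (t, p)).
Proof.
move=> re tab; split.
- move=> p i Tp; have [k ->] := obP i.
  have -> : (ob k != 0) = k by case: k.
  by apply: (evalf_space oU sg); [exact: TU|exact: re].
- exact: regular_slice.
- by move=> i; apply: regular_slice => //; exact: regular_ederiv.
Qed.

(** Provides the dominating constant: the product of a smaller closed time interval with the
    triangle is compact. *)
Lemma regular_bounded e t : regular e -> a < t < b ->
  exists u v M : R, [/\ u < t < v, (forall s, u < s < v -> a < s < b) &
    forall s p, u < s < v -> T p -> `|ev e (s, p)| <= M].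
Proof.
move=> re /andP[ta tb].
pose u := (a + t) / 2; pose v := (t + b) / 2.
have uv s : u <= s <= v -> a < s < b.
  by rewrite /u /v => /andP[? ?]; apply/andP; split; lra.
pose K : set W := `[u, v]%classic `*` T.
have cK : compact K by apply: compact_setX; [exact: segment_compact|exact: compact_tri_ref].
have ce : {within K, continuous (ev e)}.
  apply: continuous_in_subspaceT => -[s p] /set_mem [/=]; rewrite in_itv /= => suv Tp.
  by apply: regular_cont => //; exact: uv.
have [M [_ hM]] := within_continuous_bounded cK ce.
exists u, v, (`|M| + 1); split.
- by rewrite /u /v; apply/andP; split; lra.
- by move=> s /andP[us sv]; apply: uv; rewrite !ltW.
- move=> s p /andP[us sv] Tp; apply: (hM (`|M| + 1)); first by rewrite ltr_pwDr// ler_norm.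
  by split => //=; rewrite in_itv /= !ltW.
Qed.

Lemma evalf_integral_time e (v : H2fun R) t : regular e -> a < t < b ->
  is_derive t 1 (fun s => \int[leb2 R]_(p in T) (ev e (s, p) * v p))
    (\int[leb2 R]_(p in T) (ev (ederiv DT e) (t, p) * v p)).
Proof.
move=> re tab; have [u [w [M [tuw uw hM]]]] := regular_bounded (regular_ederiv DT re) tab.
apply: (@is_derive_under_integral R _ _ (leb2 R) T v (fun s p => ev e (s, p))
   (fun s p => ev (ederiv DT e) (s, p)) u w t M) => //.
- exact: measurable_tri_ref.
- exact: h2_integrable.
- by move=> s /uw sab; apply: continuous_measurable_tri; exact: regular_slice.
- move=> s /uw sab; apply: within_continuous_bounded; first exact: compact_tri_ref.
  exact: regular_slice.
- by move=> s p /uw sab Tp; apply: (evalf_time oU sg); [exact: TU|exact: re].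
Qed.

Lemma evalf_edge_integral_time e h (w : R -> R) t : regular e -> a < t < b ->
  {within `[0, 1], continuous w} ->
  is_derive t 1 (fun s => \int[mu]_(r in `[0, 1]) (ev e (s, edge_pt h r) * w r))
    (\int[mu]_(r in `[0, 1]) (ev (ederiv DT e) (t, edge_pt h r) * w r)).
Proof.
move=> re tab cw; have [u [x [M [tuw uw hM]]]] := regular_bounded (regular_ederiv DT re) tab.
have e01 (r : R) : `[0, 1]%classic r -> T (edge_pt h r) by rewrite /= in_itv /=; exact: edge_pt_tri.
apply: (@is_derive_under_integral R _ _ mu `[0, 1]%classic w (fun s r => ev e (s, edge_pt h r))
   (fun s r => ev (ederiv DT e) (s, edge_pt h r)) u x t M) => //.
- exact: within_continuous_integrable_itv.
- move=> s /uw sab; have := within_continuous_integrable_itv (@regular_edge e s h re sab).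
  by move=> /integrableP[/measurable_EFinP].
- move=> s /uw sab; apply: within_continuous_bounded; first exact: segment_compact.
  exact: regular_edge.
- by move=> s r /uw sab /e01 Tp; apply: (evalf_time oU sg); [exact: TU|exact: re].
- by move=> s r suw /e01 Tp; exact: hM.
Qed.

End Triangle.

(** * Integration by parts of the Hessian term on one triangle *)

Section Triangle.
Variable R : realType.
Local Notation W := (R * (R * R))%type.
Local Notation mR := (measurableTypeR R).
Local Notation mR2 := (mR * mR)%type.
Local Notation mu := (@lebesgue_measure R).
Local Notation T := (@tri_ref R).
Variables (a b : R) (g : R -> metric R) (U : set W).
Hypothesis oU : open U.
Hypothesis TU : forall t p, a < t < b -> T p -> U (t, p).
Hypothesis sg : forall i j, smooth U (fun z => g z.1 z.2 i j).
Hypothesis rg : forall t, a < t < b -> riemannian (g t).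
Local Notation J := (jets_at (comp g)).
Local Notation ev := (evalf (comp g)).
Local Notation regular := (regular a b g).
Variables (t : R) (tab : a < t < b) (v : H2fun R).

Let nd s p (sab : a < s < b) (Tp : T p) : nondegenerate (J (s, p)) :=
  jets_of_nondegenerate TU sg rg sab Tp.

Let rkap : regular (kapvolE R).
Proof. by move=> s p sab Tp; apply: defined_kapvolE; exact: nd. Qed.
Let rmom i j : regular (momE R i j).
Proof. by move=> s p sab Tp; apply: defined_momE; exact: nd. Qed.
Let rdiv k : regular (divE R k).
Proof. by move=> s p sab Tp; apply: defined_divE; exact: nd. Qed.
Let rshear h : regular (shearE (edge_vec R h)).
Proof. by move=> s p sab Tp; apply: defined_shearE; [exact: nd|exact: edge_vec_neq0]. Qed.
Let rgeod h : regular (geodE (edge_vec R h)).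
Proof. by move=> s p sab Tp; apply: defined_geodE; [exact: nd|exact: edge_vec_neq0]. Qed.

Definition sigma_at (s : R) (p : R * R) : 'M[R]_2 := \matrix_(i, j) derive1 (fun r => g r p i j) s.

Local Notation M i j p := (ev (momE R i j) (t, p)).
Local Notation P k p := (ev (divE R k) (t, p)).
Local Notation dM i j p := (ev (ederiv (sp j) (momE R i j)) (t, p)).
Local Notation dP k p := (ev (ederiv (sp k) (divE R k)) (t, p)).
Local Notation G i := (h2_grad v (ob i)).
Local Notation H i j := (h2_hess v (ob i) (ob j)).
Local Notation e h := (edge_vec R h).

Lemma divE_ev k p : P k p = dM k false p + dM k true p +
  (M false false p * ev (chrE R k false false) (t, p) + M false true p * ev (chrE R k false true) (t, p)
   + (M true false p * ev (chrE R k true false) (t, p) + M true true p * ev (chrE R k true true) (t, p))).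
Proof. by []. Qed.

(** The Leibniz rule used twice: M : Hess v = div (M grad v) - div (v P) + v div P. The Christoffel
    terms of the Hessian are those of [divE], and [kapvolE_time] identifies div P with twice the
    evolution of the curvature form. *)
Lemma stress_hess_pointwise p : T p ->
  inner2 (g t) p (S_op (g t) p (sigma_at t p)) (hess (g t) v p) * vol (g t) p =
  (H false false p * M false false p + G false p * dM false false p)
  + (H false true p * M false true p + G false p * dM false true p)
  + (H true false p * M true false p + G true p * dM true false p)
  + (H true true p * M true true p + G true p * dM true true p)
  - (G false p * P false p + v p * dP false p) - (G true p * P true p + v p * dP true p)
  + 2 * (ev (ederiv DT (kapvolE R)) (t, p) * v p).
Proof.
move=> Tp; have Uz := TU tab Tp; have nJ := nd tab Tp.
have dN0 : ev (detE R) (t, p) != 0 by rewrite gt_eqF//; case: nJ.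
rewrite (stress_ev oU TU sg rg tab Tp) /hess !mxE !sumb !(christoffel_ev oU sg _ _ _ Uz dN0) !divE_ev.
have -> : ev (ederiv DT (kapvolE R)) (t, p) = 2^-1 * (dP false p + dP true p) := kapvolE_time nJ.
do 8 move: (ev (chrE R _ _ _) _) => ?.
do 4 move: (ev (ederiv _ (momE R _ _)) _) => ?; do 4 move: (ev (momE R _ _) _) => ?.
do 2 move: (ev (ederiv _ (divE R _)) _) => ?; do 4 move: (h2_hess v _ _ p) => ?.
do 2 move: (h2_grad v _ p) => ?; move: (h2_val v p) => ?.
by field.
Qed.

Local Notation I01 := (`[0%R, 1%R]%classic).
Local Notation nu k h := (coord (ob k) (conormal R h)).
Local Notation tr h i s := (h2_trace v h (ob i) s).

Let mT := @measurable_tri_ref R.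
Let mI : measurable (`[0, 1]%classic : set mR). Proof. exact: measurable_itv. Qed.

Let obK k : (ob k != 0) = k. Proof. by case: k. Qed.

Lemma stress_hess_integral :
  \int[leb2 R]_(p in T) (inner2 (g t) p (S_op (g t) p (sigma_at t p)) (hess (g t) v p) * vol (g t) p) =
  \sum_h (\int[mu]_(s in I01) (tr h false s * (M false false (edge_pt h s) * nu false h))
        + \int[mu]_(s in I01) (tr h false s * (M false true (edge_pt h s) * nu true h))
        + \int[mu]_(s in I01) (tr h true s * (M true false (edge_pt h s) * nu false h))
        + \int[mu]_(s in I01) (tr h true s * (M true true (edge_pt h s) * nu true h))
        - \int[mu]_(s in I01) (v (edge_pt h s) * (P false (edge_pt h s) * nu false h))
        - \int[mu]_(s in I01) (v (edge_pt h s) * (P true (edge_pt h s) * nu true h)))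
  + 2 * \int[leb2 R]_(p in T) (ev (ederiv DT (kapvolE R)) (t, p) * v p).
Proof.
have gr i j : \sum_h \int[mu]_(s in I01) (tr h i s * (M i j (edge_pt h s) * nu j h)) =
    \int[leb2 R]_(p in T) (H i j p * M i j p + G i p * dM i j p).
  by have := green_h2_grad v (ob i) (ob j) (regular_C1 oU TU sg (rmom i j) tab); rewrite obK => ->.
have gv k : \sum_h \int[mu]_(s in I01) (v (edge_pt h s) * (P k (edge_pt h s) * nu k h)) =
    \int[leb2 R]_(p in T) (G k p * P k p + v p * dP k p).
  by have := green_h2_value v (ob k) (regular_C1 oU TU sg (rdiv k) tab); rewrite obK => ->.
rewrite !sumrB !big_split; cbv beta; rewrite !gr !gv /= {gr gv}.
have iM i j : (leb2 R).-integrable T (EFin \o (fun p => H i j p * M i j p + G i p * dM i j p)).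
  have i1 := mul_tri_integrable (h2_hess_integrable v (ob i) (ob j)) (regular_slice TU sg (rmom i j) tab).
  have i2 := mul_tri_integrable (h2_grad_integrable v (ob i)) (regular_slice TU sg (regular_ederiv (sp j) (rmom i j)) tab).
  exact: (integrableD mT i1 i2).
have iP k : (leb2 R).-integrable T (EFin \o (fun p => G k p * P k p + v p * dP k p)).
  have i1 := mul_tri_integrable (h2_grad_integrable v (ob k)) (regular_slice TU sg (rdiv k) tab).
  have i2 := mul_tri_integrable (h2_integrable v) (regular_slice TU sg (regular_ederiv (sp k) (rdiv k)) tab).
  exact: (integrableD mT i1 i2).
have iK : (leb2 R).-integrable T (EFin \o (fun p => ev (ederiv DT (kapvolE R)) (t, p) * v p)).
  have -> : (fun p => ev (ederiv DT (kapvolE R)) (t, p) * v p) = (fun p => v p * ev (ederiv DT (kapvolE R)) (t, p)).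
    by apply/funext => p; rewrite mulrC.
  apply: mul_tri_integrable; first exact: h2_integrable.
  exact: (regular_slice TU sg (regular_ederiv _ rkap) tab).
have i2 := integrable_add mT (iM false false) (iM false true).
have i3 := integrable_add mT i2 (iM true false).
have i4 := integrable_add mT i3 (iM true true).
have i5 := integrable_sub mT i4 (iP false).
have i6 := integrable_sub mT i5 (iP true).
have i7 := integrable_scale mT 2 iK.
rewrite -(Rintegral_scale mT 2 iK).
rewrite -(Rintegral_add mT (iM false false) (iM false true)) -(Rintegral_add mT i2 (iM true false)).
rewrite -(Rintegral_add mT i3 (iM true true)) -(Rintegral_sub mT i4 (iP false)).
rewrite -(Rintegral_sub mT i5 (iP true)) -(Rintegral_add mT i6 i7).
by apply: eq_Rintegral => p /set_mem Tp; rewrite stress_hess_pointwise.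
Qed.

(** [momE_conormal] paired with the gradient trace: what remains is the tangential derivative of [v]
    times sigma(n, tau). *)
Lemma boundary_pointwise h s : 0 <= s <= 1 ->
  bil (sigma_at t (edge_pt h s)) (tau (g t) h (edge_pt h s)) (tau (g t) h (edge_pt h s))
    * normal_deriv (g t) v h s * len (g t) h s
  + (tr h false s * (M false false (edge_pt h s) * nu false h)
     + tr h false s * (M false true (edge_pt h s) * nu true h)
     + tr h true s * (M true false (edge_pt h s) * nu false h)
     + tr h true s * (M true true (edge_pt h s) * nu true h))
  = ev (shearE (e h)) (t, edge_pt h s) * trace_tangent v h s.
Proof.
move=> s01; set p := edge_pt h s; have Tp : T p by exact: edge_pt_tri.
have nJ := nd tab Tp.
have mc k := momE_conormal nJ k (edge_vec_neq0 R h).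
rewrite (tau_ev TU sg rg tab Tp).
have sE : bil (sigma_at t p) (e h) (e h) = ev (bilE (@sigE R) (vecE (e h)) (vecE (e h))) (t, p).
  by rewrite /bil !sumb !mxE !(time_deriv_ev oU TU sg tab Tp).
rewrite sE /normal_deriv sumb -/p.
have nE k := nor_ev TU sg rg tab Tp h k.
have -> : len (g t) h s = len_at g t p h by [].
have -> : forall x y : R, x * (coord (ob false) (nor (g t) h p) * tr h false s + coord (ob true) (nor (g t) h p) * tr h true s) * y
   = x * ((coord (ob false) (nor (g t) h p) * y) * tr h false s + (coord (ob true) (nor (g t) h p) * y) * tr h true s).
  by move=> x y; ring.
rewrite !nE {nE} /trace_tangent sumb.
have m0 := mc false; have m1 := mc true; rewrite {mc}.
have mE k : evalE (J (t, p)) (bilE (@sigE R) (vecE (e h)) (vecE (e h)) / normE (e h) * volE R * (cornE (e h) k / detE R))%J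
   = ev (bilE (@sigE R) (vecE (e h)) (vecE (e h))) (t, p) / ev (normE (e h)) (t, p) * ev (volE R * (cornE (e h) k / detE R))%J (t, p).
  by rewrite /evalf [LHS]/= [in RHS]/= !mulrA.
rewrite !mE {mE} in m0 m1.
have sh k : evalE (J (t, p)) (shearE (e h) * vecE (e h) k)%J = ev (shearE (e h)) (t, p) * coord (ob k) (e h).
  by case: k.
rewrite !sh {sh} in m0 m1.
have nu0 : nu false h = (e h).2 by [].
have nu1 : nu true h = - (e h).1 by [].
rewrite nu0 nu1 [RHS]mulrDr ![in RHS]mulrA -m0 -m1 /evalf {m0 m1}.
ring.
Qed.

End Triangle.

(** * The evolution formula on one triangle *)

Section Triangle.
Variable R : realType.
Local Notation W := (R * (R * R))%type.
Local Notation mR := (measurableTypeR R).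
Local Notation mR2 := (mR * mR)%type.
Local Notation mu := (@lebesgue_measure R).
Local Notation T := (@tri_ref R).
Variables (a b : R) (g : R -> metric R) (U : set W).
Hypothesis oU : open U.
Hypothesis TU : forall t p, a < t < b -> T p -> U (t, p).
Hypothesis sg : forall i j, smooth U (fun z => g z.1 z.2 i j).
Hypothesis rg : forall t, a < t < b -> riemannian (g t).
Local Notation J := (jets_at (comp g)).
Local Notation ev := (evalf (comp g)).
Local Notation regular := (regular a b g).
Variables (t : R) (tab : a < t < b) (v : H2fun R).

Let nd s p (sab : a < s < b) (Tp : T p) : nondegenerate (J (s, p)) :=
  jets_of_nondegenerate TU sg rg sab Tp.

Let rkap : regular (kapvolE R).
Proof. by move=> s p sab Tp; apply: defined_kapvolE; exact: nd. Qed.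
Let rmom i j : regular (momE R i j).
Proof. by move=> s p sab Tp; apply: defined_momE; exact: nd. Qed.
Let rdiv k : regular (divE R k).
Proof. by move=> s p sab Tp; apply: defined_divE; exact: nd. Qed.
Let rshear h : regular (shearE (edge_vec R h)).
Proof. by move=> s p sab Tp; apply: defined_shearE; [exact: nd|exact: edge_vec_neq0]. Qed.
Let rgeod h : regular (geodE (edge_vec R h)).
Proof. by move=> s p sab Tp; apply: defined_geodE; [exact: nd|exact: edge_vec_neq0]. Qed.

Local Notation M i j p := (ev (momE R i j) (t, p)).
Local Notation P k p := (ev (divE R k) (t, p)).
Local Notation e h := (edge_vec R h).
Local Notation I01 := (`[0%R, 1%R]%classic).
Local Notation nu k h := (coord (ob k) (conormal R h)).
Local Notation tr h i s := (h2_trace v h (ob i) s).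
Local Notation shear h p := (ev (shearE (e h)) (t, p)).
Local Notation dshear h p :=
  ((e h).1 * ev (ederiv DX (shearE (e h))) (t, p) + (e h).2 * ev (ederiv DY (shearE (e h))) (t, p)).
Local Notation dgeod h p := (ev (ederiv DT (geodE (e h))) (t, p)).

(** The share of one side in the edge term of [b_h], with ds written in the parameter of the
    edge. *)
Definition edge_load h s : R :=
  bil (sigma_at g t (edge_pt h s)) (tau (g t) h (edge_pt h s)) (tau (g t) h (edge_pt h s))
    * normal_deriv (g t) v h s * len (g t) h s.

Let mI : measurable (`[0, 1]%classic : set mR). Proof. exact: measurable_itv. Qed.

Lemma shear_edge h (s : R) : 0 <= s <= 1 ->
  is_derive s 1 (fun r => shear h (edge_pt h r)) (dshear h (edge_pt h s)).
Proof.
move=> s01; have Tp := edge_pt_tri h s01.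
have Uz := TU tab Tp; have de := rshear h tab Tp.
have := @is_derive_evalf R U oU (comp g) (fun i j => sg (ob i) (ob j)) _ _ (0, e h) Uz de.
rewrite /= mul0r add0r => /derive_space d.
have E (r : R) : edge_pt h r = r *: e h + corner R h by rewrite /edge_pt addrC.
under eq_fun do rewrite E.
by apply: (is_derive_line (f := fun q => shear h q)); rewrite -E.
Qed.

Lemma shear_trace_integrable h :
  mu.-integrable I01 (EFin \o (fun s => shear h (edge_pt h s) * trace_tangent v h s)).
Proof.
have i0 := integrable_scale mI (coord 0 (e h)) (h2_trace_integrable v h 0).
have i1 := integrable_scale mI (coord 1 (e h)) (h2_trace_integrable v h 1).
have := mul_edge_integrable (integrable_add mI i0 i1) (regular_edge (h := h) TU sg (rshear h) tab).
by congr (integrable _ _ _); apply/funext => s /=; rewrite /trace_tangent sum2 mulrC.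
Qed.

Lemma shear_by_parts h :
  \int[mu]_(s in I01) (shear h (edge_pt h s) * trace_tangent v h s) =
  v (edge_pt h 1) * shear h (edge_pt h 1) - v (edge_pt h 0) * shear h (edge_pt h 0)
  - \int[mu]_(s in I01) (v (edge_pt h s) * dshear h (edge_pt h s)).
Proof.
have cdx x : {within `[0, 1], continuous (fun s => ev (ederiv x (shearE (e h))) (t, edge_pt h s))}.
  exact: (regular_edge (h := h) TU sg (regular_ederiv x (rshear h)) tab).
have cd : {within `[0, 1], continuous (fun s => dshear h (edge_pt h s))}.
  by move=> s; apply: cvgD; (apply: cvgM; first exact: cvg_cst); [exact: (cdx DX s)|exact: (cdx DY s)].
rewrite -(edge_by_parts v h (@shear_edge h) cd); apply/eqP; rewrite -subr_eq opprK; apply/eqP.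
have cv : {within `[0, 1], continuous (fun s => v (edge_pt h s))} := @edge_continuous _ h v (@h2_cont _ v).
rewrite -(Rintegral_add mI).
- by apply: eq_Rintegral => s _; rewrite (mulrC (shear _ _)).
- exact: shear_trace_integrable.
- apply: within_continuous_integrable_itv => s; apply: cvgM; [exact: cv|exact: cd].
Qed.

Lemma edge_loadE h s : 0 <= s <= 1 ->
  edge_load h s = shear h (edge_pt h s) * trace_tangent v h s
  - (tr h false s * (M false false (edge_pt h s) * nu false h)
     + tr h false s * (M false true (edge_pt h s) * nu true h)
     + tr h true s * (M true false (edge_pt h s) * nu false h)
     + tr h true s * (M true true (edge_pt h s) * nu true h)).
Proof.
by move=> s01; rewrite -(boundary_pointwise oU TU sg rg tab v h s01) addrK.
Qed.

(** Gathers all boundary contributions on one edge. The tangential derivative of [v] is integrated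
    by parts, leaving endpoint values and the evolution of the geodesic curvature. *)
Lemma edge_load_integral h :
  mu.-integrable I01 (EFin \o edge_load h) /\
  \int[mu]_(s in I01) edge_load h s +
  (\int[mu]_(s in I01) (tr h false s * (M false false (edge_pt h s) * nu false h))
        + \int[mu]_(s in I01) (tr h false s * (M false true (edge_pt h s) * nu true h))
        + \int[mu]_(s in I01) (tr h true s * (M true false (edge_pt h s) * nu false h))
        + \int[mu]_(s in I01) (tr h true s * (M true true (edge_pt h s) * nu true h))
        - \int[mu]_(s in I01) (v (edge_pt h s) * (P false (edge_pt h s) * nu false h))
        - \int[mu]_(s in I01) (v (edge_pt h s) * (P true (edge_pt h s) * nu true h))) =
  v (edge_pt h 1) * shear h (edge_pt h 1) - v (edge_pt h 0) * shear h (edge_pt h 0)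
  + 2 * \int[mu]_(s in I01) (dgeod h (edge_pt h s) * v (edge_pt h s)).
Proof.
have cM i j : {within `[0, 1], continuous (fun s => M i j (edge_pt h s) * nu j h)}.
  by move=> s; apply: cvgM; [exact: (regular_edge (h := h) TU sg (rmom i j) tab)|exact: cvg_cst].
have iM i j := mul_edge_integrable (h2_trace_integrable v h (ob i)) (cM i j).
have cv : {within `[0, 1], continuous (fun s => v (edge_pt h s))} := @edge_continuous _ h v (@h2_cont _ v).
have iP k : mu.-integrable I01 (EFin \o (fun s => v (edge_pt h s) * (P k (edge_pt h s) * nu k h))).
  apply: within_continuous_integrable_itv => s; apply: cvgM; first exact: cv.
  by apply: cvgM; [exact: (regular_edge (h := h) TU sg (rdiv k) tab)|exact: cvg_cst].
have iG : mu.-integrable I01 (EFin \o (fun s => dgeod h (edge_pt h s) * v (edge_pt h s))).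
  apply: within_continuous_integrable_itv => s; apply: cvgM; last exact: cv.
  exact: (regular_edge (h := h) TU sg (regular_ederiv DT (rgeod h)) tab).
have iS := shear_trace_integrable h.
have i2 := integrable_add mI (iM false false) (iM false true).
have i3 := integrable_add mI i2 (iM true false).
have i4 := integrable_add mI i3 (iM true true).
have i5 := integrable_sub mI iS i4.
have E s : s \in I01 -> edge_load h s = shear h (edge_pt h s) * trace_tangent v h s
  - (tr h false s * (M false false (edge_pt h s) * nu false h)
     + tr h false s * (M false true (edge_pt h s) * nu true h)
     + tr h true s * (M true false (edge_pt h s) * nu false h)
     + tr h true s * (M true true (edge_pt h s) * nu true h)).
  by move=> /set_mem; rewrite /= in_itv /=; exact: edge_loadE.
split.
  by apply: eq_integrable i5 => // s /E /= ->.
rewrite (eq_Rintegral mu E) (Rintegral_sub mI iS i4) (Rintegral_add mI i3 (iM true true)).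
rewrite (Rintegral_add mI i2 (iM true false)) (Rintegral_add mI (iM false false) (iM false true)).
rewrite shear_by_parts.
(* By [geodE_time], the derivative of sigma(n, tau) along the edge is minus the flux of [divE],
   minus twice the evolution of the geodesic curvature form. *)
have -> : \int[mu]_(s in I01) (v (edge_pt h s) * dshear h (edge_pt h s)) =
  - (\int[mu]_(s in I01) (v (edge_pt h s) * (P false (edge_pt h s) * nu false h))
   + \int[mu]_(s in I01) (v (edge_pt h s) * (P true (edge_pt h s) * nu true h))
   + 2 * \int[mu]_(s in I01) (dgeod h (edge_pt h s) * v (edge_pt h s))).
  rewrite -(Rintegral_scale mI 2 iG) -(Rintegral_add mI (iP false) (iP true)).
  have i6 := integrable_add mI (iP false) (iP true).
  rewrite -(Rintegral_add mI i6 (integrable_scale mI 2 iG)) -mulN1r -Rintegral_scale//; last first.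
    exact: (integrable_add mI i6 (integrable_scale mI 2 iG)).
  apply: eq_Rintegral => s /set_mem sI.
  have s01 : 0 <= s <= 1 by move: sI; rewrite /= in_itv.
  have nJ := nd tab (edge_pt_tri h s01).
  have G := geodE_time nJ (edge_vec_neq0 R h).
  have -> : nu false h = (e h).2 by [].
  have -> : nu true h = - (e h).1 by [].
  rewrite /evalf G {G}.
  move: (evalE _ (divE R false)) (evalE _ (divE R true)) (evalE _ (ederiv DX _)) (evalE _ (ederiv DY _)).
  by move: (h2_val v _) (e h).1 (e h).2 => x y z p q r s1; field.
do 6 move: (\int[mu]_(s in I01) (_ * (_ * _))) => ?.
ring.
Qed.

(** The share of one triangle in the distributional curvature, over all of its edges and corners
    whether or not they lie on the boundary; the terms 2 pi v(z), constant in time, are left out. *)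
Definition tri_part s : R :=
  \int[leb2 R]_(p in T) (gauss_curv (g s) p * v p * vol (g s) p)
  + \sum_h \int[mu]_(r in I01) (geod_curv (g s) h (edge_pt h r) * v (edge_pt h r) * len (g s) h r)
  - \sum_i angle (g s) i * v (corner R i).

Lemma geod_curv_integrable h :
  mu.-integrable I01 (EFin \o (fun r => geod_curv (g t) h (edge_pt h r) * v (edge_pt h r) * len (g t) h r)).
Proof.
have cv : {within `[0, 1], continuous (fun s => v (edge_pt h s))} := @edge_continuous _ h v (@h2_cont _ v).
have i : mu.-integrable I01 (EFin \o (fun r => ev (geodE (e h)) (t, edge_pt h r) * v (edge_pt h r))).
  apply: within_continuous_integrable_itv => s; apply: cvgM; last exact: cv.
  exact: (regular_edge (h := h) TU sg (rgeod h) tab).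
apply: eq_integrable i => // r /set_mem rI.
have r01 : 0 <= r <= 1 by move: rI; rewrite /= in_itv.
rewrite /comp /= [in RHS]mulrAC; congr (_ * _)%:E.
exact/esym/(geod_curv_ev oU TU sg rg tab (edge_pt_tri h r01)). 
Qed.

Lemma edge_pt_at1 h : edge_pt h 1 = corner R (ordS h).
Proof. by rewrite /edge_pt scale1r /edge_vec addrC subrK. Qed.

Lemma edge_pt_at0 h : edge_pt h 0 = corner R h.
Proof. by rewrite /edge_pt scale0r addr0. Qed.

(** The endpoint values from [edge_load_integral], regrouped by corner, are [v] times the difference
    of sigma(n, tau) on the incoming and outgoing edges; by [angle_time] this is minus twice the
    rate of change of the angle times [v]. *)
Lemma tri_part_derive : is_derive t 1 tri_part
  (2^-1 * (\int[leb2 R]_(p in T) (inner2 (g t) p (S_op (g t) p (sigma_at g t p)) (hess (g t) v p) * vol (g t) p)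
   + \sum_h \int[mu]_(s in I01) edge_load h s)).
Proof.
have cv h : {within `[0, 1], continuous (fun s => v (edge_pt h s))} := @edge_continuous _ h v (@h2_cont _ v).
pose A s := \int[leb2 R]_(p in T) (ev (kapvolE R) (s, p) * v p).
pose B h s := \int[mu]_(r in I01) (ev (geodE (e h)) (s, edge_pt h r) * v (edge_pt h r)).
have dA : is_derive t 1 A _ := evalf_integral_time oU TU sg v rkap tab.
have dB h : is_derive t 1 (B h) _ := evalf_edge_integral_time oU TU sg h (rgeod h) tab (cv h).
have dC i := is_deriveM (angle_time oU TU sg rg i tab) (is_derive_cst (v (corner R i)) t 1).
(* The expressions represent the geometry for times in ]a, b[, which is a neighbourhood of [t]. *)
have nF : \forall s \near t, A s + (B h0 s + (B h1 s + B h2 s))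
   - (angle (g s) h0 * v (corner R h0) + (angle (g s) h1 * v (corner R h1) + angle (g s) h2 * v (corner R h2)))
   = tri_part s.
  have : \forall s \near t, s \in `]a, b[ by apply: near_in_itvoo; rewrite in_itv.
  apply: filterS => s; rewrite in_itv /= => sab.
  apply/esym; rewrite /tri_part !sum3; congr (_ + _ - _).
    by apply: eq_Rintegral => p /set_mem Tp; rewrite mulrAC (curvature_ev oU TU sg rg sab Tp).
  have E h : \int[mu]_(r in I01) (geod_curv (g s) h (edge_pt h r) * v (edge_pt h r) * len (g s) h r) = B h s.
    apply: eq_Rintegral => r /set_mem; rewrite /= in_itv /= => r01.
    by rewrite mulrAC -(geod_curv_ev oU TU sg rg sab (edge_pt_tri h r01)).
  by rewrite !E.
have D := is_deriveB (is_deriveD dA (is_deriveD (dB h0) (is_deriveD (dB h1) (dB h2))))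
  (is_deriveD (dC h0) (is_deriveD (dC h1) (dC h2))).
apply: (@near_eq_is_derive _ _ _ _ tri_part t 1 _ nF).
apply: (is_derive_eq D).
rewrite (stress_hess_integral oU TU sg rg tab v) [in RHS]addrAC -big_split /=.
rewrite (eq_bigr _ (fun h _ => etrans (addrC _ _) (proj2 (edge_load_integral h)))) !sum3.
rewrite !edge_pt_at1 !edge_pt_at0 !scaler0 !add0r.
have E (x y : R) : x *: (y : R^o) = x * y by [].
rewrite !E /cst.
have -> : ordS h0 = h1 by exact: val_inj.
have -> : ordS h1 = h2 by exact: val_inj.
have -> : ordS h2 = h0 by exact: val_inj.
move: (\int[leb2 R]_(p in T) _) => K.
do 3 move: (\int[mu]_(p in I01) _) => ?.
do 3 move: (h2_val v _) => ?.
do 6 move: (ev (shearE _) _) => ?.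
by field.
Qed.

Lemma edge_length_time (p : R * R) h : T p ->
  is_derive t 1 (fun s => bil (g s p) (e h) (e h)) (bil (sigma_at g t p) (e h) (e h)).
Proof.
move=> Tp; have Uz := TU tab Tp.
under eq_fun do rewrite bil_ev.
have := evalf_time oU sg Uz (defined_normE (J (t, p)) (e h)).
move=> /is_derive_eq; apply; rewrite /bil !sumb !mxE !(time_deriv_ev oU TU sg tab Tp).
move: (e h) => u; rewrite /evalf /= /coord /=; ring.
Qed.

End Triangle.

(** * Reversal of the parameter of an edge *)

Section Reflection.
Variable R : realType.
Local Notation mR := (measurableTypeR R).
Local Notation mu := (@lebesgue_measure R).
Local Notation I01 := (`[0%R, 1%R]%classic : set mR).

Let psi (x : mR) : mR := 1 - x.

Let mpsi : measurable_fun setT psi.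
Proof. by apply: measurable_funB => //; exact: measurable_cst. Qed.

Let preimage_psi (b0 b1 : bool) (x y : R) :
  psi @^-1` [set` Interval (BSide b0 x) (BSide b1 y)] =
  [set` Interval (BSide (~~ b1) (1 - y)) (BSide (~~ b0) (1 - x))].
Proof.
apply/seteqP; split => r /=; rewrite !in_itv /psi /=.
all: case: b0; case: b1 => /= /andP[? ?]; apply/andP; split; lra.
Qed.

Let lebesgue_onem A : measurable A -> pushforward mu psi A = mu A.
Proof.
move=> mA; apply/esym/lebesgue_measure_unique => //= _ [[x y]] _ <-.
rewrite /pushforward preimage_psi /= !lebesgue_measure_itv/= !lte_fin.
by rewrite ltrD2l ltrN2; case: ifP => // _; rewrite -!EFinD; congr (_%:E); ring.
Qed.

(** Gradient traces are merely integrable, so a substitution rule for continuous functions does not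
    cover them. Reflection preserves Lebesgue measure, since it preserves the measure of intervals,
    and the integral is transported as that of a pushforward. *)
Lemma integrable_onem (f : R -> R) : mu.-integrable I01 (EFin \o f) ->
  mu.-integrable I01 (EFin \o (fun s => f (1 - s))) /\
  \int[mu]_(s in I01) f (1 - s) = \int[mu]_(s in I01) f s.
Proof.
move=> fi; have mI : measurable I01 by exact: measurable_itv.
have pI : psi @^-1` I01 = I01 by rewrite preimage_psi /= subr0 subrr.
pose F : mR -> \bar R := (EFin \o f) \_ I01.
have Fi : mu.-integrable I01 F.
  by apply: eq_integrable fi => // s sI; rewrite /F patchE sI.
have mF : measurable_fun setT F.
  by apply/(measurable_restrictT _ mI); case/integrableP: fi.
have iFp : mu.-integrable (psi @^-1` I01) (F \o psi).
  apply/integrableP; split; first by apply: measurable_funTS; exact: measurableT_comp.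
  have -> : (\int[mu]_(x in psi @^-1` I01) `|(F \o psi) x| = \int[pushforward mu psi]_(y in I01) `|F y|)%E.
    rewrite ge0_integral_pushforward//.
    by apply: measurableT_comp => //; exact: measurable_funTS.
  rewrite (eq_measure_integral mu); last by move=> A mA _; exact: lebesgue_onem.
  by case/integrableP: Fi.
have E s : s \in I01 -> (F \o psi) s = (f (1 - s))%:E.
  move=> sI; rewrite /= /F patchE ifT//; move/set_mem: sI; rewrite -{1}pI => ?.
  exact/mem_set.
have J := integral_pushforward mpsi mF iFp mI.
rewrite pI in J iFp; split; first by apply: eq_integrable iFp.
rewrite /Rintegral; congr fine.
transitivity (\int[mu]_(s in I01) F s)%E; last first.
  by apply: eq_integral => s sI; rewrite /F patchE sI.
rewrite -(eq_integral _ _ E) -J; apply: eq_measure_integral => A mA _; exact: lebesgue_onem.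
Qed.

End Reflection.

(** * Combinatorics of edges and vertices *)

Section Edges.
Variable S : triangulation.
Implicit Types (h : side S) (E : {set vert S}).

Lemma ordS_neq (i : 'I_3) : i != ordS i.
Proof. by elim/I3_ind: i. Qed.

Lemma ord3_cases (i j : 'I_3) : i != j -> j = ordS i \/ i = ordS j.
Proof.
by elim/I3_ind: i; elim/I3_ind: j => //= _; (left + right); exact: val_inj.
Qed.

Lemma org_neq h : org h != corner_vert h.1 (ordS h.2).
Proof. by rewrite (inj_eq (@corner_vert_inj S h.1)) ordS_neq. Qed.

Lemma org_in_edge h : org h \in edge_of h.
Proof. by rewrite !inE eqxx. Qed.

(** Such sides run through the edge in the same direction, so [coherent] identifies them; distinct
    sides of an edge thus have opposite orientations. *)
Lemma edge_of_org h h' : edge_of h = edge_of h' -> org h = org h' -> h = h'.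
Proof.
move=> E eo; have := org_neq h; move: E eo; case: h => T i; case: h' => T' j.
rewrite /edge_of /org /= => E eo n; apply: coherent => //.
have : corner_vert T (ordS i) \in [set corner_vert T' j; corner_vert T' (ordS j)]%SET.
  by rewrite -E !inE eqxx orbT.
by rewrite !inE -eo eq_sym (negbTE n) /= => /eqP.
Qed.

(** By [edge_of_org] a side of [E] is determined by its origin, one of the two endpoints. *)
Lemma card_sides E : E \in edges S -> (0 < #|sides_of E| <= 2)%N.
Proof.
case/imsetP => h _ ->; apply/andP; split.
  by apply/card_gt0P; exists h; rewrite inE.
have /card_in_imset <- : {in sides_of (edge_of h) &, injective (@org S)}.
  by move=> h1 h2; rewrite !inE => /eqP E1 /eqP E2; apply: edge_of_org; rewrite E1.
apply: leq_trans (_ : #|edge_of h| <= 2)%N; last by rewrite cards2; case: eqP.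
by apply/subset_leq_card/fintype.subsetP => _ /imsetP[h1 + ->]; rewrite inE => /eqP <-; exact: org_in_edge.
Qed.

Lemma int_or_bnd E : E \in edges S -> E \notin int_edges S -> E \in bnd_edges S.
Proof.
move=> eE; have := card_sides eE; rewrite !inE eE /=.
by case: #|_| => [|[|[|]]].
Qed.

Lemma sum_sides (V : nmodType) (K : side S -> V) :
  \sum_(E in edges S) \sum_(h in sides_of E) K h = \sum_h K h.
Proof.
rewrite [RHS](partition_big (@edge_of S) (mem (edges S)))/=; last first.
  by move=> h _; exact: imset_f.
by apply: eq_bigr => E _; apply: eq_bigl => h; rewrite inE.
Qed.

Lemma sum_int_sides (V : nmodType) (K : side S -> V) :
  (forall h, edge_of h \in bnd_edges S -> K h = 0) ->
  \sum_(E in int_edges S) \sum_(h in sides_of E) K h = \sum_h K h.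
Proof.
move=> K0; rewrite -sum_sides [RHS](bigID (mem (int_edges S))) /= [X in _ + X]big1 ?addr0.
  apply: eq_bigl => E; apply/idP/andP => [iE|[]//]; split => //.
  by move: iE; rewrite inE => /andP[].
move=> E /andP[eE nE]; apply: big1 => h; rewrite inE => /eqP hE.
by apply: K0; rewrite hE; exact: int_or_bnd.
Qed.

Lemma side_of_pair (T : tri S) z w : z != w -> z \in vset T -> w \in vset T ->
  exists2 h, h.1 = T & edge_of h = [set z; w]%SET.
Proof.
move=> zw /imsetP[i _ zi] /imsetP[j _ wj].
have /ord3_cases[E|E] : i != j by apply: contra_neq zw => ij; rewrite zi wj ij.
  by exists (T, i); rewrite // /edge_of /= -E zi wj.
by exists (T, j); rewrite // /edge_of /= -E zi wj finset.setUC.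
Qed.

End Edges.

Section Vertices.
Variables (R : realType) (S : triangulation) (v : V_space R S).
Implicit Types (h : side S) (z : vert S).

Let pos h z : R := if org h == z then 0 else 1.

Let pos01 h z : 0 <= pos h z <= 1.
Proof. by rewrite /pos; case: eqP; rewrite ler01 lexx. Qed.

Let edge_pt_pos h i : corner_vert h.1 i \in edge_of h ->
  edge_pt h.2 (pos h (corner_vert h.1 i)) = corner R i.
Proof.
rewrite !inE /pos /org !(inj_eq (@corner_vert_inj S h.1)) => /orP[]/eqP ->.
  by rewrite eqxx edge_pt_at0.
by rewrite (negbTE (ordS_neq _)) edge_pt_at1.
Qed.

Let transfer_pos h h' z : edge_of h = edge_of h' -> z \in edge_of h ->
  transfer h h' (pos h z) = pos h' z.
Proof.
move=> E zh; rewrite /transfer; case: eqP => [eo|/eqP n].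
  by rewrite (edge_of_org E (esym eo)).
have : org h' \in edge_of h by rewrite E org_in_edge.
rewrite !inE -[corner_vert h.1 h.2]/(org h) (negbTE n) /= => /eqP eo.
move: zh; rewrite !inE -[corner_vert h.1 h.2]/(org h) /pos eo => /orP[]/eqP ->.
  by rewrite eqxx eq_sym (negbTE (org_neq h)) subr0.
by rewrite eqxx (negbTE (org_neq h)) subrr.
Qed.

Lemma corner_value_edge h h' i j : edge_of h = edge_of h' -> corner_vert h.1 i \in edge_of h ->
  corner_vert h.1 i = corner_vert h'.1 j -> v h.1 (corner R i) = v h'.1 (corner R j).
Proof.
move=> E ih ij; rewrite -(edge_pt_pos ih) (V_single_valued v E)// transfer_pos//.
by rewrite ij edge_pt_pos// -ij -E.
Qed.

(** Single-valuedness is given across edges only. Since links are connected, a chain of triangles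
    around the vertex, consecutive ones sharing an edge through it, carries the value from one
    triangle to the other. *)
Lemma corner_value h h' : org h = org h' -> v h.1 (corner R h.2) = v h'.1 (corner R h'.2).
Proof.
set z := org h => zh'.
have zT k : org k = z -> z \in vset k.1 by move=> <-; apply/imsetP; exists k.2.
have /connectP[p] := link_connected (zT h erefl) (zT h' (esym zh')).
have : corner_vert h.1 h.2 = z by [].
have : corner_vert h'.1 h'.2 = z by [].
elim: p h.1 h.2 => [|T2 p IH] T i hj hi /=.
  by move=> _ E; move: hj; rewrite E -hi => /corner_vert_inj ->.
case/andP=> /existsP[w /andP[wz]]; rewrite finset.subsetI !finset.subUset !finset.sub1set.
case/andP=> /andP[z1 w1] /andP[z2 w2] pp.
have zw : z != w by rewrite eq_sym.
have [k1 k1T k1E] := side_of_pair zw z1 w1.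
have [k2 k2T k2E] := side_of_pair zw z2 w2.
have /imsetP[j _ zj] := z2.
move=> L; rewrite -(IH T2 j hj (esym zj) pp L) -k1T -k2T; apply: corner_value_edge.
- by rewrite k1E k2E.
- by rewrite k1T hi k1E !inE eqxx.
- by rewrite k1T k2T hi.
Qed.

Lemma vert_val_org h : vert_val v (org h) = v h.1 (corner R h.2).
Proof.
rewrite /vert_val; case: pickP => [h' /eqP|/(_ h)]; first exact: corner_value.
by rewrite eqxx.
Qed.

Lemma vert_val_bnd z : z \notin int_verts S -> vert_val v z = 0.
Proof.
rewrite inE negb_forall => /existsP[E]; rewrite negb_imply negbK => /andP[bE zE].
have /imsetP[h _ Eh] : E \in edges S by move: bE; rewrite inE => /andP[].
have zh : z \in edge_of h by rewrite -Eh.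
have [i iz] : exists i, corner_vert h.1 i = z.
  by move: zh; rewrite !inE => /orP[]/eqP ->; eexists.
have -> : z = org (h.1, i) by [].
rewrite vert_val_org /= -(@edge_pt_pos h i) ?iz//.
by apply: V_bnd0 => //; rewrite -Eh.
Qed.

End Vertices.

Lemma is_derive_bigsum (R : realType) (I : Type) (r : seq I) (f : I -> R -> R) (df : I -> R) (t : R) :
  (forall i, is_derive t 1 (f i) (df i)) ->
  is_derive t 1 (fun s => \sum_(i <- r) f i s) (\sum_(i <- r) df i).
Proof.
move=> D; elim: r => [|i r IH].
  by rewrite big_nil; under eq_fun do rewrite big_nil; exact: is_derive_cst.
by rewrite big_cons; under eq_fun do rewrite big_cons; exact: is_deriveD.
Qed.

(** * Edge integrals as sums over sides *)

Section EdgeIntegral.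
Variables (R : realType) (S : triangulation).
Implicit Types (h : side S) (G : tri_metric R S).
Local Notation I01 := (`[0%R, 1%R]%classic).
Local Notation mu := (leb R).

Lemma transfer01 h h' (s : R) : 0 <= s <= 1 -> 0 <= transfer h h' s <= 1.
Proof. by rewrite /transfer; case: ifP => // _ /andP[? ?]; apply/andP; split; lra. Qed.

Lemma len_transfer G h h' s : tt_continuous G -> edge_of h = edge_of h' -> 0 <= s <= 1 ->
  len (G h.1) h.2 s = len (G h'.1) h'.2 (transfer h h' s).
Proof. by move=> ttG E s01; rewrite /len (ttG h h'). Qed.

Lemma integral_transfer h h' (F : R -> R) : mu.-integrable I01 (EFin \o F) ->
  mu.-integrable I01 (EFin \o (fun s => F (transfer h h' s))) /\
  \int[mu]_(s in I01) F (transfer h h' s) = \int[mu]_(s in I01) F s.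
Proof. by rewrite /transfer => Fi; case: (org h' == org h) => //; exact: integrable_onem. Qed.

(** The integral is taken in the parameter of one chosen side. Each summand is returned to its own
    side by [transfer], the identity or the reflection of [0, 1], neither of which changes the
    integral. *)
Lemma edge_integral_sum G E (f F : side S -> R -> R) : E \in edges S ->
  (forall h, mu.-integrable I01 (EFin \o F h)) ->
  (forall h s, edge_of h = E -> 0 <= s <= 1 ->
     f h s * len (G h.1) h.2 s = \sum_(h' in sides_of E) F h' (transfer h h' s)) ->
  edge_integral G E f = \sum_(h in sides_of E) \int[mu]_(s in I01) F h s.
Proof.
move=> eE iF fF; rewrite /edge_integral; case: pickP => [h|h0]; last first.
  by have /andP[/card_gt0P[h]] := card_sides eE; rewrite h0.
rewrite inE => /eqP hE.
have mI : measurable (I01 : set (measurableTypeR R)) by exact: measurable_itv.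
transitivity (\int[mu]_(s in I01) (\sum_(h' in sides_of E) F h' (transfer h h' s))).
  by apply: eq_Rintegral => s /set_mem; rewrite /= in_itv /=; exact: fF.
have i h' := proj1 (integral_transfer h h' (iF h')).
rewrite (proj2 (Rintegral_bigsum _ mI (fun h' _ => i h'))).
by apply: eq_bigr => h' _; exact: (proj2 (integral_transfer h h' (iF h'))).
Qed.

End EdgeIntegral.

(** * Summation over the triangulation *)

Section Assembly.
Variables (R : realType) (S : triangulation) (a b : R) (g : R -> tri_metric R S).
Hypothesis hg : regge_family a b g.
Variable v : V_space R S.
Implicit Types (h : side S).
Local Notation I01 := (`[0%R, 1%R]%classic).
Local Notation mu := (leb R).

Let tri_family (T : tri S) (s : R) : metric R := g s T.

Let rg T t : a < t < b -> riemannian (tri_family T t).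
Proof. by move=> tab; have [_ /(_ t tab)[r _]] := hg; exact: r. Qed.

Lemma tri_partE s T : tri_part (tri_family T) (v T) s =
  tri_integral (g s) T (fun p => gauss_curv (g s T) p * v T p)
  + \sum_i \int[mu]_(r in I01) (geod_curv (g s T) i (edge_pt i r) * v T (edge_pt i r) * len (g s T) i r)
  - \sum_i angle (g s T) i * v T (corner R i).
Proof. by []. Qed.

(** Grouping corners by vertex; those at boundary vertices drop out because [v] vanishes there, so
    the angle sum may range over all corners. *)
Lemma vertex_sum (s : R) :
  \sum_(z in int_verts S) angle_defect (g s) z * vert_val v z =
  2 * pi * (\sum_(z in int_verts S) vert_val v z)
  - \sum_(T : tri S) \sum_i angle (g s T) i * v T (corner R i).
Proof.
rewrite big_distrr /= pair_bigA /=.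
rewrite (partition_big (@org S) xpredT)//= (bigID (mem (int_verts S)) xpredT) /= [X in _ - (_ + X)]big1.
  rewrite addr0 -sumrB; apply: eq_bigr => z _; rewrite /angle_defect mulrBl big_distrl /=.
  by congr (_ - _); apply: eq_bigr => h /eqP <-; rewrite vert_val_org.
move=> z nz; apply: big1 => h /eqP hz.
by rewrite -vert_val_org hz vert_val_bnd// mulr0.
Qed.

(** As [v] vanishes on boundary edges, the sum over sides of interior edges equals the sum over all
    sides. *)
Lemma edge_sum (s : R) : a < s < b ->
  \sum_(E in int_edges S) edge_integral (g s) E (fun h r =>
      jump (fun h' r' => geod_curv (g s h'.1) h'.2 (edge_pt h'.2 r')) h r * v h.1 (edge_pt h.2 r)) =
  \sum_(T : tri S) \sum_i
     \int[mu]_(r in I01) (geod_curv (g s T) i (edge_pt i r) * v T (edge_pt i r) * len (g s T) i r).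
Proof.
move=> sab; have [sm /(_ s sab)[_ tt]] := hg.
pose F h r := geod_curv (g s h.1) h.2 (edge_pt h.2 r) * v h.1 (edge_pt h.2 r) * len (g s h.1) h.2 r.
rewrite pair_bigA /= -(sum_int_sides (K := fun h => \int[mu]_(r in I01) F h r)).
  apply: eq_bigr => E; rewrite inE => /andP[eE _]; apply: edge_integral_sum => //.
    move=> h; have [U [oU TU sgU]] := sm h.1.
    exact: (geod_curv_integrable (g := tri_family h.1) oU TU sgU (@rg h.1) sab).
  move=> h r <- r01; rewrite /jump !big_distrl; apply: eq_bigr => h'; rewrite inE => /eqP hh' /=.
  by rewrite /F (V_single_valued v (esym hh') r01) (len_transfer tt (esym hh') r01).
move=> h hb; apply: Rintegral_eq0 => r /set_mem.
by rewrite /= in_itv /= /F => r01; rewrite (V_bnd0 v hb r01) mulr0 mul0r.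
Qed.

Lemma kappa_dist_tri_part s : a < s < b ->
  kappa_dist (g s) v = \sum_T tri_part (tri_family T) (v T) s
    + 2 * pi * (\sum_(z in int_verts S) vert_val v z).
Proof.
move=> sab; rewrite /kappa_dist edge_sum// vertex_sum.
under [in RHS]eq_bigr do rewrite tri_partE.
by rewrite sumrB big_split /= addrA addrAC.
Qed.

(** On each side sigma(tau, tau) is the time derivative of g(e, e) divided by g(e, e), and the
    values of g(e, e) from the two sides agree at all times near [t]. *)
Lemma sigma_tangential t h h' (r : R) : a < t < b -> edge_of h = edge_of h' -> 0 <= r <= 1 ->
  let r' := transfer h h' r in
  bil (time_deriv g t h.1 (edge_pt h.2 r)) (tau (g t h.1) h.2 (edge_pt h.2 r)) (tau (g t h.1) h.2 (edge_pt h.2 r))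
  = bil (time_deriv g t h'.1 (edge_pt h'.2 r')) (tau (g t h'.1) h'.2 (edge_pt h'.2 r'))
        (tau (g t h'.1) h'.2 (edge_pt h'.2 r')).
Proof.
move=> tab E r01 r'.
have [sm rt] := hg.
have [U [oU TU sgU]] := sm h.1; have [U' [oU' TU' sgU']] := sm h'.1.
have Tp := edge_pt_tri h.2 r01; have Tp' := edge_pt_tri h'.2 (transfer01 h h' r01).
rewrite (tau_ev (g := tri_family h.1) TU sgU (@rg h.1) tab Tp).
rewrite (tau_ev (g := tri_family h'.1) TU' sgU' (@rg h'.1) tab Tp').
have D := edge_length_time (g := tri_family h.1) oU TU sgU tab h.2 Tp.
have D' := edge_length_time (g := tri_family h'.1) oU' TU' sgU' tab h'.2 Tp'.
rewrite -!bil_ev; congr (_ / _); last by have [_ tt] := rt t tab; exact: tt.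
have nE : \forall s \near t, bil (g s h.1 (edge_pt h.2 r)) (edge_vec R h.2) (edge_vec R h.2) =
   bil (g s h'.1 (edge_pt h'.2 r')) (edge_vec R h'.2) (edge_vec R h'.2).
  have : \forall s \near t, s \in `]a, b[ by apply: near_in_itvoo; rewrite in_itv.
  by apply: filterS => s; rewrite in_itv /= => sab; have [_ tt] := rt s sab; exact: tt.
by have [_ <-] := near_eq_is_derive nE D; have [_ <-] := D'.
Qed.

(** Both sigma(tau, tau) and ds are single-valued on an edge, so they may be moved inside the jump,
    which then splits by side. *)
Lemma b_hE t : a < t < b -> b_h (g t) (time_deriv g t) v =
  \sum_T (tri_integral (g t) T (fun p =>
      inner2 (g t T) p (S_op (g t T) p (time_deriv g t T p)) (hess (g t T) (v T) p))
   + \sum_i \int[mu]_(r in I01) edge_load (tri_family T) t (v T) i r).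
Proof.
move=> tab; have [sm /(_ t tab)[_ tt]] := hg.
pose F h r := edge_load (tri_family h.1) t (v h.1) h.2 r.
rewrite big_split /= pair_bigA /= -(sum_sides (fun h => \int[mu]_(r in I01) F h r)); congr (_ + _).
apply: eq_bigr => E eE; apply: edge_integral_sum => //.
  move=> h; have [U [oU TU sgU]] := sm h.1.
  exact: (proj1 (edge_load_integral (g := tri_family h.1) oU TU sgU (@rg h.1) tab _ _)).
move=> h r <- r01; rewrite /jump big_distrr big_distrl; apply: eq_bigr => h'; rewrite inE => /eqP hh' /=.
by rewrite (sigma_tangential tab (esym hh') r01) (len_transfer tt (esym hh') r01).
Qed.

End Assembly.

Theorem theorem4p1 (R : realType) (S : triangulation) (a b : R)
    (g : R -> tri_metric R S) (hg : regge_family a b g) (v : V_space R S)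
    (t : R) (ht : a < t < b) :
  is_derive t 1 (fun s : R => kappa_dist (g s) v)
    (2^-1 * b_h (g t) (time_deriv g t) v).
Proof.
rewrite (b_hE hg v ht) big_distrr /=.
have D T : is_derive t 1 (tri_part (fun s => g s T) (v T)) (2^-1 * (tri_integral (g t) T (fun p =>
      inner2 (g t T) p (S_op (g t T) p (time_deriv g t T p)) (hess (g t T) (v T) p))
   + \sum_i \int[leb R]_(r in `[0, 1]) edge_load (fun s => g s T) t (v T) i r)).
  have [sm rt] := hg; have [U [oU TU sgU]] := sm T.
  exact: (tri_part_derive (g := fun s => g s T) oU TU sgU (fun s sab => proj1 (rt s sab) T) ht (v T)).
have nE : \forall s \near t, \sum_T tri_part (fun s => g s T) (v T) s
    + 2 * pi * (\sum_(z in int_verts S) vert_val v z) = kappa_dist (g s) v.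
  have : \forall s \near t, s \in `]a, b[ by apply: near_in_itvoo; rewrite in_itv.
  by apply: filterS => s; rewrite in_itv /= => sab; rewrite (kappa_dist_tri_part hg v sab).
apply: near_eq_is_derive nE _.
apply: is_derive_eq (addr0 _).
exact: is_deriveD (is_derive_bigsum (index_enum (tri S)) D) (is_derive_cst _ t 1).
Qed.
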